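(* Let $\bar x\in\mathcal F(\bar\omega)$. 1. If FOSCMS is fulfilled for $M_{\bar\omega}$ at $\bar x$ and RSSOSC holds at $\bar x$ for $P(\bar\omega)$, then there are neighborhoods $U$ of $\bar x$, $W$ of $\bar\omega$ and a constant $L>0$ such that $$(S_M(\omega)\cup S(\omega))\cap U\subset\bar x+L\tau_1(\omega)\mathcal B_{\mathbb R^n}\quad\forall\omega\in W.$$ In addition, if $\bar x$ is an essential local minimizer of second order for $P(\bar\omega)$ and either $T^{\rm lin}_{\bar\omega}(\bar x)\neq\{0\}$ or $M_{\bar\omega}$ is metrically regular around $(\bar x,0)$, then $X(\omega)\cap U\neq\emptyset$ for all $\omega\in W$. 2. If SOSCMS is fulfilled for $M_{\bar\omega}$ at $\bar x$ and $\bar x$ is an essential local minimizer of second order for $P(\bar\omega)$, then there are neighborhoods $U$ of $\bar x$, $W$ of $\bar\omega$ and a constant $L>0$ such that $$(S_M(\omega)\cup S(\omega))\cap U\subset\bar x+L\tau_2(\omega)\mathcal B_{\mathbb R^n}\quad\forall\omega\in W.$$ In addition, if either $T^{\rm lin}_{\bar\omega}(\bar x)\neq\{0\}$ or $M_{\bar\omega}$ is metrically regular around $(\bar x,0)$, then $X(\omega)\cap U\neq\emptyset$ for all $\omega\in W$.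
   Context: Setting. $\Omega$ is a topological space, $\bar\omega\in\Omega$, $\bar x\in\mathbb R^n$; $f:\mathbb R^n\times\Omega\to\mathbb R$ and $q:\mathbb R^n\times\Omega\to\mathbb R^m$ are continuous; $P=\bigcup_{i=1}^pP_i\subset\mathbb R^m$ is a finite union of convex polyhedra $P_i=\{y\mid a_{ij}^Ty\le b_{ij},\ j=1,\dots,m_i\}$. Problem $P(\omega)$: minimize $f(x,\omega)$ over $x$ subject to $q(x,\omega)\in P$; its feasible set is $\mathcal F(\omega):=\{x\mid q(x,\omega)\in P\}$. $M_\omega(x):=q(x,\omega)-P$. $\|\cdot\|$ is the Euclidean norm (and the associated operator norm), $\mathcal B_{\mathbb R^n}$ the closed unit ball, ${\rm d}(\cdot,\cdot)$ the distance to a set. Standing assumption. There are neighborhoods $U_0$ of $\bar x$ and $W_0$ of $\bar\omega$ such that $f$ and $q$ are twice partially differentiable with respect to $x$ on $U_0\times W_0$; $q,\nabla_xf,\nabla_xq,\nabla_x^2f,\nabla_x^2q$ are continuous at $(\bar x,\bar\omega)$; and $\nabla_x^2f(\cdot,\omega)$, $\nabla_x^2q(\cdot,\omega)$ are continuous on $U_0$ for every $\omega\in W_0$. Cones. For $\Gamma\subset\mathbb R^d$ and $x\in\Gamma$: $T(x;\Gamma):=\{u\mid\exists u_k\to u,\ t_k\downarrow0:\ x+t_ku_k\in\Gamma\}$; $\hat N(x;\Gamma):=\{\xi\mid\limsup_{x'\to x,\,x'\in\Gamma}\xi^T(x'-x)/\|x'-x\|\le0\}$; $N(x;\Gamma):=\{\xi\mid\exists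 x_k\to x,\ x_k\in\Gamma,\ \xi_k\to\xi:\ \xi_k\in\hat N(x_k;\Gamma)\}$; $N(x;\Gamma;u):=\{\xi\mid\exists t_k\downarrow0,\ u_k\to u,\ \xi_k\to\xi:\ \xi_k\in\hat N(x+t_ku_k;\Gamma)\ \forall k\}$. All are empty if the base point is not in $\Gamma$. $T^{\rm lin}_\omega(x):=\{u\mid\nabla_xq(x,\omega)u\in T(q(x,\omega);P)\}$. Solution maps. $X(\omega)$ is the set of local minimizers of $P(\omega)$; $S(\omega):=\{x\mid0\in\nabla_xf(x,\omega)+\hat N(x;\mathcal F(\omega))\}$; $S_M(\omega):=\{x\mid0\in\nabla_xf(x,\omega)+\nabla_xq(x,\omega)^TN(q(x,\omega);P)\}$ (only points near $\bar x$, where the derivatives exist, matter). For $l\in\{1,2\}$: $e_l(\omega):=\|\nabla_xq(\bar x,\omega)-\nabla_xq(\bar x,\bar\omega)\|+\|q(\bar x,\omega)-q(\bar x,\bar\omega)\|^{1/l}$ and $\tau_l(\omega):=\|\nabla_xf(\bar x,\omega)-\nabla_xf(\bar x,\bar\omega)\|+e_l(\omega)$. Metric regularity. $M_{\bar\omega}$ is metrically regular around $(\bar x,0)$ if there are $\kappa>0$ and neighborhoods $U'$ of $\bar x$, $V'$ of $0$ with ${\rm d}(x,M_{\bar\omega}^{-1}(y))\le\kappa\,{\rm d}(y,M_{\bar\omega}(x))$ for all $(x,y)\in U'\times V'$. FOSCMS for $M_{\bar\omega}$ at $\bar x$: for every $0\neq u\in T^{\rm lin}_{\bar\omega}(\bar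 x)$, [$\nabla_xq(\bar x,\bar\omega)^T\lambda=0$, $\lambda\in N(q(\bar x,\bar\omega);P;\nabla_xq(\bar x,\bar\omega)u)$] implies $\lambda=0$. SOSCMS for $M_{\bar\omega}$ at $\bar x$: for every $0\neq u\in T^{\rm lin}_{\bar\omega}(\bar x)$, [$\nabla_xq(\bar x,\bar\omega)^T\lambda=0$, $\lambda\in N(q(\bar x,\bar\omega);P;\nabla_xq(\bar x,\bar\omega)u)$, $u^T\nabla_x^2(\lambda^Tq)(\bar x,\bar\omega)u\ge0$] implies $\lambda=0$. RSSOSC at $\bar x$ for $P(\bar\omega)$: with $\mathcal L(x,\lambda,\omega):=f(x,\omega)+\lambda^Tq(x,\omega)$, the critical cone $\mathcal C_{\bar\omega}(\bar x):=\{u\in T^{\rm lin}_{\bar\omega}(\bar x)\mid\nabla_xf(\bar x,\bar\omega)u\le0\}$ and $\Lambda^1_{\bar\omega}(\bar x;u):=\{\lambda\in N(q(\bar x,\bar\omega);P;\nabla_xq(\bar x,\bar\omega)u)\mid\nabla_x\mathcal L(\bar x,\lambda,\bar\omega)=0\}$, one has $u^T\nabla_x^2\mathcal L(\bar x,\lambda,\bar\omega)u>0$ for all $0\neq u\in\mathcal C_{\bar\omega}(\bar x)$ and all $\lambda\in\Lambda^1_{\bar\omega}(\bar x;u)$. Essential local minimizer of second order: $\bar x\in\mathcal F(\bar\omega)$ is one for $P(\bar\omega)$ if there are a neighborhood $U'$ of $\bar x$ and $\eta>0$ with $\max\{f(x,\bar\omega)-f(\bar x,\bar\omega),\ {\rm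 d}(q(x,\bar\omega),P)\}\ge\eta\|x-\bar x\|^2$ for all $x\in U'$. *)

(* Defs.v *)
From HB Require Import structures.
From mathcomp Require Export all_boot all_order all_algebra.
From mathcomp Require Export all_classical all_reals all_analysis.

Set Implicit Arguments.
Unset Strict Implicit.
Unset Printing Implicit Defensive.

Import Order.TTheory GRing.Theory Num.Theory.
Import numFieldNormedType.Exports.

Local Open Scope classical_set_scope.
Local Open Scope ring_scope.

(* Vectors of R^n are row vectors and derivatives act on the right, as for the
   library's Jacobian: 'd G x u = u *m 'J G x.  Hence 'J G x is the transpose
   of the matrix usually written \nabla G(x), and \nabla G(x)^T lambda reads
   lambda *m ('J G x)^T. *)

Definition dotr (R : realType) n (u v : 'rV[R]_n) : R := (u *m v^T) 0 0.

(* The library's norm on matrices is the max norm (same topology). *)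
Definition enorm (R : realType) n (u : 'rV[R]_n) : R := Num.sqrt (dotr u u).

Definition eball (R : realType) n : set 'rV[R]_n := [set u | enorm u <= 1].

Definition opnorm (R : realType) n m (A : 'M[R]_(n, m)) : R :=
  sup [set enorm (u *m A) | u in @eball R n].

(* Extended-real valued, so that the distance to the empty set is +oo. *)
Definition edist (R : realType) n (x : 'rV[R]_n) (A : set 'rV[R]_n) : \bar R :=
  ereal_inf [set (enorm (x - y))%:E | y in A].

Definition grad (R : realType) n (g : 'rV[R]_n -> R) (x : 'rV[R]_n) : 'rV[R]_n :=
  \row_j 'D_(delta_mx 0 j) g x.

Definition hess (R : realType) n (g : 'rV[R]_n -> R) (x : 'rV[R]_n) : 'M[R]_n :=
  'J (grad g) x.

Definition qform (R : realType) n (A : 'M[R]_n) (u : 'rV[R]_n) : R :=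
  dotr (u *m A) u.

Definition coord (R : realType) n m (G : 'rV[R]_n -> 'rV[R]_m) (i : 'I_m)
  (x : 'rV[R]_n) : R := G x 0 i.

Definition polyhedron (R : realType) d (C : set 'rV[R]_d) : Prop :=
  exists (k : nat) (a : 'I_k -> 'rV[R]_d) (b : 'I_k -> R),
    C = [set y | forall j, dotr (a j) y <= b j].

Definition polyhedral_union (R : realType) d (P : set 'rV[R]_d) : Prop :=
  exists (p : nat) (C : 'I_p -> set 'rV[R]_d),
    (forall i, polyhedron (C i)) /\ P = \bigcup_i C i.

Definition standing_assumption (R : realType) n m (Omega : topologicalType)
    (f : 'rV[R]_n -> Omega -> R) (q : 'rV[R]_n -> Omega -> 'rV[R]_m)
    (xbar : 'rV[R]_n) (wbar : Omega) : Prop :=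
  exists (U0 : set 'rV[R]_n) (W0 : set Omega),
    [/\ nbhs xbar U0 /\ nbhs wbar W0,
        (forall x w, U0 x -> W0 w ->
           [/\ differentiable (f ^~ w) x, differentiable (grad (f ^~ w)) x,
               differentiable (q ^~ w) x
             & forall i, differentiable (grad (coord (q ^~ w) i)) x]),
        [/\ {for (xbar, wbar), continuous (fun z => q z.1 z.2)},
            {for (xbar, wbar), continuous (fun z => grad (f ^~ z.2) z.1)}
          & {for (xbar, wbar), continuous (fun z => 'J (q ^~ z.2) z.1)}],
        {for (xbar, wbar), continuous (fun z => hess (f ^~ z.2) z.1)} /\
        (forall i, {for (xbar, wbar),
           continuous (fun z => hess (coord (q ^~ z.2) i) z.1)})
      & forall w, W0 w ->
          {within U0, continuous (hess (f ^~ w))} /\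
          (forall i, {within U0, continuous (hess (coord (q ^~ w) i))})].

Definition tangent (R : realType) d (G : set 'rV[R]_d) (x : 'rV[R]_d) :
    set 'rV[R]_d :=
  [set u | G x /\ exists (t : nat -> R) (v : nat -> 'rV[R]_d),
     [/\ (forall k, 0 < t k), t @ \oo --> (0 : R), v @ \oo --> u
       & forall k, G (x + t k *: v k)]].

Definition regular_normal (R : realType) d (G : set 'rV[R]_d) (x : 'rV[R]_d) :
    set 'rV[R]_d :=
  [set xi | G x /\
     (limf_esup (fun y : 'rV[R]_d => (dotr xi (y - x) / enorm (y - x))%:E)
        (within G x^') <= 0)%E].

Definition limiting_normal (R : realType) d (G : set 'rV[R]_d) (x : 'rV[R]_d) :
    set 'rV[R]_d :=
  [set xi | G x /\ exists (y eta : nat -> 'rV[R]_d),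
     [/\ y @ \oo --> x, eta @ \oo --> xi
       & forall k, regular_normal G (y k) (eta k)]].

Definition dir_normal (R : realType) d (G : set 'rV[R]_d) (x u : 'rV[R]_d) :
    set 'rV[R]_d :=
  [set xi | G x /\ exists (t : nat -> R) (v eta : nat -> 'rV[R]_d),
     [/\ (forall k, 0 < t k) /\ t @ \oo --> (0 : R), v @ \oo --> u,
         eta @ \oo --> xi
       & forall k, regular_normal G (x + t k *: v k) (eta k)]].

(* Below, g and G stand for f(., omega) and q(., omega) at a fixed omega. *)

Definition feasible (R : realType) n m (G : 'rV[R]_n -> 'rV[R]_m)
    (P : set 'rV[R]_m) : set 'rV[R]_n := [set x | P (G x)].

Definition Tlin (R : realType) n m (G : 'rV[R]_n -> 'rV[R]_m)
    (P : set 'rV[R]_m) (x : 'rV[R]_n) : set 'rV[R]_n :=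
  [set u | tangent P (G x) (u *m 'J G x)].

Definition local_minimizers (R : realType) n m (g : 'rV[R]_n -> R)
    (G : 'rV[R]_n -> 'rV[R]_m) (P : set 'rV[R]_m) : set 'rV[R]_n :=
  [set x | feasible G P x /\
     \forall y \near x, feasible G P y -> g x <= g y].

Definition stationary (R : realType) n m (g : 'rV[R]_n -> R)
    (G : 'rV[R]_n -> 'rV[R]_m) (P : set 'rV[R]_m) : set 'rV[R]_n :=
  [set x | exists2 xi, regular_normal (feasible G P) x xi & 0 = grad g x + xi].

Definition M_stationary (R : realType) n m (g : 'rV[R]_n -> R)
    (G : 'rV[R]_n -> 'rV[R]_m) (P : set 'rV[R]_m) : set 'rV[R]_n :=
  [set x | exists2 lambda, limiting_normal P (G x) lambda
             & 0 = grad g x + lambda *m ('J G x)^T].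

Definition constraint_map (R : realType) n m (G : 'rV[R]_n -> 'rV[R]_m)
    (P : set 'rV[R]_m) (x : 'rV[R]_n) : set 'rV[R]_m :=
  [set G x - y | y in P].

Definition metrically_regular (R : realType) n m
    (M : 'rV[R]_n -> set 'rV[R]_m) (x0 : 'rV[R]_n) (y0 : 'rV[R]_m) : Prop :=
  exists (kappa : R) (U : set 'rV[R]_n) (V : set 'rV[R]_m),
    [/\ 0 < kappa, nbhs x0 U, nbhs y0 V
      & forall x y, U x -> V y ->
          (edist x [set z | M z y] <= kappa%:E * edist y (M x))%E].

Definition FOSCMS (R : realType) n m (G : 'rV[R]_n -> 'rV[R]_m)
    (P : set 'rV[R]_m) (x : 'rV[R]_n) : Prop :=
  forall u, u != 0 -> Tlin G P x u ->
    forall lambda, lambda *m ('J G x)^T = 0 ->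
      dir_normal P (G x) (u *m 'J G x) lambda -> lambda = 0.

Definition SOSCMS (R : realType) n m (G : 'rV[R]_n -> 'rV[R]_m)
    (P : set 'rV[R]_m) (x : 'rV[R]_n) : Prop :=
  forall u, u != 0 -> Tlin G P x u ->
    forall lambda, lambda *m ('J G x)^T = 0 ->
      dir_normal P (G x) (u *m 'J G x) lambda ->
      0 <= qform (hess (fun y => dotr lambda (G y)) x) u -> lambda = 0.

Definition lagrangian (R : realType) n m (g : 'rV[R]_n -> R)
    (G : 'rV[R]_n -> 'rV[R]_m) (lambda : 'rV[R]_m) (x : 'rV[R]_n) : R :=
  g x + dotr lambda (G x).

Definition critical_cone (R : realType) n m (g : 'rV[R]_n -> R)
    (G : 'rV[R]_n -> 'rV[R]_m) (P : set 'rV[R]_m) (x : 'rV[R]_n) :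
    set 'rV[R]_n :=
  [set u | Tlin G P x u /\ dotr (grad g x) u <= 0].

Definition multipliers (R : realType) n m (g : 'rV[R]_n -> R)
    (G : 'rV[R]_n -> 'rV[R]_m) (P : set 'rV[R]_m) (x u : 'rV[R]_n) :
    set 'rV[R]_m :=
  [set lambda | dir_normal P (G x) (u *m 'J G x) lambda /\
                grad (lagrangian g G lambda) x = 0].

Definition RSSOSC (R : realType) n m (g : 'rV[R]_n -> R)
    (G : 'rV[R]_n -> 'rV[R]_m) (P : set 'rV[R]_m) (x : 'rV[R]_n) : Prop :=
  forall u, u != 0 -> critical_cone g G P x u ->
    forall lambda, multipliers g G P x u lambda ->
      0 < qform (hess (lagrangian g G lambda) x) u.

Definition ess_local_min2 (R : realType) n m (g : 'rV[R]_n -> R)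
    (G : 'rV[R]_n -> 'rV[R]_m) (P : set 'rV[R]_m) (x0 : 'rV[R]_n) : Prop :=
  feasible G P x0 /\
  exists (eta : R) (U : set 'rV[R]_n),
    [/\ 0 < eta, nbhs x0 U
      & forall x, U x ->
          ((eta * enorm (x - x0) ^+ 2)%:E
             <= maxe (g x - g x0)%:E (edist (G x) P))%E].

Definition e_ (R : realType) n m (Omega : topologicalType)
    (q : 'rV[R]_n -> Omega -> 'rV[R]_m) (xbar : 'rV[R]_n) (wbar : Omega)
    (l : nat) (w : Omega) : R :=
  opnorm ('J (q ^~ w) xbar - 'J (q ^~ wbar) xbar)
  + enorm (q xbar w - q xbar wbar) `^ (l%:R^-1).

Definition tau_ (R : realType) n m (Omega : topologicalType)
    (f : 'rV[R]_n -> Omega -> R) (q : 'rV[R]_n -> Omega -> 'rV[R]_m)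
    (xbar : 'rV[R]_n) (wbar : Omega) (l : nat) (w : Omega) : R :=
  enorm (grad (f ^~ w) xbar - grad (f ^~ wbar) xbar) + e_ q xbar wbar l w.

Definition ball_at (R : realType) n (xbar : 'rV[R]_n) (r : R) : set 'rV[R]_n :=
  [set xbar + r *: b | b in @eball R n].

(* Main.v *)
Require Import Defs.
From mathcomp Require Import all_boot all_order all_algebra.
From mathcomp Require Import all_classical all_reals all_analysis.
From mathcomp Require Import ring lra.
Import Order.TTheory GRing.Theory Num.Theory.
Import numFieldNormedType.Exports.
Local Open Scope classical_set_scope.
Local Open Scope ring_scope.

(** Both stability estimates are proved by contradiction. If no constant [L]
works, there are parameters [w] close to [wbar] and stationary points [x] close
to [xbar], [x <> xbar], such that [tau_l w] is of smaller order than
[t = |x - xbar|]. All perturbations of the data at [xbar] are then negligible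
against the second-order Taylor expansion of [f] and [q] in [x]: those of the
derivatives are [o(t)], that of [q] is [o(t^l)]. Limits are taken along an
ultrafilter ([failure_net]), which makes every bounded quantity convergent;
[Omega] need not have countable bases, so that sequences of parameters would
not do. The displacements [x - xbar] divided by [t] tend to some [u <> 0].

The two kinds of stationary points have one common consequence, which requires
no constraint qualification: arbitrarily close to [x] there are [x'] and
[y] in [P] with [q x'] close to [y], and a regular normal [mu] to [P] at [y],
such that the KKT equation holds at [x'] with multiplier [mu] up to a small
error ([asymptotically_stationary]). For M-stationary points this is the
definition of limiting normals. For a regular normal to the feasible set it
follows from quadratic penalisation ([regular_normal_feasible]). All tolerances
are taken equal to [t^3], so that they do not interfere with second-order
expansions. It follows that [u] lies in [T^lin] and that limits of normals
at the points [y] are normals in direction [u *m J].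

Polyhedrality enters in one way ([polyhedral_classes]): along the ultrafilter
all points [y] satisfy the same constraints, with equality for the same ones,
so that the normals at one of them are orthogonal to the displacements
[y' - ybar] of all others, and hence also to their limit direction [u *m J].

Either the multipliers are unbounded along the ultrafilter, or they converge
([multiplier_dichotomy]).
- In the first case, normalising them yields a directional normal [lam <> 0]
  with [lam *m J^T = 0], in contradiction with FOSCMS. In the second part, where
  the perturbation of [q] is [o(t^2)], orthogonality and the expansion of [q]
  show moreover that the quadratic form of the Hessian of [lam q] vanishes at
  [u] ([curvature_residual]), in contradiction with SOSCMS.
- In the second case, the limit [lam] is a multiplier in direction [u], [u] is
  critical, and testing the KKT equation with [u] shows that the quadratic form
  of the Hessian of the Lagrangian vanishes at [u] ([bounded_multipliers]). This
  contradicts RSSOSC.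
  In the second part it contradicts quadratic growth: at the points [x'] the
  distance of [q x' wbar] to [P] is [o(t^2)], so that [f x' wbar - f xbar wbar]
  is at least [eta |x' - xbar|^2], whereas its expansion, rewritten with [lam], is
  [o(t^2)].

For the existence of local minimisers, feasible points are found close to
[xbar + t *: v] for small [t], where [v] is a nonzero element of [T^lin], or
[v = 0] under metric regularity ([feasible_along]). If there were none,
minimising the distance of [q x w] to [P] plus a small multiple of the distance
of [x] to [xbar + t *: v] would produce unit normals, namely the normalised
residuals, that are almost annihilated by the adjoint Jacobian. Their limit
[lam] contradicts metric regularity if [v = 0]. If [v <> 0], the residuals form
small angles with [lam], whence the Hessian of [lam q] at [v] is nonnegative and
SOSCMS is violated. Once there are feasible points, minimisers of [f] over the
feasible part of a small ball around [xbar] tend to [xbar] by quadratic growth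
([local_minimizer_nearby]). *)

Set Implicit Arguments.
Unset Strict Implicit.
Unset Printing Implicit Defensive.

(** * The Euclidean inner product and limits of matrices *)

Section InnerProduct.
Context {R : realType}.

Lemma dotrE n (u v : 'rV[R]_n) : dotr u v = \sum_j u 0 j * v 0 j.
Proof. by rewrite /dotr mxE; apply: eq_bigr => j _; rewrite mxE. Qed.

Lemma dotrC n (u v : 'rV[R]_n) : dotr u v = dotr v u.
Proof. by rewrite !dotrE; apply: eq_bigr => j _; rewrite mulrC. Qed.

Lemma dotrDl n (u v w : 'rV[R]_n) : dotr (u + v) w = dotr u w + dotr v w.
Proof. by rewrite /dotr mulmxDl mxE. Qed.

Lemma dotrDr n (u v w : 'rV[R]_n) : dotr w (u + v) = dotr w u + dotr w v.
Proof. by rewrite dotrC dotrDl !(dotrC w). Qed.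

Lemma dotrZl n a (u v : 'rV[R]_n) : dotr (a *: u) v = a * dotr u v.
Proof. by rewrite /dotr -scalemxAl mxE. Qed.

Lemma dotrZr n a (u v : 'rV[R]_n) : dotr u (a *: v) = a * dotr u v.
Proof. by rewrite dotrC dotrZl dotrC. Qed.

Lemma dotrNl n (u v : 'rV[R]_n) : dotr (- u) v = - dotr u v.
Proof. by rewrite -scaleN1r dotrZl mulN1r. Qed.

Lemma dotrNr n (u v : 'rV[R]_n) : dotr u (- v) = - dotr u v.
Proof. by rewrite dotrC dotrNl dotrC. Qed.

Lemma dotrBl n (u v w : 'rV[R]_n) : dotr (u - v) w = dotr u w - dotr v w.
Proof. by rewrite dotrDl dotrNl. Qed.

Lemma dotrBr n (u v w : 'rV[R]_n) : dotr w (u - v) = dotr w u - dotr w v.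
Proof. by rewrite dotrDr dotrNr. Qed.

Lemma dotr0l n (u : 'rV[R]_n) : dotr 0 u = 0.
Proof. by rewrite /dotr mul0mx mxE. Qed.

Lemma dotr0r n (u : 'rV[R]_n) : dotr u 0 = 0.
Proof. by rewrite dotrC dotr0l. Qed.

Lemma dotr_mulmx n m (u : 'rV[R]_n) (A : 'M[R]_(n, m)) (v : 'rV[R]_m) :
  dotr (u *m A) v = dotr u (v *m A^T).
Proof. by rewrite /dotr trmx_mul trmxK mulmxA. Qed.

Lemma dotr_delta n (u : 'rV[R]_n) j : dotr u (delta_mx 0 j) = u 0 j.
Proof.
rewrite dotrE (bigD1 j)//= mxE !eqxx mulr1 big1 ?addr0// => i ij.
by rewrite mxE eqxx/= (negPf ij) mulr0.
Qed.

Lemma dotr_ge0 n (u : 'rV[R]_n) : 0 <= dotr u u.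
Proof. by rewrite dotrE sumr_ge0// => j _; rewrite -expr2 sqr_ge0. Qed.

Lemma enorm_ge0 n (u : 'rV[R]_n) : 0 <= enorm u.
Proof. exact: sqrtr_ge0. Qed.

Lemma sqr_enorm n (u : 'rV[R]_n) : enorm u ^+ 2 = dotr u u.
Proof. by rewrite sqr_sqrtr// dotr_ge0. Qed.

Lemma enormN n (u : 'rV[R]_n) : enorm (- u) = enorm u.
Proof. by rewrite /enorm dotrNl dotrNr opprK. Qed.

Lemma enormZ n a (u : 'rV[R]_n) : enorm (a *: u) = `|a| * enorm u.
Proof.
by rewrite /enorm dotrZl dotrZr mulrA -expr2 sqrtrM ?sqr_ge0// sqrtr_sqr.
Qed.

Lemma entry_le_norm n m (A : 'M[R]_(n, m)) i j : `|A i j| <= `|A|.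
Proof.
rewrite [leRHS]/Num.Def.normr/= mx_normrE.
exact: (le_bigmax _ (fun ij : 'I_n * 'I_m => `|A ij.1 ij.2|) (i, j)).
Qed.

Lemma norm_le_entries n m (A : 'M[R]_(n, m)) (e : R) : 0 <= e ->
  (forall i j, `|A i j| <= e) -> `|A| <= e.
Proof.
by move=> e0 Ae; rewrite [leLHS]/Num.Def.normr/= mx_normrE bigmax_le.
Qed.

Lemma norm_dotr n (u v : 'rV[R]_n) : `|dotr u v| <= n%:R * (`|u| * `|v|).
Proof.
rewrite dotrE (le_trans (ler_norm_sum _ _ _))//.
rewrite (le_trans (ler_sum _ (G := fun=> `|u| * `|v|) _))//.
  by move=> j _; rewrite normrM ler_pM ?entry_le_norm.
by rewrite sumr_const card_ord mulr_natl.
Qed.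

Lemma norm_mulmx n m (u : 'rV[R]_n) (A : 'M[R]_(n, m)) :
  `|u *m A| <= n%:R * (`|u| * `|A|).
Proof.
apply: norm_le_entries => [|i j]; first by rewrite !mulr_ge0.
rewrite mxE (le_trans (ler_norm_sum _ _ _))//.
rewrite (le_trans (ler_sum _ (G := fun=> `|u| * `|A|) _))//.
  by move=> k _; rewrite normrM ler_pM ?entry_le_norm.
by rewrite sumr_const card_ord mulr_natl.
Qed.

Lemma norm_le_enorm n (u : 'rV[R]_n) : `|u| <= enorm u.
Proof.
apply: norm_le_entries => [|i j]; first exact: enorm_ge0.
rewrite -(@ler_pXn2r _ 2) ?nnegrE ?enorm_ge0// sqr_enorm ord1 -normrX ger0_norm ?sqr_ge0//.
rewrite dotrE (bigD1 j)//= -expr2 lerDl sumr_ge0// => k _.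
by rewrite -expr2 sqr_ge0.
Qed.

Lemma enorm_le_norm n (u : 'rV[R]_n) : enorm u <= n.+1%:R * `|u|.
Proof.
rewrite -(@ler_pXn2r _ 2) ?nnegrE ?enorm_ge0 ?mulr_ge0// sqr_enorm.
apply: le_trans (le_trans (ler_norm _) (norm_dotr u u)) _.
rewrite -expr2 exprMn ler_wpM2r ?sqr_ge0// -natrX ler_nat.
by rewrite expnS expn1 (leq_trans (leqnSn n))// leq_pmulr.
Qed.

Lemma dotr_eq0 n (u : 'rV[R]_n) : dotr u u = 0 -> u = 0.
Proof.
move=> u0; apply/eqP; rewrite -normr_eq0 eq_le normr_ge0 andbT.
by rewrite (le_trans (norm_le_enorm u))// /enorm u0 sqrtr0.
Qed.

Lemma enorm_gt0 n (u : 'rV[R]_n) : u != 0 -> 0 < enorm u.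
Proof. by rewrite -normr_gt0 => u0; rewrite (lt_le_trans u0)// norm_le_enorm. Qed.

End InnerProduct.

Section MatrixLimits.
Context {R : realType} {I : Type} (F : set_system I).
Context {FF : Filter F}.

Lemma cvg_entry n m (A : I -> 'M[R]_(n, m)) (L : 'M[R]_(n, m)) i j :
  A k @[k --> F] --> L -> A k i j @[k --> F] --> L i j.
Proof. by move=> AL; apply: (continuous_cvg _ (@coord_continuous _ n m i j L)). Qed.

Lemma cvg_entries n m (A : I -> 'M[R]_(n, m)) (L : 'M[R]_(n, m)) :
  (forall i j, A k i j @[k --> F] --> L i j) -> A k @[k --> F] --> L.
Proof.
move=> AL; apply/cvgrPdist_le => e e0; near=> k.
apply: norm_le_entries => [|i j]; first exact: ltW.
rewrite !mxE; move: i j; near: k.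
apply: filter_forall => i; apply: filter_forall => j.
by move/cvgrPdist_le : (AL i j); exact.
Unshelve. all: by end_near. Qed.

Lemma cvg_finsum J (r : seq J) (f : J -> I -> R) (l : J -> R) :
  (forall j, f j k @[k --> F] --> l j) ->
  \sum_(j <- r) f j k @[k --> F] --> \sum_(j <- r) l j.
Proof.
move=> fl; elim: r => [|j r IH].
  by rewrite big_nil; under eq_fun do rewrite big_nil; exact: cvg_cst.
by rewrite big_cons; under eq_fun do rewrite big_cons; exact: cvgD.
Qed.

Lemma cvg_mulmx n m p (A : I -> 'M[R]_(n, m)) (B : I -> 'M[R]_(m, p))
    (L : 'M[R]_(n, m)) (M : 'M[R]_(m, p)) :
  A k @[k --> F] --> L -> B k @[k --> F] --> M ->
  (A k *m B k) @[k --> F] --> L *m M.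
Proof.
move=> AL BM; apply: cvg_entries => i j.
rewrite mxE; under eq_fun do rewrite mxE.
by apply: cvg_finsum => l; apply: cvgM; exact: cvg_entry.
Qed.

Lemma cvg_trmx n m (A : I -> 'M[R]_(n, m)) (L : 'M[R]_(n, m)) :
  A k @[k --> F] --> L -> (A k)^T @[k --> F] --> L^T.
Proof.
move=> AL; apply: cvg_entries => i j.
by rewrite mxE; under eq_fun do rewrite mxE; exact: cvg_entry.
Qed.

Lemma cvg_dotr n (u v : I -> 'rV[R]_n) (a b : 'rV[R]_n) :
  u k @[k --> F] --> a -> v k @[k --> F] --> b ->
  dotr (u k) (v k) @[k --> F] --> dotr a b.
Proof.
by move=> ua vb; apply: cvg_entry; apply: cvg_mulmx => //; exact: cvg_trmx.
Qed.

Lemma cvg_enorm n (u : I -> 'rV[R]_n) (a : 'rV[R]_n) :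
  u k @[k --> F] --> a -> enorm (u k) @[k --> F] --> enorm a.
Proof.
move=> ua; apply: (continuous_cvg _ (@sqrt_continuous _ _)).
exact: cvg_dotr.
Qed.

Lemma cvg_near_eq (T : topologicalType) (A B : I -> T) (l : T) :
  (\forall k \near F, A k = B k) -> A k @[k --> F] --> l -> B k @[k --> F] --> l.
Proof. by move=> AB; apply: cvg_trans; exact: near_eq_cvg. Qed.

Lemma cvg_of_quotient (V : normedModType R) (t : I -> R) (E : I -> V) (a l : V) :
  (\forall k \near F, 0 < t k) -> t k @[k --> F] --> (0 : R) ->
  (t k)^-1 *: (E k - a) @[k --> F] --> l -> E k @[k --> F] --> a.
Proof.
move=> t_gt0 t0 El.
have lim : t k *: ((t k)^-1 *: (E k - a)) + a @[k --> F] --> 0 *: l + a.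
  by apply: cvgD; [exact: cvgZ|exact: cvg_cst].
rewrite scale0r add0r in lim; apply: cvg_near_eq lim.
apply: filterS t_gt0 => k tk.
by rewrite scalerA mulfV ?gt_eqF// scale1r subrK.
Qed.

(** Serves to pass from an error [o(t^2)] to an error [o(t)]. *)
Lemma cvg_lower_quotient (V : normedModType R) (t : I -> R) (E : I -> V) (l : V) :
  (\forall k \near F, 0 < t k) -> t k @[k --> F] --> (0 : R) ->
  (t k ^+ 2)^-1 *: E k @[k --> F] --> l -> (t k)^-1 *: E k @[k --> F] --> (0 : V).
Proof.
move=> t_gt0 t0 El.
have lim : t k *: ((t k ^+ 2)^-1 *: E k) @[k --> F] --> 0 *: l by exact: cvgZ.
rewrite scale0r in lim; apply: cvg_near_eq lim; apply: filterS t_gt0 => k tk.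
by rewrite scalerA expr2 invfM mulrA mulfV ?gt_eqF// mul1r.
Qed.

End MatrixLimits.

(** * Ultrafilters instead of subsequences *)

Section Ultrafilters.

Lemma ultra_fmap I T (G : set_system I) (u : I -> T) :
  UltraFilter G -> UltraFilter (u @ G).
Proof.
move=> GU; split; first exact: fmap_proper_filter.
move=> H HF GH; rewrite eqEsubset; split => // A HA.
have [//|GnA] := in_ultra_setVsetC (u @^-1` A) GU.
have /filter_ex [x []//] : H (A `&` ~` A) by apply: filterI => //; exact: GH.
Qed.

(** Replaces the extraction of convergent subsequences. *)
Lemma ultra_cvg_compact I (T : topologicalType) (G : set_system I)
    (u : I -> T) (A : set T) :
  UltraFilter G -> compact A -> (\forall k \near G, A (u k)) ->
  exists2 l, A l & u k @[k --> G] --> l.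
Proof.
move=> GU; rewrite compact_ultra => cA Au.
by have [l [Al ul]] := cA _ (ultra_fmap u GU) Au; exists l.
Qed.

Lemma compact_normed_ball (R : realType) n (M : R) (x : 'rV[R]_n) :
  compact [set v : 'rV[R]_n | `|v - x| <= M].
Proof.
apply: bounded_closed_compact.
  exists (`|x| + M); split; first exact: num_real.
  move=> N MN v /= vM; rewrite ltW// (le_lt_trans _ MN)//.
  by rewrite -(subrK x v) addrC (le_trans (ler_normD _ _))// lerD2l.
have cf : continuous (fun v : 'rV[R]_n => `|v - x|).
  move=> v; exact: cvg_norm (cvgB cvg_id (cvg_cst _)).
exact: (preimage_closed (fun v _ => cf v) (@closed_le R M)).
Qed.

Lemma ultra_cvg_bounded (R : realType) I (G : set_system I) n
    (u : I -> 'rV[R]_n) (M : R) :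
  UltraFilter G -> (\forall k \near G, `|u k| <= M) ->
  exists l : 'rV[R]_n, u k @[k --> G] --> l.
Proof.
move=> GU uM; have [|l _ ul] := @ultra_cvg_compact _ _ G u _ GU
  (@compact_normed_ball R n M 0); last by exists l.
by apply: filterS uM => k /=; rewrite subr0.
Qed.

(** Turns the failure of an eventual property into an ultrafilter along which
its negation always holds; every proof by contradiction below starts here. *)
Lemma frequently_ultra T (F : set_system T) (A : set T) :
  Filter F -> (forall B, F B -> A `&` B !=set0) ->
  exists G, [/\ UltraFilter G, F `<=` G & G A].
Proof.
move=> FF AF.
have WP : ProperFilter (within A F).
  apply: Build_ProperFilter => //= WA0.
  by have [x [Ax /(_ Ax)]] := AF _ WA0.
have [G [GU WG]] := ultraFilterLemma WP; exists G; split => //.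
  by move=> B FB; apply: WG; apply: filterS FB => x Bx _.
by apply: WG; exact: withinT.
Qed.

(** Replaces the passage to a subsequence on which a finite classification is
constant. *)
Lemma ultra_finite I (T : finType) (G : set_system I) (c : I -> T) :
  UltraFilter G -> exists x, \forall k \near G, c k = x.
Proof.
move=> GU; apply: contrapT => /forallNP nx.
have : \forall k \near G, forall x, c k <> x.
  apply: filter_forall => x.
  by have [/nx//|] := in_ultra_setVsetC [set k | c k = x] GU.
by move=> /filter_ex[k /(_ (c k))].
Qed.

End Ultrafilters.

(** * Normal cones of finite unions of polyhedra *)

Lemma near_seq_all (T : eqType) (I : Type) (F : set_system I) (s : seq T)
    (Q : T -> I -> Prop) : Filter F ->
  (forall x, x \in s -> \forall i \near F, Q x i) ->
  \forall i \near F, forall x, x \in s -> Q x i.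
Proof.
move=> FF; elim: s => [|x s IH] sQ; first by apply: nearW.
have [] := (IH _, sQ x (mem_head _ _)).
  by move=> y ys; apply: sQ; rewrite in_cons ys orbT.
move=> /[swap]; apply: filterS2 => i Qx Qs y.
by rewrite in_cons => /predU1P[->//|]; exact: Qs.
Qed.

Section NormalCones.
Context {R : realType} {d : nat}.
Implicit Types (P : set 'rV[R]_d) (x y z v xi : 'rV[R]_d).

(** All norms being equivalent, the Euclidean norm of the definition may be
replaced by the maximum norm, which generates the topology. *)
Lemma regular_normalP P x xi : regular_normal P x xi <->
  P x /\ forall e, 0 < e ->
    \forall y \near x, P y -> dotr xi (y - x) <= e * `|y - x|.
Proof.
split=> [[Px xi_le0]|[Px xi_le]]; split=> //.
  move=> e e0; have e'0 : 0 < e / d.+1%:R by rewrite divr_gt0.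
  have : (limf_esup (fun y => (dotr xi (y - x) / enorm (y - x))%:E)
      (within P x^') < (e / d.+1%:R)%:E)%E by rewrite (le_lt_trans xi_le0).
  rewrite limf_esupE => /ereal_inf_lt[_ [V PV <-]] supV.
  have {PV} : \forall y \near x, y != x -> P y -> V y by exact: PV.
  apply: filterS => y yV Py.
  have [->|yx] := eqVneq y x; first by rewrite subrr dotr0r normr0 mulr0.
  have nyx : 0 < enorm (y - x) by rewrite enorm_gt0// subr_eq0.
  have : dotr xi (y - x) / enorm (y - x) <= e / d.+1%:R.
    rewrite -lee_fin (le_trans _ (ltW supV))// ereal_sup_ubound//.
    by exists y => //; exact: yV.
  rewrite ler_pdivrMr// => /le_trans; apply.
  rewrite -mulrA ler_pM2l// ler_pdivrMl//; exact: enorm_le_norm.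
apply/lee_addgt0Pr => e e0; rewrite add0e limf_esupE.
pose V := [set y | y != x /\ P y /\ dotr xi (y - x) <= e * `|y - x|].
apply: (@le_trans _ _ (ereal_sup
  ((fun y => (dotr xi (y - x) / enorm (y - x))%:E) @` V))).
  apply: ereal_inf_lbound; exists V => //.
  have := xi_le _ e0; apply: filterS => y ey yx Py; split => //; split => //.
  exact: ey.
apply: ge_ereal_sup => _ [y [yx [Py xiy]] <-]; rewrite lee_fin.
have nyx : 0 < enorm (y - x) by rewrite enorm_gt0// subr_eq0.
by rewrite ler_pdivrMr// (le_trans xiy)// ler_pM2l// norm_le_enorm.
Qed.

Lemma regular_normal_mem P x xi : regular_normal P x xi -> P x.
Proof. by case. Qed.

Lemma regular_normalZ P x xi (a : R) :
  0 < a -> regular_normal P x xi -> regular_normal P x (a *: xi).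
Proof.
move=> a0 /regular_normalP[Px xi_le]; apply/regular_normalP; split=> // e e0.
have := xi_le (e / a) (divr_gt0 e0 a0); apply: filterS => y + Py => /(_ Py).
by rewrite dotrZl mulrAC ler_pdivlMr// mulrC.
Qed.

Lemma cvg_ray x v : x + s *: v @[s --> 0^'+] --> x.
Proof.
have : x + s *: v @[s --> 0^'+] --> x + 0 *: v.
  apply: cvgD; first exact: cvg_cst.
  by apply: cvgZr_tmp; apply: cvg_at_right_filter; exact: cvg_id.
by rewrite scale0r addr0.
Qed.

Lemma regular_normal_le0 P x xi v : regular_normal P x xi ->
  (\forall s \near 0^'+, P (x + s *: v)) -> dotr xi v <= 0.
Proof.
move=> /regular_normalP[Px xi_le] Pxv.
have v1 : 0 < `|v| + 1 by rewrite ltr_wpDl.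
apply/ler_addgt0Pr => e e0; rewrite add0r.
have xiv : \forall s \near 0^'+,
    P (x + s *: v) -> dotr xi (s *: v) <= e / (`|v| + 1) * `|s *: v|.
  have : \forall s \near 0^'+, P (x + s *: v) ->
      dotr xi (x + s *: v - x) <= e / (`|v| + 1) * `|x + s *: v - x|.
    exact: (@cvg_ray x v _ (xi_le _ (divr_gt0 e0 v1))).
  by apply: filterS => s; rewrite [x + _]addrC addrK.
near (0 : R)^'+ => s.
have s0 : 0 < s by near: s; exact: nbhs_right_gt.
have Pv : P (x + s *: v) by near: s.
have : dotr xi (s *: v) <= e / (`|v| + 1) * `|s *: v| by move: Pv; near: s.
rewrite dotrZr normrZ gtr0_norm// mulrCA ler_pM2l// => /le_trans; apply.
by rewrite -mulrA ler_piMr ?(ltW e0)// ler_pdivrMl// mulr1 lerDl.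
Unshelve. all: by end_near. Qed.

(** With [a = w - y] and [b = z - y], minimality reads
[2 (a . b) <= b . b], and the right-hand side is [o(|b|)]. *)
Lemma regular_normal_proj P (w y : 'rV[R]_d) : P y ->
  (\forall z \near y, P z -> dotr (w - y) (w - y) <= dotr (w - z) (w - z)) ->
  regular_normal P y (w - y).
Proof.
move=> Py ymin; apply/regular_normalP; split=> // e e0.
have : \forall z \near y, `|z - y| <= e / d.+1%:R.
  apply/nbhs_normP; exists (e / d.+1%:R) => /=; first by rewrite divr_gt0.
  by move=> z /= /ltW; rewrite distrC.
apply: filterS2 ymin => z ymin zy Pz; have {ymin} := ymin Pz.
rewrite (_ : w - z = (w - y) - (z - y)); last by rewrite opprB addrA subrK.
move: (w - y) (z - y) zy => a b zy.
rewrite !(dotrBl, dotrBr) (dotrC b a) => ab.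
have ab2 : dotr a b <= dotr b b.
  by have := dotr_ge0 b; move: ab; lra.
rewrite (le_trans ab2)// (le_trans (ler_norm _))// (le_trans (norm_dotr _ _))//.
rewrite mulrA ler_wpM2r//.
rewrite (@le_trans _ _ (d.+1%:R * `|b|))// ?ler_wpM2r ?ler_nat//.
by rewrite -ler_pdivlMl// mulrC.
Qed.

(** Encodes a polyhedral union by the lists of the constraints of its members,
which allows to classify points by bit vectors. *)
Lemma polyhedral_unionE P : polyhedral_union P ->
  exists ss : seq (seq ('rV[R]_d * R)), forall y,
    P y <-> exists2 s, s \in ss & forall ab, ab \in s -> dotr ab.1 y <= ab.2.
Proof.
move=> [p [C [Cpoly ->]]].
have /choice[s sP] i : exists s : seq ('rV[R]_d * R), forall y,
    C i y <-> forall ab, ab \in s -> dotr ab.1 y <= ab.2.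
  have [k [a [b ->]]] := Cpoly i.
  exists [seq (a j, b j) | j <- enum 'I_k] => y; split=> [Cy _ /mapP[j _ ->]|Cy j].
    exact: Cy.
  by apply: (Cy (a j, b j)); apply: map_f; rewrite mem_enum.
exists [seq s i | i <- enum 'I_p] => y; split.
  move=> [i _ /sP Ciy]; exists (s i) => //.
  by apply: map_f; rewrite mem_enum.
by move=> [_ /mapP[i _ ->] /sP Ciy]; exists i.
Qed.

Lemma continuous_dotr (a : 'rV[R]_d) : continuous (dotr a).
Proof.
move=> y; exact: (@cvg_dotr R _ (nbhs y) _ d (cst a) id a y (cvg_cst _) cvg_id).
Qed.

(** Points of a polyhedral union fall into finitely many classes, according to
the constraints that they satisfy and that they satisfy with equality. If [y]
is close to [ybar] and in the class of [z], then [P] contains the segment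
[z + s (y - ybar)] for small [s] of both signs: the constraints active at [z]
are active at [y], hence at [ybar]. So normals at [z] annihilate [y - ybar]. *)
Lemma polyhedral_classes P (ybar : 'rV[R]_d) : polyhedral_union P ->
  exists (T : finType) (c : 'rV[R]_d -> T), \forall y \near ybar,
    forall z xi, c z = c y -> regular_normal P z xi ->
      dotr xi (y - ybar) = 0.
Proof.
move=> /polyhedral_unionE[ss PE]; pose S := flatten ss.
pose c y : (size S).-tuple (bool * bool) :=
  [tuple of [seq (dotr ab.1 y <= ab.2, dotr ab.1 y == ab.2) | ab <- in_tuple S]].
exists ((size S).-tuple (bool * bool))%type, c.
have : \forall y \near ybar, forall ab, ab \in S ->
    dotr ab.1 ybar != ab.2 -> dotr ab.1 y != ab.2.
  apply: (@near_seq_all _ _ (nbhs ybar) S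
    (fun ab y => dotr ab.1 ybar != ab.2 -> dotr ab.1 y != ab.2)) => ab _.
  have [_|ab_neq] := eqVneq; first by apply: nearW.
  have : dotr ab.1 y - ab.2 @[y --> ybar] --> dotr ab.1 ybar - ab.2.
    exact: (cvgB (@continuous_dotr ab.1 ybar) (cvg_cst _)).
  move=> /cvgr_neq0; rewrite subr_eq0 => /(_ ab_neq).
  by apply: filterS => y; rewrite subr_eq0.
apply: filterS => y ynear z xi /(congr1 val)/= /eq_in_map cyz xi_nrm.
have /PE[s sss sz] := regular_normal_mem xi_nrm.
(* To be applied with [e = 1] and [e = - 1], the two signs of the displacement. *)
have two_sided (e : R) : \forall r \near 0^'+, P (z + r *: (e *: (y - ybar))).
  have : \forall r \near 0^'+, forall ab, ab \in s ->
      dotr ab.1 (z + r *: (e *: (y - ybar))) <= ab.2.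
    apply: (@near_seq_all _ _ (nbhs 0^'+) s (fun ab r =>
      dotr ab.1 (z + r *: (e *: (y - ybar))) <= ab.2)) => ab abs.
    have abS : ab \in S by apply/flattenP; exists s.
    have [_ zE] := cyz _ abS.
    have := sz _ abs; rewrite le_eqVlt => /predU1P[zab|zab].
      have yab : dotr ab.1 y = ab.2 by apply/eqP; rewrite -zE zab eqxx.
      have ybab : dotr ab.1 ybar = ab.2.
        by apply/eqP; apply: contraTT (eqxx ab.2) => /(ynear _ abS); rewrite yab.
      apply: nearW => r.
      by rewrite dotrDr !dotrZr dotrBr yab ybab subrr !mulr0 addr0 zab.
    have := cvg_comp _ _ (@cvg_ray z (e *: (y - ybar))) (@continuous_dotr ab.1 z).
    by move=> /cvgr_le; apply.
  by apply: filterS => r rP; apply/PE; exists s.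
have := regular_normal_le0 xi_nrm (two_sided 1).
have := regular_normal_le0 xi_nrm (two_sided (- 1)).
by rewrite !dotrZr; lra.
Qed.

(** Tangents and directional normals are defined with sequences, whereas the
limits below are taken along ultrafilters on arbitrary index types. *)
Lemma filter_sequence I (G : set_system I) (V : normedModType R) (u : I -> V)
    (l : V) (A : set I) : ProperFilter G -> u k @[k --> G] --> l -> G A ->
  exists s : nat -> I, (forall k, A (s k)) /\ u (s k) @[k --> \oo] --> l.
Proof.
move=> GG ul GA.
have /choice[s sP] (k : nat) : exists i, A i /\ `|l - u i| <= k.+1%:R^-1.
  have /cvgrPdist_le/(_ k.+1%:R^-1) := ul.
  rewrite invr_gt0 ltr0n => /(_ isT) uk.
  have : G (A `&` [set i | `|l - u i| <= k.+1%:R^-1]) by exact: filterI.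
  by move=> /filter_ex[i [? ?]]; exists i.
exists s; split=> [k|]; first by have [] := sP k.
apply/cvgrPdist_le => e e0.
have /cvgrPdist_le/(_ _ e0) := @cvg_harmonic R.
apply: filterS => k; rewrite sub0r normrN ger0_norm ?invr_ge0//.
by apply: le_trans; have [] := sP k.
Qed.

Lemma ray_quotient (t : R) ybar y :
  0 < t -> ybar + t *: (t^-1 *: (y - ybar)) = y.
Proof. by move=> t0; rewrite scalerA divff ?gt_eqF// scale1r addrC subrK. Qed.

Lemma tangent_intro I (G : set_system I) P ybar v
    (t : I -> R) (y : I -> 'rV[R]_d) : ProperFilter G -> P ybar ->
  (\forall k \near G, 0 < t k /\ P (y k)) -> t k @[k --> G] --> 0 ->
  (t k)^-1 *: (y k - ybar) @[k --> G] --> v -> tangent P ybar v.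
Proof.
move=> GG Pybar tP t0 yv.
have [s [sP sv]] := @filter_sequence _ G (R^o * 'rV[R]_d)%type
  (fun k => (t k, (t k)^-1 *: (y k - ybar))) (0, v) _ GG (cvg_pair t0 yv) tP.
split=> //; exists (t \o s), (fun k => (t (s k))^-1 *: (y (s k) - ybar)); split.
- by move=> k; have [] := sP k.
- exact: (cvg_comp _ _ sv cvg_fst).
- exact: (cvg_comp _ _ sv cvg_snd).
- by move=> k; have [tk yk] := sP k; rewrite /= ray_quotient.
Qed.

Lemma dir_normal_intro I (G : set_system I) P ybar v xi
    (t : I -> R) (y eta : I -> 'rV[R]_d) : ProperFilter G -> P ybar ->
  (\forall k \near G, 0 < t k /\ regular_normal P (y k) (eta k)) ->
  t k @[k --> G] --> 0 -> (t k)^-1 *: (y k - ybar) @[k --> G] --> v ->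
  eta k @[k --> G] --> xi -> dir_normal P ybar v xi.
Proof.
move=> GG Pybar tP t0 yv etaxi.
have [s [sP sv]] := @filter_sequence _ G (R^o * ('rV[R]_d * 'rV[R]_d))%type
  (fun k => (t k, ((t k)^-1 *: (y k - ybar), eta k))) (0, (v, xi)) _ GG
  (cvg_pair t0 (cvg_pair yv etaxi)) tP.
split=> //; exists (t \o s), (fun k => (t (s k))^-1 *: (y (s k) - ybar)),
  (eta \o s); split.
- split; first by move=> k; have [] := sP k.
  exact: (cvg_comp _ _ sv cvg_fst).
- exact: (cvg_comp _ _ (cvg_comp _ _ sv cvg_snd) cvg_fst).
- exact: (cvg_comp _ _ (cvg_comp _ _ sv cvg_snd) cvg_snd).
- by move=> k; have [tk yk] := sP k; rewrite /= ray_quotient.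
Qed.

(** Tangents to a polyhedral union are feasible directions: along an
ultrafilter, one of the polyhedra contains the whole approximating sequence. *)
Lemma tangent_polyhedral P ybar v : polyhedral_union P ->
  tangent P ybar v -> \forall s \near 0^'+, P (ybar + s *: v).
Proof.
move=> /polyhedral_unionE[ss PE] [Pybar [t [w [t0 tlim wlim Pw]]]].
have [G [GU ooG]] := @ultraFilterLemma _ \oo _.
have tG : t k @[k --> G] --> 0 by apply: cvg_trans tlim; exact: cvg_app.
have wG : w k @[k --> G] --> v by apply: cvg_trans wlim; exact: cvg_app.
have /choice[i iP] k : exists i : seq_sub ss, forall ab, ab \in ssval i ->
    dotr ab.1 (ybar + t k *: w k) <= ab.2.
  by have /PE[s sss sP] := Pw k; exists (SeqSub sss).
have [s sG] := ultra_finite i GU.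
have : \forall r \near 0^'+, forall ab, ab \in ssval s ->
    dotr ab.1 (ybar + r *: v) <= ab.2.
  apply: (@near_seq_all _ _ (nbhs 0^'+) (ssval s) (fun ab r =>
      dotr ab.1 (ybar + r *: v) <= ab.2)) => ab abs.
  have wab : \forall k \near G, dotr ab.1 (ybar + t k *: w k) <= ab.2.
    by apply: filterS sG => k ks; apply: iP; rewrite ks.
  (* An inactive constraint stays inactive on a short piece of the ray; an
  active one is not increased by [v]. *)
  have [ybar_ab|] := ltP (dotr ab.1 ybar) ab.2.
    have := cvg_comp _ _ (@cvg_ray ybar v) (@continuous_dotr ab.1 ybar).
    by move=> /cvgr_le; apply.
  move=> ab_ybar.
  have abv : dotr ab.1 v <= 0.
    apply: (cvgr_to_le (@cvg_dotr _ _ G _ _ (fun=> ab.1) w _ _ (cvg_cst _) wG)).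
    apply: filterS wab => k; rewrite dotrDr dotrZr => abk.
    by rewrite -(pmulr_rle0 _ (t0 k)); move: abk ab_ybar; lra.
  have ybar_ab : dotr ab.1 ybar <= ab.2.
    have : dotr ab.1 (ybar + t k *: w k) @[k --> G] --> dotr ab.1 (ybar + 0 *: v).
      apply: (@cvg_dotr _ _ G _ _ (fun=> ab.1)); first exact: cvg_cst.
      by apply: cvgD; [exact: cvg_cst|exact: cvgZ].
    rewrite scale0r addr0 => lim_ab.
    exact: (cvgr_to_le lim_ab wab).
  near=> r; have r0 : 0 < r by near: r; exact: nbhs_right_gt.
  by rewrite dotrDr dotrZr -[leRHS]addr0 lerD// pmulr_rle0.
apply: filterS => r rP; apply/PE; exists (ssval s) => //; exact: ssvalP.
Unshelve. all: by end_near. Qed.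

End NormalCones.

Lemma polyhedral_union_closed (R : realType) d (P : set 'rV[R]_d) :
  polyhedral_union P -> closed P.
Proof.
move=> /polyhedral_unionE[ss PE]; rewrite -openC openE => y.
move: (y : 'rV[R]_d) => {}y /= nPy.
have : \forall z \near y, forall s, s \in ss ->
    ~ (forall ab, ab \in s -> dotr ab.1 z <= ab.2).
  apply: (@near_seq_all _ _ (nbhs y) ss (fun s z =>
    ~ (forall ab, ab \in s -> dotr ab.1 z <= ab.2))) => s sss.
  have /existsNP[ab /not_implyP[abs /negP]] :
      ~ (forall ab, ab \in s -> dotr ab.1 y <= ab.2).
    by move=> sy; apply: nPy; apply/PE; exists s.
  rewrite -ltNge => aby.
  have : \forall z \near y, ab.2 < dotr ab.1 z.
    exact: (cvgr_gt _ (@continuous_dotr _ _ ab.1 y) _ aby).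
  by apply: filterS => z abz /(_ _ abs); rewrite leNgt abz.
by apply: filterS => z nz /PE[s sss]; exact: nz.
Qed.

(** * Penalisation: approximate multipliers without constraint qualification *)

Section Penalisation.
Context {R : realType} {n m : nat}.
Implicit Types (G : 'rV[R]_n -> 'rV[R]_m) (P : set 'rV[R]_m).

Lemma sqr_ray k (u v : 'rV[R]_k) (s : R) :
  dotr (u + s *: v) (u + s *: v) =
  dotr u u + s * (2 * dotr u v) + s * (s * dotr v v).
Proof. by rewrite !(dotrDl, dotrDr, dotrZl, dotrZr) (dotrC v u); ring. Qed.

Lemma cvg_diff_ray k (g : 'rV[R]_n -> 'rV[R]_k) x h : differentiable g x ->
  s^-1 *: (g (x + s *: h) - g x) @[s --> 0^'+] --> h *m 'J g x.
Proof.
move=> gx; have /cvg_ex[l gl] := @diff_derivable _ _ _ g x h gx.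
apply: cvg_dnbhs_at_right; rewrite -deriveEjacobian// /derive.
rewrite (cvg_lim _ gl)//=; move: gl => /=.
suff -> : (fun s : R => s^-1 *: (g (x + s *: h) - g x)) =
    (fun s => s^-1 *: (g (s *: h + x) - g x)) by [].
by apply/funext => s; rewrite [x + _]addrC.
Qed.

(** First-order conditions for the quadratically penalised problem: in the
slack variable [y'] they say that the scaled residual is normal to [P], in [x']
that it is an approximate multiplier, up to the slope [al] of the nonsmooth
term. *)
Lemma penalty_stationarity G P (c x0 x' : 'rV[R]_n) (y' : 'rV[R]_m)
    (al rho : R) : 0 <= al -> 0 < rho -> P y' -> differentiable G x' ->
  (\forall x \near x',
    dotr c x' + al * `|x' - x0| + rho * dotr (G x' - y') (G x' - y') <=
    dotr c x + al * `|x - x0| + rho * dotr (G x - y') (G x - y')) ->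
  (\forall y \near y', P y ->
    dotr (G x' - y') (G x' - y') <= dotr (G x' - y) (G x' - y)) ->
  let lam := (2 * rho) *: (G x' - y') in
  regular_normal P y' lam /\ `|c + lam *m ('J G x')^T| <= al.
Proof.
move=> al0 rho0 Py' dG xmin ymin lam; split.
  by apply: regular_normalZ; [rewrite mulr_gt0|exact: regular_normal_proj].
(* Testing minimality in the direction [- g] of steepest descent gives
[|g|_2 ^ 2 <= al * |g|], whence [|g| <= al] as [|g| <= |g|_2]. *)
set g : 'rV[R]_n := c + _; pose h : 'rV[R]_n := - g.
pose r : 'rV[R]_m := G x' - y'.
pose D (s : R) : 'rV[R]_m := s^-1 *: (G (x' + s *: h) - G x').
have Dlim : D s @[s --> 0^'+] --> h *m 'J G x' by exact: cvg_diff_ray.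
have quot : \forall s \near 0^'+,
    0 <= dotr c h + al * `|h| + (2 * rho) * dotr r (D s)
         + rho * (s * dotr (D s) (D s)).
  have : \forall s \near 0^'+,
      dotr c x' + al * `|x' - x0| + rho * dotr (G x' - y') (G x' - y') <=
      dotr c (x' + s *: h) + al * `|x' + s *: h - x0| +
        rho * dotr (G (x' + s *: h) - y') (G (x' + s *: h) - y').
    exact: (@cvg_ray _ _ x' h _ xmin).
  have : \forall s \near (0 : R)^'+, 0 < s by exact: nbhs_right_gt.
  apply: filterS2 => s s0.
  have -> : G (x' + s *: h) - y' = r + s *: D s.
    by rewrite /D scalerA divff ?gt_eqF// scale1r [RHS]addrC subrKA.
  have nle : `|x' + s *: h - x0| <= `|x' - x0| + s * `|h|.
    by rewrite addrAC (le_trans (ler_normD _ _))// normrZ gtr0_norm.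
  have := ler_wpM2l al0 nle.
  rewrite -/r sqr_ray dotrDr dotrZr => ale min_le.
  rewrite -(pmulr_rge0 _ s0).
  lra.
have lim : dotr c h + al * `|h| + (2 * rho) * dotr r (D s)
    + rho * (s * dotr (D s) (D s)) @[s --> 0^'+] -->
    dotr c h + al * `|h| + (2 * rho) * dotr r (h *m 'J G x') + 
    rho * (0 * dotr (h *m 'J G x') (h *m 'J G x')).
  apply: cvgD; first apply: cvgD; first exact: cvg_cst.
    by apply: cvgM; [exact: cvg_cst|apply: cvg_dotr => //; exact: cvg_cst].
  apply: cvgM; [exact: cvg_cst|apply: cvgM; last exact: cvg_dotr].
  by apply: cvg_at_right_filter; exact: cvg_id.
have := @cvgr_to_ge _ _ (at_right_proper_filter (0 : R)) _ _ _ _ lim quot.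
have -> : (2 * rho) * dotr r (h *m 'J G x') = dotr (lam *m ('J G x')^T) h.
  by rewrite [RHS]dotrC -dotr_mulmx [RHS]dotrC dotrZl.
rewrite mul0r mulr0 addr0 addrAC -dotrDl -/g /h dotrNr normrN.
rewrite addrC subr_ge0 -sqr_enorm => gle.
have [->|g0] := eqVneq g 0; first by rewrite normr0.
rewrite -(@ler_pM2r _ `|g|) ?normr_gt0// (le_trans _ gle)// expr2.
by rewrite ler_pM ?norm_le_enorm.
Qed.

(** Exact penalisation around a point with no feasible point nearby: the
normalised residual at a minimiser of [|G x - y| + al * |x - x0|] is a unit
normal that the adjoint Jacobian almost annihilates, as in Ekeland's
variational principle. The condition [be < al * r] keeps the minimiser in the
interior of the ball. With [t > 0] the norm of the residual at the minimiser,
[|w| <= (|w|^2 + t^2) / (2 t)] with equality if [|w| = t]; hence the point also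
minimises the problem with quadratic penalty. *)
Lemma infeasible_normal G P (x0 : 'rV[R]_n) (y0 : 'rV[R]_m) (al be r : R) :
  continuous G -> closed P -> P y0 -> 0 < al -> enorm (G x0 - y0) <= be ->
  be < al * r ->
  (forall x, `|x - x0| < r -> differentiable G x /\ ~ P (G x)) ->
  exists (x : 'rV[R]_n) (y : 'rV[R]_m),
    let lam := (enorm (G x - y))^-1 *: (G x - y) in
    [/\ `|x - x0| <= be / al, 0 < enorm (G x - y) <= be,
        regular_normal P y lam & `|lam *m ('J G x)^T| <= al].
Proof.
move=> Gcont Pcl Py0 al0 y0be ber Gr.
have be0 : 0 <= be by rewrite (le_trans _ y0be) ?enorm_ge0.
have r0 : 0 < r by rewrite -(pmulr_rgt0 _ al0) (le_lt_trans be0).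
pose B := [set x : 'rV[R]_n | `|x - x0| <= r].
have cB : compact B by exact: compact_normed_ball.
have [M GM] : exists M, forall x, B x -> `|G x| <= M.
  have /compact_bounded : compact (G @` B).
    by apply: continuous_compact => //; exact: continuous_subspaceT.
  move=> [M [_ MP]]; exists (M + 1) => x Bx.
  by apply: (MP (M + 1)); [rewrite ltrDl|exists x].
(* The [+ 1] puts the second component of a minimiser in the interior. *)
pose Y := P `&` [set y : 'rV[R]_m | `|y - 0| <= M + be + 1].
have cY : compact Y.
  by rewrite /Y setIC; apply: compact_closedI => //; exact: compact_normed_ball.
pose phi (z : 'rV[R]_n * 'rV[R]_m) := enorm (G z.1 - z.2) + al * `|z.1 - x0|.
have phi_cont : continuous phi.
  move=> z; apply: cvgD.
    apply: cvg_enorm; apply: cvgB; last exact: cvg_snd.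
    by apply: (continuous_cvg _ (Gcont z.1)); exact: cvg_fst.
  apply: cvgM; first exact: cvg_cst.
  by apply: cvg_norm; apply: cvgB; [exact: cvg_fst|exact: cvg_cst].
have Yle (x : 'rV[R]_n) (y : 'rV[R]_m) :
    B x -> enorm (G x - y) <= be -> `|y| <= M + be.
  move=> Bx xy; rewrite -(subrK (G x) y) addrC (le_trans (ler_normD _ _))//.
  by rewrite lerD ?GM// distrC (le_trans (norm_le_enorm _)).
have Bx0 : B x0 by rewrite /B/= subrr normr0 ltW.
have BYz0 : (B `*` Y) (x0, y0).
  split=> //; split=> //=; rewrite subr0 (le_trans (Yle _ _ Bx0 y0be))//.
  by rewrite lerDl.
have [] := @compact_EVT_min _ R phi (B `*` Y) _ (compact_setX cB cY) _.
- by exists (x0, y0).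
- exact: continuous_subspaceT.
move=> [x y]; rewrite inE => -[/= Bx [Py _]] phi_min.
have phi_le : phi (x, y) <= be.
  rewrite (le_trans (phi_min (x0, y0) _)) ?inE//.
  by rewrite /phi/= subrr normr0 mulr0 addr0.
move: phi_le; rewrite /phi/= => phi_le.
have xbe : `|x - x0| <= be / al.
  rewrite ler_pdivlMr// mulrC (le_trans _ phi_le)// lerDr enorm_ge0//.
have xr : `|x - x0| < r by rewrite (le_lt_trans xbe)// ltr_pdivrMr// mulrC.
have ebe : enorm (G x - y) <= be.
  by rewrite (le_trans _ phi_le)// lerDl mulr_ge0// ltW.
set t := enorm (G x - y) in ebe phi_le.
have t0 : 0 < t.
  apply: enorm_gt0; rewrite subr_eq0; apply/eqP => xy.
  by have [_] := Gr _ xr; rewrite xy.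
have min2 (x1 : 'rV[R]_n) (y1 : 'rV[R]_m) : B x1 -> Y y1 ->
    al * `|x - x0| + (2 * t)^-1 * dotr (G x - y) (G x - y) <=
    al * `|x1 - x0| + (2 * t)^-1 * dotr (G x1 - y1) (G x1 - y1).
  move=> Bx1 Yy1; have := phi_min (x1, y1); rewrite inE => /(_ (conj Bx1 Yy1)).
  rewrite /phi/= -!sqr_enorm -/t; set t1 := enorm (G x1 - y1).
  have -> : (2 * t)^-1 * t ^+ 2 = t / 2 by field; rewrite gt_eqF.
  suff : t1 - t / 2 <= (2 * t)^-1 * t1 ^+ 2 by lra.
  rewrite -subr_ge0.
  have -> : (2 * t)^-1 * t1 ^+ 2 - (t1 - t / 2) = (2 * t)^-1 * (t1 - t) ^+ 2.
    by field; rewrite gt_eqF.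
  by rewrite mulr_ge0 ?sqr_ge0// invr_ge0 mulr_ge0// ltW.
have xB : \forall x1 \near x, B x1.
  have : `|x1 - x0| @[x1 --> x] --> `|x - x0|.
    exact: (cvg_norm (cvgB cvg_id (cvg_cst _))).
  by move=> /cvgr_le; apply.
have yY : \forall y1 \near y, P y1 -> Y y1.
  have : `|y1 - 0| @[y1 --> y] --> `|y - 0|.
    exact: (cvg_norm (cvgB cvg_id (cvg_cst _))).
  move=> /cvgr_le /(_ (M + be + 1)); rewrite subr0.
  have -> : `|y| < M + be + 1 by rewrite (le_lt_trans (Yle _ _ Bx ebe))// ltrDl.
  by move=> /(_ isT); apply: filterS.
have t20 : 0 < (2 * t)^-1 by rewrite invr_gt0 mulr_gt0.
have [||] := @penalty_stationarity G P 0 x0 x y al _ (ltW al0) t20 Py (Gr _ xr).1.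
- apply: filterS xB => x1 Bx1; rewrite !dotr0l !add0r.
  by apply: min2 => //; split=> //; move: yY => /nbhs_singleton [].
- apply: filterS yY => y1 Yy1 /Yy1 {}Yy1.
  by have := min2 _ _ Bx Yy1; rewrite lerD2l ler_pM2l.
have -> : 2 * (2 * t)^-1 = t^-1 by field; rewrite gt_eqF.
move=> nrm; rewrite add0r => slope.
by exists x, y; split => //; rewrite t0.
Qed.

End Penalisation.

(** * Stationary points are limits of approximate KKT points *)

Section ApproximateStationarity.
Context {R : realType} {n m : nat}.
Implicit Types (g : 'rV[R]_n -> R) (G : 'rV[R]_n -> 'rV[R]_m) (P : set 'rV[R]_m).

(** Both notions of stationarity imply this one, and the sequences of
approximate multipliers that it provides are all that the stability estimates
use. *)
Definition asymptotically_stationary g G P (x : 'rV[R]_n) : Prop :=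
  forall e : R, 0 < e -> exists (x' : 'rV[R]_n) (y lam : 'rV[R]_m),
    [/\ `|x' - x| <= e, `|G x' - y| <= e, regular_normal P y lam
      & `|grad g x' + lam *m ('J G x')^T| <= e].

Lemma M_stationary_asymptotically g G P x :
  M_stationary g G P x -> asymptotically_stationary g G P x.
Proof.
move=> [lam [PGx [y [eta [yx etalam eta_nrm]]]] lamE] e e0.
have res : grad g x + eta k *m ('J G x)^T @[k --> \oo] -->
    grad g x + lam *m ('J G x)^T.
  by apply: cvgD; [exact: cvg_cst|apply: cvg_mulmx => //; exact: cvg_cst].
rewrite -lamE in res.
have yk : \forall k \near \oo, `|G x - y k| <= e.
  by move/cvgrPdist_le : yx; exact.
have rk : \forall k \near \oo, `|0 - (grad g x + eta k *m ('J G x)^T)| <= e.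
  by move/cvgrPdist_le : res; exact.
have [k [yke rke]] : exists k, `|G x - y k| <= e /\
    `|0 - (grad g x + eta k *m ('J G x)^T)| <= e.
  exact: filter_ex (filterI yk rk).
exists x, (y k), (eta k); split=> //; first by rewrite subrr normr0 ltW.
by rewrite -normrN -sub0r.
Qed.

(** As [xi] is a regular normal, [x0] is the only minimiser of
[- xi . x + e |x - x0|] over the feasible points of a small ball. Minimisers of the problems in
which the constraint is replaced by the penalty [k |G x - y|^2] with [y] in [P]
tend to [x0], and their stationarity conditions provide the multipliers. These
may be unbounded as [e] tends to [0]. *)
Lemma regular_normal_feasible G P (x0 xi : 'rV[R]_n) (e : R) :
  continuous G -> closed P ->
  (\forall x \near x0, differentiable G x) ->
  regular_normal (feasible G P) x0 xi -> 0 < e ->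
  exists (x' : 'rV[R]_n) (y lam : 'rV[R]_m),
    [/\ `|x' - x0| <= e, `|G x' - y| <= e, regular_normal P y lam
      & `|- xi + lam *m ('J G x')^T| <= e].
Proof.
move=> Gcont Pcl dG /regular_normalP[Px0 xi_le] e0.
have e20 : 0 < e / 2 by rewrite divr_gt0.
have [r /= r0 rP] : exists2 r : R, 0 < r & forall x : 'rV[R]_n, `|x - x0| <= r ->
    differentiable G x /\ (P (G x) -> dotr xi (x - x0) <= e / 2 * `|x - x0|).
  have : \forall x \near x0, differentiable G x /\
      (P (G x) -> dotr xi (x - x0) <= e / 2 * `|x - x0|).
    exact: (filterI dG (xi_le _ e20)).
  move=> /nbhs_normP[r /= r0 rP].
  exists (r / 2); first by rewrite divr_gt0.
  move=> x xr; apply: rP => /=; rewrite distrC (le_lt_trans xr)//.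
  by rewrite ltr_pdivrMr// ltr_pMr// ltr1n.
pose B := [set x : 'rV[R]_n | `|x - x0| <= r].
pose Y := P `&` [set y : 'rV[R]_m | `|y - G x0| <= 1].
have cB : compact B by exact: compact_normed_ball.
have cY : compact Y.
  by rewrite /Y setIC; apply: compact_closedI => //; exact: compact_normed_ball.
pose N (z : 'rV[R]_n * 'rV[R]_m) := dotr (- xi) z.1 + e * `|z.1 - x0|.
pose D (z : 'rV[R]_n * 'rV[R]_m) := dotr (G z.1 - z.2) (G z.1 - z.2).
have N_cont : continuous N.
  move=> z; apply: cvgD.
    by apply: cvg_dotr; [exact: cvg_cst|exact: cvg_fst].
  apply: cvgM; first exact: cvg_cst.
  by apply: cvg_norm; apply: cvgB; [exact: cvg_fst|exact: cvg_cst].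
have D_cont : continuous D.
  move=> z; apply: cvg_dotr.
    apply: cvgB; last exact: cvg_snd.
    by apply: (continuous_cvg _ (Gcont z.1)); exact: cvg_fst.
  apply: cvgB; last exact: cvg_snd.
  by apply: (continuous_cvg _ (Gcont z.1)); exact: cvg_fst.
have BYz0 : (B `*` Y) (x0, G x0).
  by split; [rewrite /B/= subrr normr0 ltW|split=> //=; rewrite subrr normr0].
have /choice[z zP] (k : nat) : exists z, (B `*` Y) z /\
    forall w, (B `*` Y) w -> N z + k.+1%:R * D z <= N w + k.+1%:R * D w.
  have [] := @compact_EVT_min _ R (fun z => N z + k.+1%:R * D z)
    (B `*` Y) _ (compact_setX cB cY) _.
  - by exists (x0, G x0).
  - apply: continuous_subspaceT => z; apply: cvgD; first exact: N_cont.
    by apply: cvgM; [exact: cvg_cst|exact: D_cont].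
  - by move=> z /set_mem BYz zmin; exists z; split=> // w /mem_set/zmin.
have [F [FU ooF]] := @ultraFilterLemma _ \oo _.
have BYz : \forall k \near F, (B `*` Y) (z k).
  by apply: nearW => k; have [] := zP k.
have [[xs ys] /= [Bxs [Pys _]] zlim] := @ultra_cvg_compact _ _ F z _ FU
  (compact_setX cB cY) BYz.
have N0 : N (x0, G x0) = dotr (- xi) x0.
  by rewrite /N/= subrr normr0 mulr0 addr0.
have D0 : D (x0, G x0) = 0 by rewrite /D/= subrr dotr0l.
have zle k : N (z k) + k.+1%:R * D (z k) <= N (x0, G x0).
  by have := (zP k).2 _ BYz0; rewrite D0 mulr0 addr0.
have Nlim : N (z k) @[k --> F] --> N (xs, ys).
  exact: (cvg_comp _ _ zlim (N_cont _)).
have Dlim : D (z k) @[k --> F] --> D (xs, ys).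
  exact: (cvg_comp _ _ zlim (D_cont _)).
have Ns : N (xs, ys) <= N (x0, G x0).
  apply: (cvgr_to_le Nlim); apply: nearW => k.
  by apply: le_trans (zle k); rewrite lerDl mulr_ge0// dotr_ge0.
have Ds : D (xs, ys) <= 0.
  have hlim : k.+1%:R^-1 @[k --> F] --> (0 : R).
    exact: cvg_trans (cvg_app _ ooF) cvg_harmonic.
  have bnd : k.+1%:R^-1 * (N (x0, G x0) - N (z k)) @[k --> F] -->
      0 * (N (x0, G x0) - N (xs, ys)).
    by apply: cvgM => //; apply: cvgB => //; exact: cvg_cst.
  have : 0 <= 0 * (N (x0, G x0) - N (xs, ys)) - D (xs, ys).
    apply: (cvgr_to_ge (cvgB bnd Dlim)); apply: nearW => k.
    by rewrite subr_ge0 ler_pdivlMl// lerBrDl zle.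
  by rewrite mul0r sub0r oppr_ge0.
have ysE : ys = G xs.
  apply/esym/eqP; rewrite -subr_eq0; apply/eqP; apply: dotr_eq0.
  by apply/eqP; rewrite eq_le dotr_ge0 andbT.
have xsE : xs = x0.
  have PGxs : P (G xs) by rewrite -ysE.
  have := (rP _ Bxs).2 PGxs; move: Ns; rewrite N0 /N/= dotrBr !dotrNl => Ns xs_le.
  apply/eqP; rewrite -subr_eq0 -normr_eq0 eq_le normr_ge0 andbT.
  by rewrite -(pmulr_rle0 _ e20); lra.
rewrite {}ysE {}xsE in zlim.
have xlim : (z k).1 @[k --> F] --> x0 by exact: (cvg_comp _ _ zlim cvg_fst).
have ylim : (z k).2 @[k --> F] --> G x0 by exact: (cvg_comp _ _ zlim cvg_snd).
have xr : \forall k \near F, `|(z k).1 - x0| < r.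
  by move/cvgr_distC_lt : xlim; exact.
have xe : \forall k \near F, `|(z k).1 - x0| <= e.
  by move/cvgr_distC_le : xlim; exact.
have y1 : \forall k \near F, `|(z k).2 - G x0| < 1.
  by move/cvgr_distC_lt : ylim; exact.
have Gy : \forall k \near F, `|G (z k).1 - (z k).2| <= e.
  have : G (z k).1 - (z k).2 @[k --> F] --> G x0 - G x0.
    by apply: cvgB => //; exact: (continuous_cvg _ (Gcont x0)).
  by rewrite subrr => /cvgr0_norm_le; exact.
have [k [[xrk xek] [y1k Gyk]]] := filter_ex (filterI (filterI xr xe) (filterI y1 Gy)).
move: (zP k) xrk xek y1k Gyk {xlim ylim zlim}.
case: (z k) => x y /= [[/= Bx [Py _]] zmin] xrk xek y1k Gyk.
have nbhsx : \forall x1 \near x, B x1.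
  have : `|x1 - x0| @[x1 --> x] --> `|x - x0|.
    exact: (cvg_norm (cvgB cvg_id (cvg_cst _))).
  by move=> /cvgr_le; apply.
have nbhsy : \forall y1 \near y, `|y1 - G x0| <= 1.
  have : `|y1 - G x0| @[y1 --> y] --> `|y - G x0|.
    exact: (cvg_norm (cvgB cvg_id (cvg_cst _))).
  by move=> /cvgr_le; apply.
have Yy : Y y by split => //; exact: ltW.
have [|||] := @penalty_stationarity _ _ _ G P (- xi) x0 x y e k.+1%:R (ltW e0)
  _ Py (rP _ Bx).1 => //.
- by apply: filterS nbhsx => x1 Bx1; apply: (zmin (x1, y)).
- apply: filterS nbhsy => y2 y21 Py2; have := zmin (x, y2) (conj Bx (conj Py2 y21)).
  by rewrite lerD2l ler_pM2l.
- by move=> nrm slope; exists x, y; eexists; split; [exact: xek|exact: Gyk|exact: nrm|].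
Qed.

Lemma stationary_asymptotically g G P (x0 : 'rV[R]_n) : continuous G -> closed P ->
  (\forall x \near x0, differentiable G x) -> {for x0, continuous (grad g)} ->
  stationary g G P x0 -> asymptotically_stationary g G P x0.
Proof.
move=> Gcont Pcl dG gcont [xi xi_nrm xiE] e e0.
have e20 : 0 < e / 2 by rewrite divr_gt0.
have /nbhs_normP[r /= r0 rP] : \forall x \near x0, `|grad g x0 - grad g x| <= e / 2.
  by move/cvgrPdist_le : gcont; exact.
have [e1 [e10 e1e e1r]] : exists e1 : R, [/\ 0 < e1, e1 <= e / 2 & e1 <= r / 2].
  exists (Num.min (e / 2) (r / 2)); rewrite lt_min e20 divr_gt0//.
  by split=> //; rewrite ge_min lexx ?orbT.
have [x [y [lam [xe ye nrm le_e]]]] :=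
  regular_normal_feasible Gcont Pcl dG xi_nrm e10.
have e2e : e / 2 <= e by rewrite ler_pdivrMr// ler_pMr// ler1n.
exists x, y, lam; split=> //; rewrite ?(le_trans xe) ?(le_trans ye) ?(le_trans e1e)//.
have gx : `|grad g x0 - grad g x| <= e / 2.
  apply: rP => /=; rewrite distrC (le_lt_trans xe)// (le_lt_trans e1r)//.
  by rewrite ltr_pdivrMr// ltr_pMr// ltr1n.
have -> : grad g x + lam *m ('J G x)^T =
    (- xi + lam *m ('J G x)^T) - (grad g x0 - grad g x).
  have -> : grad g x0 = - xi by apply/eqP; rewrite -addr_eq0 -xiE.
  by rewrite opprB [- xi + _]addrC addrACA subrr addr0 addrC.
by rewrite (splitr e) (le_trans (ler_normB _ _))// lerD// (le_trans le_e).
Qed.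

End ApproximateStationarity.

(** * Uniform Taylor expansions *)

Section Rays.
Context {R : realType}.

(** Needed because the gradient of a Lagrangian is a combination of the
gradients of its terms only at points of differentiability. *)
Lemma near_eq_diff (V W : normedModType R) (f g : V -> W) (x : V) :
  {near x, f =1 g} -> differentiable f x ->
  differentiable g x /\ 'd g x = 'd f x :> (V -> W).
Proof.
move=> fg /diff_locallyP[dcont fE].
have gE : g \o shift x = cst (g x) + 'd f x +o_ (0 : V) id.
  apply/eqaddoP => e e0; move/eqaddoP : fE => /(_ e e0).
  have fg0 : \forall h \near (0 : V), f (h + x) = g (h + x).
    by move: fg; rewrite (near_shift 0); apply: filterS => h /=; rewrite subr0.
  apply: filterS2 fg0 => h fgh; rewrite /=.
  rewrite -[X in X -> _]/(is_true (`|f (h + x) - (f x + 'd f x h)| <= _)).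
  by rewrite fgh (nbhs_singleton fg).
have dE := diff_unique dcont gE.
split; last exact: dE.
apply/diff_locallyP; split; first by rewrite dE; exact: dcont.
by rewrite dE; exact: gE.
Qed.

Lemma is_derive_ray (W : normedModType R) n (F : 'rV[R]_n -> W)
    (x h : 'rV[R]_n) (s : R) (l : W) :
  is_derive (x + s *: h) h F l -> is_derive s 1 (fun s => F (x + s *: h)) l.
Proof.
move=> [dF Fl].
have E : (fun t : R => t^-1 *:
      (((fun s => F (x + s *: h)) \o shift s) (t *: (1 : R)) - F (x + s *: h))) =
    (fun t => t^-1 *: ((F \o shift (x + s *: h)) (t *: h) - F (x + s *: h))).
  by apply/funext => t /=; rewrite [t *: 1]mulr1 scalerDl addrCA.
by split; rewrite /derivable/derive E.
Qed.

Lemma derive_grad n (phi : 'rV[R]_n -> R) x h :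
  differentiable phi x -> 'D_h phi x = dotr (grad phi x) h.
Proof.
move=> dphi; rewrite deriveE// [in LHS](row_sum_delta h) linear_sum dotrE.
by apply: eq_bigr => j _; rewrite linearZ/= mxE deriveE// mulrC.
Qed.

Lemma derive_entry n k (F : 'rV[R]_n -> 'rV[R]_k) x h (j : 'I_k) :
  differentiable F x ->
  is_derive x h (fun y => F y 0 j) ((h *m 'J F x) 0 j).
Proof.
move=> dF; have dFh := @diff_derivable _ _ _ F x h dF.
split; first by move/derivable_mxP : dFh.
by rewrite -deriveEjacobian// derive_mx// mxE.
Qed.

Lemma mean_value_ray n (phi : 'rV[R]_n -> R) (dphi : 'rV[R]_n -> R)
    (x h : 'rV[R]_n) :
  (forall s : R, 0 <= s <= 1 ->
    is_derive (x + s *: h) h phi (dphi (x + s *: h))) ->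
  exists2 s : R, 0 <= s <= 1 & phi (x + h) - phi x = dphi (x + s *: h).
Proof.
move=> dphiP; pose f (s : R) := phi (x + s *: h).
have df (s : R) : 0 <= s <= 1 -> is_derive s 1 f (dphi (x + s *: h)).
  by move=> s01; apply: is_derive_ray; exact: dphiP.
have [|s s01||s] := @MVT_segment R f (fun s => dphi (x + s *: h)) 0 1.
- exact: ler01.
- apply: df; move: s01; rewrite in_itv/= => /andP[s0 s1].
  by rewrite !ltW.
- apply: derivable_within_continuous => s; rewrite in_itv/= => /df s01.
  exact: ex_derive.
- rewrite in_itv/= => s01; rewrite /f scale1r scale0r addr0 subr0 mulr1 => E.
  by exists s.
Qed.

Lemma grad_increment n (phi : 'rV[R]_n -> R) (x h : 'rV[R]_n) (H : 'M[R]_n) (e : R) :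
  0 <= e -> (forall s : R, 0 <= s <= 1 ->
    differentiable (grad phi) (x + s *: h) /\
    `|hess phi (x + s *: h) - H| <= e) ->
  `|grad phi (x + h) - grad phi x - h *m H| <= n%:R * (`|h| * e).
Proof.
move=> e0 dH; apply: norm_le_entries => [|i j]; first by rewrite !mulr_ge0.
have [s s01 E] := @mean_value_ray n (fun y => grad phi y 0 j)
  (fun y => (h *m hess phi y) 0 j) x h (fun s s01 => derive_entry _ _ (dH s s01).1).
have -> : (grad phi (x + h) - grad phi x - h *m H) i j =
    (h *m (hess phi (x + s *: h) - H)) 0 j.
  by rewrite (ord1 i) mulmxBr; move: E; rewrite !mxE => <-.
rewrite (le_trans (entry_le_norm _ _ _))// (le_trans (norm_mulmx _ _))//.
by rewrite ler_wpM2l// ler_wpM2l// (dH s s01).2.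
Qed.

Lemma taylor2 n (phi : 'rV[R]_n -> R) (x h : 'rV[R]_n) (H : 'M[R]_n) (e : R) :
  0 <= e -> (forall s : R, 0 <= s <= 1 ->
    [/\ differentiable phi (x + s *: h), differentiable (grad phi) (x + s *: h)
      & `|hess phi (x + s *: h) - H| <= e]) ->
  `|phi (x + h) - phi x - dotr (grad phi x) h - qform H h / 2| <=
  n%:R * (n%:R * (`|h| * e) * `|h|).
Proof.
(* The mean value theorem for [f] leaves the increment of the gradient minus its
linearisation, to which [grad_increment] applies. *)
move=> e0 dH; pose f (s : R) := phi (x + s *: h) - s * dotr (grad phi x) h
  - s ^+ 2 / 2 * qform H h.
pose df (s : R) := dotr (grad phi (x + s *: h)) h - dotr (grad phi x) h
  - s * qform H h.
have dfP (s : R) : 0 <= s <= 1 -> is_derive s 1 f (df s).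
  move=> s01; have [dphi _ _] := dH s s01.
  have : is_derive s 1 (fun s => phi (x + s *: h)) (dotr (grad phi (x + s *: h)) h).
    by apply: is_derive_ray; split; [exact: diff_derivable|exact: derive_grad].
  move=> dphi1.
  have lin : is_derive s 1 (fun s : R => s * dotr (grad phi x) h) (dotr (grad phi x) h).
    by apply: is_derive_eq; rewrite /GRing.scale/= mulr1 mulr0 add0r.
  have quad : is_derive s 1 (fun s : R => s ^+ 2 / 2 * qform H h) (s * qform H h).
    apply: is_derive_eq; by rewrite /GRing.scale/=; field.
  exact: (is_deriveB (is_deriveB dphi1 lin) quad).
have [|s s01||s] := @MVT_segment R f df 0 1.
- exact: ler01.
- by apply: dfP; move: s01; rewrite in_itv/= => /andP[s0 s1]; rewrite !ltW.
- apply: derivable_within_continuous => s; rewrite in_itv/= => /dfP s01.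
  exact: ex_derive.
rewrite in_itv/= => s01; rewrite subr0 mulr1 /f scale1r scale0r addr0 !mul0r.
rewrite expr0n/= !mul0r !subr0 mul1r expr1n mul1r => E.
rewrite (_ : _ - _ = df s); last by rewrite -E; ring.
have -> : df s = dotr (grad phi (x + s *: h) - grad phi x - (s *: h) *m H) h.
  by rewrite /df !dotrBl -scalemxAl dotrZl.
rewrite (le_trans (norm_dotr _ _))// ler_wpM2l// ler_wpM2r//.
have /andP[s0 s1] := s01.
rewrite (le_trans (@grad_increment n phi x (s *: h) H e e0 _))//.
  move=> r /andP[r0 r1]; rewrite scalerA.
  by have [] := dH (r * s); rewrite ?mulr_ge0 ?mulr_ile1.
rewrite ler_wpM2l// ler_wpM2r// normrZ ger0_norm//.
by rewrite ler_piMl.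
Qed.

End Rays.

Section SmoothFamilies.
Context {R : realType} {n : nat} {Omega : topologicalType}.
Context (xbar : 'rV[R]_n) (wbar : Omega).

Definition twice_smooth (phi : 'rV[R]_n -> Omega -> R) : Prop :=
  (\forall z \near (xbar, wbar), differentiable (phi ^~ z.2) z.1 /\
     differentiable (grad (phi ^~ z.2)) z.1) /\
  {for (xbar, wbar), continuous (fun z => hess (phi ^~ z.2) z.1)}.

(** The expansions around [xbar] are uniform in the parameter, with the Hessian
at the reference parameter: this is what joint continuity at one point gives. *)
Lemma taylor_near (phi : 'rV[R]_n -> Omega -> R) (e : R) :
  twice_smooth phi -> 0 < e ->
  let H := hess (phi ^~ wbar) xbar in
  \forall z \near (xbar, wbar),
    let h := z.1 - xbar in
    `|grad (phi ^~ z.2) z.1 - grad (phi ^~ z.2) xbar - h *m H| <= e * `|h| /\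
    `|phi z.1 z.2 - phi xbar z.2 - dotr (grad (phi ^~ z.2) xbar) h
      - qform H h / 2| <= e * `|h| ^+ 2.
Proof.
move=> [dphi hcont] e0 H.
(* Each pairing in [taylor2] costs a factor [n] in the maximum norm; [n.+1]
avoids a division by zero. *)
pose e1 := e / (n.+1%:R * n.+1%:R).
have e10 : 0 < e1 by rewrite divr_gt0// mulr_gt0.
have hH : \forall z \near (xbar, wbar),
    `|H - hess (phi ^~ z.2) z.1| <= e1.
  by move/cvgrPdist_le : hcont; exact.
have [[U W] /= [/nbhs_normP[r /= r0 rU] nW] UW] :
    nbhs (xbar, wbar) [set z | (differentiable (phi ^~ z.2) z.1 /\
     differentiable (grad (phi ^~ z.2)) z.1) /\
     `|H - hess (phi ^~ z.2) z.1| <= e1] by exact: filterI.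
have nU : \forall x \near xbar, `|xbar - x| < r by apply/nbhs_normP; exists r.
exists ([set x : 'rV[R]_n | `|xbar - x| < r], W); first by split.
move=> [x w] /= [xr Ww].
pose h : 'rV[R]_n := x - xbar; have xE : x = xbar + h by rewrite addrC subrK.
have seg (s : R) : 0 <= s <= 1 ->
    [/\ differentiable (phi ^~ w) (xbar + s *: h),
        differentiable (grad (phi ^~ w)) (xbar + s *: h)
      & `|hess (phi ^~ w) (xbar + s *: h) - H| <= e1].
  move=> /andP[s0 s1].
  have Us : U (xbar + s *: h).
    apply: rU; rewrite /= opprD addrA subrr sub0r normrN normrZ ger0_norm//.
    by rewrite (le_lt_trans (ler_piMl _ s1))// distrC.
  have [[d1 d2] d3] := UW (xbar + s *: h, w) (conj Us Ww).
  by split; [exact: d1|exact: d2|rewrite distrC; exact: d3].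
have nn1 : n%:R <= n.+1%:R :> R by rewrite ler_nat.
have e1E : n.+1%:R * (n.+1%:R * e1) = e by rewrite /e1; field.
have n1e : n.+1%:R * e1 <= e.
  rewrite -[leRHS]e1E; apply: ler_peMl; last by rewrite ler1n.
  exact: mulr_ge0 (ler0n R n.+1) (ltW e10).
rewrite -/h; split.
  rewrite [in X in X - _]xE.
  rewrite (le_trans (@grad_increment _ n (phi ^~ w) xbar h H e1 (ltW e10) _))//.
    by move=> s /seg[].
  rewrite mulrCA mulrC ler_wpM2r// (le_trans _ n1e)// ler_wpM2r//.
  exact: ltW.
rewrite [in X in X - phi xbar w]xE.
rewrite (le_trans (@taylor2 _ n (phi ^~ w) xbar h H e1 (ltW e10) _))//.
have -> : n%:R * (n%:R * (`|h| * e1) * `|h|) = (n%:R * (n%:R * e1)) * `|h| ^+ 2.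
  by ring.
rewrite ler_wpM2r ?sqr_ge0// -[leRHS]e1E.
by rewrite ler_pM ?ler_wpM2r ?mulr_ge0// ltW.
Qed.

Context {I : Type} (F : set_system I) {FF : Filter F}.
Context (x : I -> 'rV[R]_n) (w : I -> Omega) (t : I -> R) (u : 'rV[R]_n).
Hypotheses (xlim : x k @[k --> F] --> xbar) (wlim : w k @[k --> F] --> wbar).
Hypotheses (t_gt0 : \forall k \near F, 0 < t k).
Hypothesis ulim : (t k)^-1 *: (x k - xbar) @[k --> F] --> u.

Lemma xw_near (Q : 'rV[R]_n * Omega -> Prop) :
  (\forall z \near (xbar, wbar), Q z) -> \forall k \near F, Q (x k, w k).
Proof. exact: (cvg_pair xlim wlim). Qed.

Lemma cvg_remainder (V : normedModType R) (E : I -> V) p :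
  (forall e : R, 0 < e ->
    \forall k \near F, `|E k| <= e * `|x k - xbar| ^+ p) ->
  (t k ^+ p)^-1 *: E k @[k --> F] --> (0 : V).
Proof.
move=> Ee; apply/cvgrPdist_le => e e0.
have M0 : 0 < (`|u| + 1) ^+ p by rewrite exprn_gt0// ltr_wpDl.
have u1 : \forall k \near F, `|(t k)^-1 *: (x k - xbar)| <= `|u| + 1.
  by apply: (cvgr_le _ (cvg_norm ulim)); rewrite ltrDl.
have := Ee (e / (`|u| + 1) ^+ p) (divr_gt0 e0 M0).
apply: filterS3 t_gt0 u1 => k tk uk Ek.
rewrite sub0r normrN normrZ ger0_norm ?invr_ge0 ?exprn_ge0 ?(ltW tk)//.
rewrite ler_pdivrMl ?exprn_gt0// (le_trans Ek)//.
rewrite [leRHS]mulrC -mulrA ler_pM2l// ler_pdivrMl//.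
rewrite -exprMn lerXn2r ?nnegrE ?mulr_ge0// ?(ltW tk)//.
move: uk; rewrite normrZ ger0_norm ?invr_ge0 ?(ltW tk)//.
by rewrite ler_pdivrMl// mulrC.
Qed.

Lemma cvg_grad_increment phi : twice_smooth phi ->
  (t k)^-1 *: (grad (phi ^~ (w k)) (x k) - grad (phi ^~ (w k)) xbar)
    @[k --> F] --> u *m hess (phi ^~ wbar) xbar.
Proof.
move=> sphi; set H := hess _ _.
pose E k := grad (phi ^~ (w k)) (x k) - grad (phi ^~ (w k)) xbar
  - (x k - xbar) *m H.
have E0 : (t k ^+ 1)^-1 *: E k @[k --> F] --> (0 : 'rV[R]_n).
  apply: cvg_remainder => e e0.
  by have := xw_near (taylor_near sphi e0); apply: filterS => k []; rewrite expr1.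
rewrite -[u *m H]add0r.
have -> : (fun k => (t k)^-1 *: (grad (phi ^~ (w k)) (x k) - grad (phi ^~ (w k)) xbar))
    = (fun k => (t k ^+ 1)^-1 *: E k + ((t k)^-1 *: (x k - xbar)) *m H).
  by apply/funext => k; rewrite -scalemxAl -scalerDr subrK.
by apply: cvgD => //; apply: cvg_mulmx => //; exact: cvg_cst.
Qed.

Lemma cvg_second_order phi : twice_smooth phi ->
  (t k ^+ 2)^-1 * (phi (x k) (w k) - phi xbar (w k)
    - dotr (grad (phi ^~ (w k)) xbar) (x k - xbar))
    @[k --> F] --> qform (hess (phi ^~ wbar) xbar) u / 2.
Proof.
move=> sphi; set H := hess _ _.
pose E k : R^o := phi (x k) (w k) - phi xbar (w k)
    - dotr (grad (phi ^~ (w k)) xbar) (x k - xbar) - qform H (x k - xbar) / 2.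
have E0 : (t k ^+ 2)^-1 *: E k @[k --> F] --> (0 : R^o).
  apply: cvg_remainder => e e0.
  by have := xw_near (taylor_near sphi e0); apply: filterS => k [].
rewrite -[qform H u / 2]add0r.
have -> : (fun k => (t k ^+ 2)^-1 * (phi (x k) (w k) - phi xbar (w k)
    - dotr (grad (phi ^~ (w k)) xbar) (x k - xbar)))
    = (fun k => (t k ^+ 2)^-1 *: E k + qform H ((t k)^-1 *: (x k - xbar)) / 2).
  apply/funext => k; rewrite /E /qform -scalemxAl dotrZl dotrZr.
  by rewrite expr2 invfM /GRing.scale/=; ring.
apply: cvgD => //; apply: cvgM; last exact: cvg_cst.
by apply: cvg_dotr => //; apply: cvg_mulmx => //; exact: cvg_cst.
Qed.

End SmoothFamilies.

Section SecondDerivatives.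
Context {R : realType} {n m : nat}.
Implicit Types (g : 'rV[R]_n -> R) (G : 'rV[R]_n -> 'rV[R]_m) (x u : 'rV[R]_n).

(** The second derivative of [G] at [x] in direction [u], as the derivative of
the Jacobian and as a quadratic form with values in the image space. *)
Definition jacobian_derivative G x u : 'M[R]_(n, m) :=
  \matrix_(a, j) (u *m hess (Defs.coord G j) x) 0 a.

Definition curvature G x u : 'rV[R]_m := \row_j qform (hess (Defs.coord G j) x) u.

Lemma mul_jacobian_derivative G x u :
  u *m jacobian_derivative G x u = curvature G x u.
Proof.
apply/rowP => j; rewrite !mxE /qform dotrE; apply: eq_bigr => a _.
by rewrite mxE mulrC.
Qed.

Lemma entry_scaleB n1 n2 (c : R) (A B : 'M[R]_(n1, n2)) i j :
  (c *: (A - B)) i j = c * (A i j - B i j).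
Proof. by rewrite !mxE. Qed.

(** Links the two kinds of derivatives in the data: the Jacobian of the map, and
the gradients of its coordinates that define the Hessians. *)
Lemma jacobian_entry G x a j : differentiable G x ->
  'J G x a j = grad (Defs.coord G j) x 0 a.
Proof.
move=> dG; have [_ E] := derive_entry (delta_mx 0 a) j dG.
by rewrite [RHS]mxE /Defs.coord [RHS]E -rowE [RHS]mxE.
Qed.

Lemma grad_lagrangian g G (lam : 'rV[R]_m) x :
  differentiable g x -> differentiable G x ->
  grad (lagrangian g G lam) x = grad g x + lam *m ('J G x)^T.
Proof.
move=> dg dG; apply/rowP => a; rewrite !mxE /lagrangian.
have dGj j : derivable (fun y => lam 0 j *: (G y 0 j : R^o)) x (delta_mx 0 a).
  apply: derivableZ; have [] := derive_entry (delta_mx 0 a) j dG; exact.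
have -> : (fun y => g y + dotr lam (G y)) =
    g + \sum_j (fun y => lam 0 j *: (G y 0 j : R^o)).
  by apply/funext => y; rewrite /= fctE dotrE fct_sumE.
rewrite deriveD; [|exact: diff_derivable|exact: derivable_sum].
congr (_ + _); rewrite derive_sum//; apply: eq_bigr => j _.
rewrite deriveZ; last by have [] := derive_entry (delta_mx 0 a) j dG; exact.
by rewrite mxE jacobian_entry// !mxE.
Qed.

Lemma hess_lagrangian g G (lam : 'rV[R]_m) x u :
  (\forall y \near x, differentiable g y /\ differentiable G y) ->
  differentiable (grad g) x ->
  (forall j, differentiable (grad (Defs.coord G j)) x) ->
  qform (hess (lagrangian g G lam) x) u =
  qform (hess g x) u + dotr lam (curvature G x u).
Proof.
move=> dgG dg dG.
pose S y := grad g y + \sum_j lam 0 j *: grad (Defs.coord G j) y.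
have SE : {near x, S =1 grad (lagrangian g G lam)}.
  apply: filterS dgG => y [dgy dGy]; rewrite grad_lagrangian//; congr (_ + _).
  apply/rowP => a; rewrite summxE mxE; apply: eq_bigr => j _.
  by rewrite [LHS]mxE [in RHS]mxE jacobian_entry.
have dS : differentiable (grad g + \sum_j (fun y => lam 0 j *: grad (Defs.coord G j) y)) x.
  apply: differentiableD => //; apply: differentiable_sum => j.
  exact: differentiableZ.
have S2 : S = grad g + \sum_j (fun y => lam 0 j *: grad (Defs.coord G j) y).
  by apply/funext => y; rewrite /S fctE fct_sumE.
have dS' : differentiable S x by rewrite S2.
have [dL _] := near_eq_diff SE dS'.
have LE : u *m hess (lagrangian g G lam) x = 'D_u S x.
  by rewrite /hess -deriveEjacobian//; apply/esym/near_eq_derive.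
have gE : u *m hess g x = 'D_u (grad g) x by rewrite /hess -deriveEjacobian.
have DS : 'D_u S x = 'D_u (grad g) x +
    \sum_j lam 0 j *: 'D_u (grad (Defs.coord G j)) x.
  rewrite S2 deriveD; last first.
  - by apply: derivable_sum => j; apply: derivableZ; exact: diff_derivable.
  - exact: diff_derivable.
  congr (_ + _); rewrite derive_sum; last first.
    by move=> j; apply: derivableZ; exact: diff_derivable.
  by apply: eq_bigr => j _; rewrite deriveZ//; exact: diff_derivable.
transitivity (dotr ('D_u S x) u); first by rewrite /qform -LE.
have -> : qform (hess g x) u = dotr ('D_u (grad g) x) u.
  by rewrite /qform -gE.
rewrite DS dotrDl; congr (_ + _).
rewrite dotrE [RHS]dotrE; under eq_bigr do rewrite summxE mulr_suml.
rewrite exchange_big/=; apply: eq_bigr => j _.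
rewrite mxE /qform dotrE mulr_sumr; apply: eq_bigr => a _.
by rewrite mxE deriveEjacobian// mulrA.
Qed.

End SecondDerivatives.

Section SmoothMaps.
Context {R : realType} {n m : nat} {Omega : topologicalType}.
Context (f : 'rV[R]_n -> Omega -> R) (q : 'rV[R]_n -> Omega -> 'rV[R]_m).
Context (xbar : 'rV[R]_n) (wbar : Omega).

(** The regularity of the data, in the coordinatewise form to which expansions
of scalar functions apply. *)
Definition smooth_data : Prop :=
  [/\ twice_smooth xbar wbar f,
      forall j, twice_smooth xbar wbar (fun x w => q x w 0 j),
      \forall z \near (xbar, wbar), differentiable (q ^~ z.2) z.1
    & {for (xbar, wbar), continuous (fun z => grad (f ^~ z.2) z.1)} /\
      {for (xbar, wbar), continuous (fun z => 'J (q ^~ z.2) z.1)}].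

Lemma standing_smooth_data :
  standing_assumption f q xbar wbar -> smooth_data.
Proof.
move=> [U0 [W0 [[nU nW] dfq [_ fgrad qjac] [fhess qhess] _]]].
have nUW : \forall z \near (xbar, wbar), U0 z.1 /\ W0 z.2.
  by exists (U0, W0).
split.
- split => //; apply: filterS nUW => -[x w] /= [Ux Ww].
  by have [] := dfq x w Ux Ww.
- move=> j; split; last exact: qhess.
  apply: filterS nUW => -[x w] /= [Ux Ww]; have [_ _ dq dgq] := dfq x w Ux Ww.
  split; last exact: dgq.
  exact: (@differentiable_comp _ _ _ _ (q ^~ w) (fun v : 'rV[R]_m => v 0 j) x
    dq (differentiable_coord _ _ _)).
- by apply: filterS nUW => -[x w] /= [Ux Ww]; have [] := dfq x w Ux Ww.
- by split.
Qed.

Hypothesis smooth : smooth_data.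
Let J := 'J (q ^~ wbar) xbar.
Let ybar := q xbar wbar.

Context {I : Type} (F : set_system I) {FF : Filter F}.
Context (x : I -> 'rV[R]_n) (w : I -> Omega) (t : I -> R) (u : 'rV[R]_n).
Hypotheses (xlim : x k @[k --> F] --> xbar) (wlim : w k @[k --> F] --> wbar).
Hypotheses (t_gt0 : \forall k \near F, 0 < t k).
Hypothesis ulim : (t k)^-1 *: (x k - xbar) @[k --> F] --> u.

Lemma cvg_jacobian : 'J (q ^~ (w k)) (x k) @[k --> F] --> J.
Proof.
have [_ _ _ [_ qjac]] := smooth.
exact: (cvg_comp _ _ (cvg_pair xlim wlim) qjac).
Qed.

Lemma cvg_grad : grad (f ^~ (w k)) (x k) @[k --> F] --> grad (f ^~ wbar) xbar.
Proof.
have [_ _ _ [fgrad _]] := smooth.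
exact: (cvg_comp _ _ (cvg_pair xlim wlim) fgrad).
Qed.

Lemma cvg_jacobian_xbar : 'J (q ^~ (w k)) xbar @[k --> F] --> J.
Proof.
have [_ _ _ [_ qjac]] := smooth.
exact: (cvg_comp _ _ (cvg_pair (cvg_cst xbar) wlim) qjac).
Qed.

Lemma near_diff_xbar :
  \forall k \near F, differentiable (q ^~ (w k)) xbar.
Proof.
have [_ _ dq _] := smooth.
exact: (xw_near (cvg_cst xbar) wlim dq).
Qed.

Lemma near_diff_x :
  \forall k \near F, differentiable (q ^~ (w k)) (x k).
Proof. have [_ _ dq _] := smooth; exact: (xw_near xlim wlim dq). Qed.

Lemma cvg_jacobian_increment :
  (t k)^-1 *: ('J (q ^~ (w k)) xbar - J) @[k --> F] --> (0 : 'M[R]_(n, m)) ->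
  (t k)^-1 *: ('J (q ^~ (w k)) (x k) - J)
    @[k --> F] --> jacobian_derivative (q ^~ wbar) xbar u.
Proof.
move=> pJ; have [_ qj _ _] := smooth.
rewrite -[jacobian_derivative _ _ _]addr0.
have -> : (fun k => (t k)^-1 *: ('J (q ^~ (w k)) (x k) - J)) =
   (fun k => (t k)^-1 *: ('J (q ^~ (w k)) (x k) - 'J (q ^~ (w k)) xbar) +
             (t k)^-1 *: ('J (q ^~ (w k)) xbar - J)).
  by apply/funext => k; rewrite -scalerDr addrA subrK.
apply: cvgD => //.
pose E k : 'M[R]_(n, m) := \matrix_(a, j) ((t k)^-1 *: (grad (Defs.coord (q ^~ (w k)) j) (x k)
  - grad (Defs.coord (q ^~ (w k)) j) xbar)) 0 a.
apply: (cvg_near_eq (A := E)).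
  have := near_diff_x; apply: filterS2 near_diff_xbar => k d1 d2.
  apply/matrixP => a j.
  have := jacobian_entry a j d1; have := jacobian_entry a j d2; rewrite /E.
  move: ('J (q ^~ (w k)) (x k)) ('J (q ^~ (w k)) xbar) => A B AE BE.
  by rewrite [LHS]mxE !entry_scaleB AE BE.
apply: cvg_entries => a j; rewrite mxE; under eq_fun do rewrite mxE.
apply: cvg_entry; exact: (cvg_grad_increment xlim wlim t_gt0 ulim (qj j)).
Qed.

Let A k := (t k ^+ 2)^-1 *: (q (x k) (w k) - q xbar (w k)
  - (x k - xbar) *m 'J (q ^~ (w k)) xbar).

Lemma cvg_second_order_map :
  A k @[k --> F] --> 2^-1 *: curvature (q ^~ wbar) xbar u.
Proof.
have [_ qj _ _] := smooth.
pose E k : 'rV[R]_m := \row_j ((t k ^+ 2)^-1 * (q (x k) (w k) 0 j - q xbar (w k) 0 j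
   - dotr (grad (Defs.coord (q ^~ (w k)) j) xbar) (x k - xbar))).
apply: (cvg_near_eq (A := E)).
  apply: filterS near_diff_xbar => k dq; apply/rowP => j.
  have : forall a, 'J (q ^~ (w k)) xbar a j = grad (Defs.coord (q ^~ (w k)) j) xbar 0 a.
    by move=> a; exact: jacobian_entry.
  rewrite /A /E; move: ('J (q ^~ (w k)) xbar) => B BE; rewrite !mxE.
  congr (_ * (_ - _)); rewrite dotrE; apply: eq_bigr => a _.
  by rewrite BE mulrC.
apply: cvg_entries => i j; rewrite !mxE mulrC; under eq_fun do rewrite mxE.
exact: (cvg_second_order xlim wlim t_gt0 ulim (qj j)).
Qed.

Lemma cvg_curvature :
  (t k ^+ 2)^-1 *: (q xbar (w k) - ybar) @[k --> F] --> (0 : 'rV[R]_m) ->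
  (t k)^-1 *: ('J (q ^~ (w k)) xbar - J) @[k --> F] --> (0 : 'M[R]_(n, m)) ->
  (t k ^+ 2)^-1 *: (q (x k) (w k) - ybar - (x k - xbar) *m J)
    @[k --> F] --> 2^-1 *: curvature (q ^~ wbar) xbar u.
Proof.
move=> pq pJ.
have lim := cvgD (cvgD cvg_second_order_map pq) (cvg_mulmx ulim pJ).
rewrite mulmx0 !addr0 in lim.
suff -> : (fun k => (t k ^+ 2)^-1 *: (q (x k) (w k) - ybar - (x k - xbar) *m J)) =
   (fun k => A k + (t k ^+ 2)^-1 *: (q xbar (w k) - ybar) +
     ((t k)^-1 *: (x k - xbar)) *m ((t k)^-1 *: ('J (q ^~ (w k)) xbar - J))).
  exact: lim.
apply/funext => k; rewrite /A; move: ('J (q ^~ (w k)) xbar) J => B J'.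
rewrite -scalemxAl -scalemxAr scalerA -invfM -expr2.
rewrite -!scalerDr; congr (_ *: _); rewrite mulmxBr.
by apply/rowP => j; rewrite !mxE; ring.
Qed.

Lemma cvg_map_quotient : t k @[k --> F] --> (0 : R) ->
  (t k)^-1 *: (q xbar (w k) - ybar) @[k --> F] --> (0 : 'rV[R]_m) ->
  (t k)^-1 *: (q (x k) (w k) - ybar) @[k --> F] --> u *m J.
Proof.
move=> t0 pq.
have lim : t k *: A k + (t k)^-1 *: (q xbar (w k) - ybar) +
    ((t k)^-1 *: (x k - xbar)) *m 'J (q ^~ (w k)) xbar @[k --> F] -->
    0 *: (2^-1 *: curvature (q ^~ wbar) xbar u) + 0 + u *m J.
  exact: (cvgD (cvgD (cvgZ t0 cvg_second_order_map) pq)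
    (cvg_mulmx ulim cvg_jacobian_xbar)).
rewrite scale0r !add0r in lim.
apply: cvg_near_eq lim; apply: filterS t_gt0 => k tk.
rewrite /A; move: ('J (q ^~ (w k)) xbar) => B.
rewrite scalerA expr2 invfM mulrA mulfV ?gt_eqF// mul1r -scalemxAl.
rewrite -!scalerDr; congr (_ *: _).
by apply/rowP => j; rewrite !mxE; ring.
Qed.

End SmoothMaps.

(** * Limits of approximate multipliers *)

Lemma cvg_near0 {R : realType} I (F : set_system I) (a : I -> R) (l : R) :
  ProperFilter F -> a k @[k --> F] --> l -> (\forall k \near F, a k = 0) -> l = 0.
Proof.
move=> FF al a0; apply/eqP; rewrite eq_le; apply/andP; split.
  by apply: (cvgr_to_le al); apply: filterS a0 => k ->.
by apply: (cvgr_to_ge al); apply: filterS a0 => k ->.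
Qed.

Section MultiplierLimits.
Context {R : realType} {n m : nat} {Omega : topologicalType}.
Context (f : 'rV[R]_n -> Omega -> R) (q : 'rV[R]_n -> Omega -> 'rV[R]_m).
Context (P : set 'rV[R]_m) (xbar : 'rV[R]_n) (wbar : Omega).
Hypotheses (P_poly : polyhedral_union P) (smooth : smooth_data f q xbar wbar).
Let J := 'J (q ^~ wbar) xbar.
Let ybar := q xbar wbar.
Hypothesis Pybar : P ybar.

Context {I : Type} (F : set_system I) {FU : UltraFilter F}.
Context (x : I -> 'rV[R]_n) (w : I -> Omega) (t : I -> R) (u : 'rV[R]_n).
Context (y mu : I -> 'rV[R]_m).
Hypotheses (xlim : x k @[k --> F] --> xbar) (wlim : w k @[k --> F] --> wbar).
Hypotheses (t_gt0 : \forall k \near F, 0 < t k) (t0 : t k @[k --> F] --> (0 : R)).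
Hypothesis ulim : (t k)^-1 *: (x k - xbar) @[k --> F] --> u.
Hypothesis q_pert :
  (t k)^-1 *: (q xbar (w k) - ybar) @[k --> F] --> (0 : 'rV[R]_m).
Hypothesis yq : (t k)^-1 *: (q (x k) (w k) - y k) @[k --> F] --> (0 : 'rV[R]_m).
Hypothesis mu_nrm : \forall k \near F, regular_normal P (y k) (mu k).

Lemma cvg_image_normal_point :
  (t k)^-1 *: (y k - ybar) @[k --> F] --> u *m J.
Proof.
have im : (t k)^-1 *: (q (x k) (w k) - ybar) @[k --> F] --> u *m J.
  exact: (cvg_map_quotient smooth xlim wlim t_gt0 ulim t0 q_pert).
rewrite -[u *m J]subr0.
suff -> : (fun k => (t k)^-1 *: (y k - ybar)) =
    (fun k => (t k)^-1 *: (q (x k) (w k) - ybar) - (t k)^-1 *: (q (x k) (w k) - y k)).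
  exact: cvgB.
by apply/funext => k; rewrite -scalerBr opprB; congr (_ *: _); rewrite [RHS]addrC subrKA.
Qed.

Lemma limit_direction_Tlin : Tlin (q ^~ wbar) P xbar u.
Proof.
apply: (tangent_intro _ Pybar _ t0 cvg_image_normal_point).
apply: filterS2 t_gt0 mu_nrm => k tk muk; split=> //.
exact: regular_normal_mem muk.
Qed.

Lemma cvg_normal_point : y k @[k --> F] --> ybar.
Proof. exact: (cvg_of_quotient t_gt0 t0 cvg_image_normal_point). Qed.

(** Along an ultrafilter all base points [y k] lie in the same class, so that
the normals at one of them annihilate the displacements of all others. *)
Lemma normals_orthogonal : \forall j \near F, \forall k \near F,
  dotr (mu j) (y k - ybar) = 0.
Proof.
have [T [c cP]] := polyhedral_classes ybar P_poly.
have [s sP] := ultra_finite (c \o y) FU.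
have cy : \forall k \near F, forall z xi, c z = c (y k) ->
    regular_normal P z xi -> dotr xi (y k - ybar) = 0.
  exact: cvg_normal_point cP.
apply: filterS2 (sP) mu_nrm => j js muj.
apply: filterS2 sP cy => k ks cyk.
exact: (cyk (y j) (mu j) (etrans js (esym ks)) muj).
Qed.

(** Exact orthogonality, not only in the limit: [bounded_multipliers] divides it
by [t k]. *)
Lemma normals_orthogonal_limit : \forall j \near F, dotr (mu j) (u *m J) = 0.
Proof.
apply: filterS normals_orthogonal => j jk.
have lim : dotr (mu j) ((t k)^-1 *: (y k - ybar)) @[k --> F] -->
    dotr (mu j) (u *m J).
  by apply: cvg_dotr; [exact: cvg_cst|exact: cvg_image_normal_point].
apply: (cvg_near0 _ lim).
by apply: filterS jk => k jk; rewrite dotrZr jk mulr0.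
Qed.

Lemma limit_normal_orthogonal (lam : 'rV[R]_m) : mu k @[k --> F] --> lam ->
  \forall k \near F, dotr lam (y k - ybar) = 0.
Proof.
move=> mulim.
have [T [c cP]] := polyhedral_classes ybar P_poly.
have [s sP] := ultra_finite (c \o y) FU.
have cy : \forall k \near F, forall z xi, c z = c (y k) ->
    regular_normal P z xi -> dotr xi (y k - ybar) = 0.
  exact: cvg_normal_point cP.
apply: filterS2 (sP) cy => k ks cyk.
have lim : dotr (mu j) (y k - ybar) @[j --> F] --> dotr lam (y k - ybar).
  by apply: cvg_dotr => //; exact: cvg_cst.
apply: (cvg_near0 _ lim).
apply: filterS2 sP mu_nrm => j js muj.
exact: (cyk (y j) (mu j) (etrans js (esym ks)) muj).
Qed.

Lemma limit_normal_directional (lam : 'rV[R]_m) : mu k @[k --> F] --> lam ->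
  dir_normal P ybar (u *m J) lam.
Proof.
move=> mulim.
apply: (dir_normal_intro _ Pybar _ t0 cvg_image_normal_point mulim).
by apply: filterS2 t_gt0 mu_nrm => k tk muk.
Qed.

(** In the expansion of [q (x k) (w k) - y k], a normal [lam] in the kernel of
the adjoint Jacobian cancels the linear term, and by polyhedrality it cancels
[y k - ybar]. Only the curvature of the constraint map remains. *)
Lemma curvature_residual (lam : 'rV[R]_m) :
  mu k @[k --> F] --> lam -> lam *m J^T = 0 ->
  (t k ^+ 2)^-1 *: (q xbar (w k) - ybar) @[k --> F] --> (0 : 'rV[R]_m) ->
  (t k)^-1 *: ('J (q ^~ (w k)) xbar - J) @[k --> F] --> (0 : 'M[R]_(n, m)) ->
  (t k ^+ 2)^-1 * dotr lam (q (x k) (w k) - y k) @[k --> F] -->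
    dotr lam (curvature (q ^~ wbar) xbar u) / 2.
Proof.
move=> mulim lamJ q2 J1.
have cur : (t k ^+ 2)^-1 *: (q (x k) (w k) - ybar - (x k - xbar) *m J)
    @[k --> F] --> 2^-1 *: curvature (q ^~ wbar) xbar u.
  exact: (cvg_curvature smooth xlim wlim t_gt0 ulim q2 J1).
have lim : dotr lam ((t k ^+ 2)^-1 *: (q (x k) (w k) - ybar - (x k - xbar) *m J))
    @[k --> F] --> dotr lam (2^-1 *: curvature (q ^~ wbar) xbar u).
  by apply: cvg_dotr => //; exact: cvg_cst.
rewrite dotrZr mulrC in lim.
apply: cvg_near_eq lim.
apply: filterS (limit_normal_orthogonal mulim) => k lamy.
rewrite dotrZr !dotrBr (dotrC lam (_ *m J)) dotr_mulmx lamJ dotr0r subr0.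
by congr (_ * _); move: lamy; rewrite dotrBr; lra.
Qed.

Hypothesis J_pert :
  (t k)^-1 *: ('J (q ^~ (w k)) xbar - J) @[k --> F] --> (0 : 'M[R]_(n, m)).
Hypothesis f_pert :
  (t k)^-1 *: (grad (f ^~ (w k)) xbar - grad (f ^~ wbar) xbar) @[k --> F] -->
  (0 : 'rV[R]_n).
Hypothesis residual :
  (t k)^-1 *: (grad (f ^~ (w k)) (x k) + mu k *m ('J (q ^~ (w k)) (x k))^T)
    @[k --> F] --> (0 : 'rV[R]_n).

Lemma residual0 :
  grad (f ^~ (w k)) (x k) + mu k *m ('J (q ^~ (w k)) (x k))^T @[k --> F] -->
  (0 : 'rV[R]_n).
Proof.
by apply: (cvg_of_quotient t_gt0 t0); under eq_fun do rewrite subr0; exact: residual.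
Qed.

(** Testing the approximate stationarity equation with the limit direction [u]
itself, and not with the difference quotient, removes the multipliers [mu k]
from the terms of order zero: they are all orthogonal to [u *m J]. So only the
second-order terms survive after division by [t k]. *)
Lemma bounded_multipliers (lam : 'rV[R]_m) : mu k @[k --> F] --> lam ->
  [/\ grad (f ^~ wbar) xbar + lam *m J^T = 0,
      dotr (grad (f ^~ wbar) xbar) u = 0
    & qform (hess (f ^~ wbar) xbar) u + dotr lam (curvature (q ^~ wbar) xbar u)
      = 0].
Proof.
move=> mulim; set g := grad (f ^~ wbar) xbar.
have KKT : g + lam *m J^T = 0.
  apply: (cvg_unique _ _ residual0) => //.
  apply: cvgD; first exact: (cvg_grad smooth xlim wlim).
  by apply: cvg_mulmx => //; apply: cvg_trmx; exact: (cvg_jacobian smooth xlim wlim).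
have lamu : dotr lam (u *m J) = 0.
  have lim : dotr (mu k) (u *m J) @[k --> F] --> dotr lam (u *m J).
    by apply: cvg_dotr => //; exact: cvg_cst.
  exact: (cvg_near0 _ lim normals_orthogonal_limit).
have gu : dotr g u = 0.
  have := congr1 (dotr u) KKT.
  by rewrite dotrDr dotr0r -dotr_mulmx (dotrC _ lam) lamu addr0 dotrC.
split=> //.
have [sf _ _ _] := smooth.
have glim : (t k)^-1 *: (grad (f ^~ (w k)) (x k) - g) @[k --> F] -->
    u *m hess (f ^~ wbar) xbar.
  have lim : (t k)^-1 *: (grad (f ^~ (w k)) (x k) - grad (f ^~ (w k)) xbar) +
      (t k)^-1 *: (grad (f ^~ (w k)) xbar - g) @[k --> F] -->
      u *m hess (f ^~ wbar) xbar + 0.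
    by apply: cvgD => //; exact: (cvg_grad_increment xlim wlim t_gt0 ulim sf).
  rewrite addr0 in lim; apply: cvg_near_eq lim; apply: nearW => k.
  by rewrite -scalerDr subrKA.
have Jlim : (t k)^-1 *: ('J (q ^~ (w k)) (x k) - J) @[k --> F] -->
    jacobian_derivative (q ^~ wbar) xbar u.
  exact: (cvg_jacobian_increment smooth xlim wlim t_gt0 ulim J_pert).
have lim : dotr ((t k)^-1 *: (grad (f ^~ (w k)) (x k) - g)) u +
    dotr (mu k) (u *m ((t k)^-1 *: ('J (q ^~ (w k)) (x k) - J))) -
    dotr ((t k)^-1 *: (grad (f ^~ (w k)) (x k) +
      mu k *m ('J (q ^~ (w k)) (x k))^T)) u @[k --> F] -->
    dotr (u *m hess (f ^~ wbar) xbar) u +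
    dotr lam (u *m jacobian_derivative (q ^~ wbar) xbar u) - dotr 0 u.
  apply: cvgB; first apply: cvgD.
  - by apply: cvg_dotr => //; exact: cvg_cst.
  - by apply: cvg_dotr => //; apply: cvg_mulmx => //; exact: cvg_cst.
  - by apply: cvg_dotr => //; exact: cvg_cst.
rewrite dotr0l subr0 mul_jacobian_derivative in lim.
apply: (cvg_near0 _ lim); apply: filterS normals_orthogonal_limit => k muk.
move: ('J (q ^~ (w k)) (x k)) (grad (f ^~ (w k)) (x k)) muk => B gk.
rewrite -scalemxAr !dotrZl dotrZr dotrBl mulmxBr dotrBr dotrDl gu => ->.
by rewrite (dotrC (_ *m _) u) -dotr_mulmx (dotrC _ (mu k)); ring.
Qed.

(** Dividing the approximate KKT equation by [|mu k|] makes the gradient of the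
objective disappear in the limit. *)
Lemma unbounded_multipliers : (forall M, \forall k \near F, M < `|mu k|) ->
  exists (lam : 'rV[R]_m) (nu : I -> 'rV[R]_m),
    [/\ lam != 0, lam *m J^T = 0, nu k @[k --> F] --> lam
      & \forall k \near F, regular_normal P (y k) (nu k)].
Proof.
move=> mu_big; pose nu k := `|mu k|^-1 *: mu k.
have mu0 : \forall k \near F, 0 < `|mu k| by exact: mu_big.
have nu1 : \forall k \near F, `|nu k| = 1.
  apply: filterS mu0 => k muk; rewrite normrZ normfV normr_id mulVf//.
  by rewrite gt_eqF.
have [|lam nulim] := @ultra_cvg_bounded R I F m nu 1 FU.
  by apply: filterS nu1 => k ->.
have inv0 : `|mu k|^-1 @[k --> F] --> (0 : R).
  apply/cvgrPdist_le => e e0; apply: filterS (mu_big e^-1) => k ek.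
  rewrite sub0r normrN ger0_norm ?invr_ge0// -[leRHS]invrK lef_pV2 ?posrE ?invr_gt0//.
    exact: ltW.
  by rewrite (lt_trans _ ek) ?invr_gt0.
exists lam, nu; split=> //.
- rewrite -normr_eq0 gt_eqF// (lt_le_trans ltr01)//.
  by apply: (cvgr_to_ge (cvg_norm nulim)); apply: filterS nu1 => k ->.
- have lim1 : nu k *m ('J (q ^~ (w k)) (x k))^T @[k --> F] --> lam *m J^T.
    by apply: cvg_mulmx => //; apply: cvg_trmx; exact: (cvg_jacobian smooth xlim wlim).
  have lim2 : `|mu k|^-1 *: (grad (f ^~ (w k)) (x k) +
        mu k *m ('J (q ^~ (w k)) (x k))^T) -
      `|mu k|^-1 *: grad (f ^~ (w k)) (x k) @[k --> F] -->
      0 *: 0 - 0 *: grad (f ^~ wbar) xbar.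
    apply: cvgB; first exact: (cvgZ inv0 residual0).
    exact: (cvgZ inv0 (cvg_grad smooth xlim wlim)).
  rewrite !scale0r subrr in lim2.
  apply: (cvg_unique _ lim1) => //; apply: cvg_near_eq lim2; apply: nearW => k.
  by rewrite -scalerBr addrC addKr scalemxAl.
- apply: filterS2 mu0 mu_nrm => k muk; apply: regular_normalZ.
  by rewrite invr_gt0.
Qed.

Lemma multiplier_dichotomy :
  (exists lam : 'rV[R]_m, mu k @[k --> F] --> lam) \/
  (exists (lam : 'rV[R]_m) (nu : I -> 'rV[R]_m),
    [/\ lam != 0, lam *m J^T = 0, nu k @[k --> F] --> lam
      & \forall k \near F, regular_normal P (y k) (nu k)]).
Proof.
have [[M muM]|nM] := pselect (exists M, \forall k \near F, `|mu k| <= M).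
  by left; exact: (ultra_cvg_bounded FU muM).
right; apply: unbounded_multipliers => M.
have [muM|] := in_ultra_setVsetC [set k | `|mu k| <= M] FU.
  by case: nM; exists M.
by apply: filterS => k /negP; rewrite -ltNge.
Qed.

End MultiplierLimits.

(** * Failure of the stability estimate produces nets of approximate KKT points *)

Section Perturbations.
Context {R : realType}.

Lemma eball_bound n (x xbar : 'rV[R]_n) (r : R) :
  0 <= r -> enorm (x - xbar) <= r -> ball_at xbar r x.
Proof.
move=> r0 xr; have [r_eq0|r_neq0] := eqVneq r 0.
  exists 0; first by rewrite /eball/= /enorm dotr0l sqrtr0.
  rewrite scaler0 addr0; apply/eqP; rewrite eq_sym -subr_eq0 -normr_eq0 eq_le.
  by rewrite normr_ge0 andbT (le_trans (norm_le_enorm _))// (le_trans xr) ?r_eq0.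
have r_gt0 : 0 < r by rewrite lt_neqAle eq_sym r_neq0.
exists (r^-1 *: (x - xbar)); last by rewrite scalerA divff// scale1r addrC subrK.
by rewrite /eball/= enormZ ger0_norm ?invr_ge0// ler_pdivrMl// mulr1.
Qed.

Lemma norm_le_opnorm n m (A : 'M[R]_(n, m)) : `|A| <= opnorm A.
Proof.
have ubA : has_ubound [set enorm (u *m A) | u in @eball R n].
  exists (m.+1%:R * (n%:R * (1 * `|A|))) => _ [u u1 <-].
  rewrite (le_trans (enorm_le_norm _))// ler_wpM2l// (le_trans (norm_mulmx _ _))//.
  by rewrite ler_wpM2l// ler_wpM2r// (le_trans (norm_le_enorm _)).
have op_ge (u : 'rV[R]_n) : enorm u <= 1 -> enorm (u *m A) <= opnorm A.
  by move=> u1; apply: ub_le_sup => //; exists u.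
apply: norm_le_entries => [|i j].
  rewrite (le_trans _ (op_ge 0 _)) ?enorm_ge0//.
  by rewrite /enorm dotr0l sqrtr0.
have delta1 : enorm (delta_mx 0 i : 'rV[R]_n) <= 1.
  by rewrite /enorm dotr_delta mxE !eqxx sqrtr1.
apply: le_trans (op_ge _ delta1); rewrite -rowE.
by rewrite (le_trans _ (norm_le_enorm _))// (le_trans _ (entry_le_norm _ 0 j))// mxE.
Qed.

Lemma opnorm_ge0 n m (A : 'M[R]_(n, m)) : 0 <= opnorm A.
Proof. by rewrite (le_trans _ (norm_le_opnorm A)). Qed.

Context {I : Type} (F : set_system I) {FF : Filter F}.

Lemma cvg_quotient0 (V : normedModType R) (E : I -> V) (t b : I -> R) p :
  (\forall k \near F, 0 < t k /\ `|E k| <= b k * t k ^+ p) ->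
  b k @[k --> F] --> (0 : R) -> (t k ^+ p)^-1 *: E k @[k --> F] --> (0 : V).
Proof.
move=> Eb b0; apply/cvgrPdist_le => e e0.
have /cvgrPdist_le/(_ e e0) := b0.
apply: filterS2 Eb => k [tk Ek] be; rewrite sub0r normrN normrZ.
rewrite ger0_norm ?invr_ge0 ?exprn_ge0 ?(ltW tk)// ler_pdivrMl ?exprn_gt0//.
rewrite (le_trans Ek)// mulrC ler_wpM2l ?exprn_ge0 ?(ltW tk)//.
by move: be; rewrite sub0r normrN; exact: le_trans (ler_norm _).
Qed.

End Perturbations.

Lemma continuous_at_parameter (X Omega V : topologicalType)
    (g : X -> Omega -> V) (w : Omega) :
  continuous (fun z : X * Omega => g z.1 z.2) -> continuous (g ^~ w).
Proof.
move=> gcont x; have lim : (z, w) @[z --> x] --> (x, w).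
  move=> B [[U W] /= [nU nW] UWB]; apply: filterS nU => z Uz.
  by apply: UWB; split=> //=; exact: nbhs_singleton.
exact: (cvg_comp _ _ lim (gcont (x, w))).
Qed.

Section KKTNets.
Context {R : realType} {n m : nat} {Omega : topologicalType}.
Context (f : 'rV[R]_n -> Omega -> R) (q : 'rV[R]_n -> Omega -> 'rV[R]_m).
Context (P : set 'rV[R]_m) (xbar : 'rV[R]_n) (wbar : Omega).

(** What remains of the failure of the estimate with [tau_l] after normalisation
by the distance [t k] of the stationary points to [xbar]. The perturbation of
[q] at [xbar] is [o(t^l)] and not [o(t)] because [tau_l] contains its [l]-th
root. *)
Record KKT_net (l : nat) (I : Type) (F : set_system I) (x : I -> 'rV[R]_n)
    (w : I -> Omega) (t : I -> R) (u : 'rV[R]_n) (y mu : I -> 'rV[R]_m) : Prop := {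
  net_x : x k @[k --> F] --> xbar;
  net_w : w k @[k --> F] --> wbar;
  net_t_gt0 : \forall k \near F, 0 < t k;
  net_t : t k @[k --> F] --> (0 : R);
  net_u : (t k)^-1 *: (x k - xbar) @[k --> F] --> u;
  net_u_neq0 : u != 0;
  net_q : (t k ^+ l)^-1 *: (q xbar (w k) - q xbar wbar) @[k --> F] -->
    (0 : 'rV[R]_m);
  net_J : (t k)^-1 *: ('J (q ^~ (w k)) xbar - 'J (q ^~ wbar) xbar) @[k --> F] -->
    (0 : 'M[R]_(n, m));
  net_f : (t k)^-1 *: (grad (f ^~ (w k)) xbar - grad (f ^~ wbar) xbar)
    @[k --> F] --> (0 : 'rV[R]_n);
  net_y : (t k ^+ 2)^-1 *: (q (x k) (w k) - y k) @[k --> F] --> (0 : 'rV[R]_m);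
  net_nrm : \forall k \near F, regular_normal P (y k) (mu k);
  net_res : (t k)^-1 *: (grad (f ^~ (w k)) (x k) +
      mu k *m ('J (q ^~ (w k)) (x k))^T) @[k --> F] --> (0 : 'rV[R]_n) }.

Definition stability_estimate (l : nat) : Prop :=
  exists (U : set 'rV[R]_n) (W : set Omega) (L : R),
    [/\ nbhs xbar U, nbhs wbar W, 0 < L
      & forall w, W w ->
         (M_stationary (f ^~ w) (q ^~ w) P `|` stationary (f ^~ w) (q ^~ w) P)
           `&` U `<=` ball_at xbar (L * tau_ f q xbar wbar l w)].

Hypotheses (q_cont : continuous (fun z : 'rV[R]_n * Omega => q z.1 z.2)).
Hypotheses (P_closed : closed P) (smooth : smooth_data f q xbar wbar).

(** The exponent [1 / l] in [tau] is undone here: the perturbation of [q] is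
controlled by the [l]-th power of [tau]. *)
Lemma tau_bounds l w : (0 < l)%N ->
  [/\ 0 <= tau_ f q xbar wbar l w,
      `|grad (f ^~ w) xbar - grad (f ^~ wbar) xbar| <= tau_ f q xbar wbar l w,
      `|'J (q ^~ w) xbar - 'J (q ^~ wbar) xbar| <= tau_ f q xbar wbar l w
    & `|q xbar w - q xbar wbar| <= tau_ f q xbar wbar l w ^+ l].
Proof.
move=> l0; rewrite /tau_ /e_.
set a := enorm (grad _ _ - _); set b := opnorm _; set c := enorm (q _ _ - _).
have a0 : 0 <= a by exact: enorm_ge0.
have b0 : 0 <= b by exact: opnorm_ge0.
have c0 : 0 <= c by exact: enorm_ge0.
have p0 : 0 <= c `^ l%:R^-1 by exact: powR_ge0.
split.
- by rewrite !addr_ge0.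
- by rewrite (le_trans (norm_le_enorm _))// -/a lerDl addr_ge0.
- by rewrite (le_trans (norm_le_opnorm _))// -/b addrCA lerDl addr_ge0.
- rewrite (le_trans (norm_le_enorm _))// -/c.
  have {1}-> : c = (c `^ l%:R^-1) ^+ l.
    by rewrite -powR_mulrn// -powRrM mulVf ?pnatr_eq0 -?lt0n// powRr1.
  by rewrite lerXn2r ?nnegrE ?addr_ge0// addrA lerDr addr_ge0.
Qed.

(** The nets are indexed by the triples [(e, (x, w))] with [x] stationary at [w]
and [tau w < e * |x - xbar|], and ordered by [e] tending to [0] and [(x, w)]
tending to [(xbar, wbar)]. Stationary points are then replaced by approximate
KKT points with tolerance [t^3]. *)
Lemma failure_net l : (l == 1%N) || (l == 2%N) -> ~ stability_estimate l ->
  exists (I : Type) (F : set_system I) x w t u y mu,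
    UltraFilter F /\ @KKT_net l I F x w t u y mu.
Proof.
move=> l12 fail.
have l0 : (0 < l)%N by case/orP: l12 => /eqP->.
pose I := (R * ('rV[R]_n * Omega))%type.
pose tau := tau_ f q xbar wbar l.
pose A : set I := [set z | [/\ 0 < z.1,
   (M_stationary (f ^~ z.2.2) (q ^~ z.2.2) P `|`
    stationary (f ^~ z.2.2) (q ^~ z.2.2) P) z.2.1
   & tau z.2.2 < z.1 * `|z.2.1 - xbar| ] ].
have [F [FU BF FA]] : exists F : set_system I, [/\ UltraFilter F,
    filter_prod (0 : R)^'+ (nbhs (xbar, wbar)) `<=` F & F A].
  apply: frequently_ultra => B [[E V] /= [E0 [[U W] /= [nU nW] UWV]] EVB].
  have [e [e0 Ee]] : exists e : R, 0 < e /\ E e.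
    have : (0 : R)^'+ (E `&` [set e | 0 < e]).
      by apply: filterI => //; exact: nbhs_right_gt.
    by move=> /filter_ex[e [? ?]]; exists e.
  apply: contrapT => nAB; apply: fail.
  exists U, W, (n.+1%:R / e); split=> //; first by rewrite divr_gt0.
  move=> w Ww x [xS Ux]; apply: contrapT => nball; apply: nAB.
  have [tau0 _ _ _] := tau_bounds w l0.
  have L0 : 0 < n.+1%:R / e by rewrite divr_gt0.
  exists (e, (x, w)); split; last by apply: EVB; split => //=; exact: UWV.
  split => //=; rewrite ltNge; apply/negP => xtau; apply: nball.
  apply: eball_bound; first by rewrite mulr_ge0// ltW.
  rewrite (le_trans (enorm_le_norm _))// -mulrA ler_pM2l// ler_pdivlMl//.
pose x0 (z : I) := z.2.1; pose w (z : I) := z.2.2; pose t (z : I) := `|x0 z - xbar|.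
have elim : z.1 @[z --> F] --> (0 : R).
  apply: cvg_trans (cvg_app _ BF) _.
  by apply: cvg_trans (cvg_fst) _; exact: cvg_within.
have zlim : z.2 @[z --> F] --> (xbar, wbar).
  by apply: cvg_trans (cvg_app _ BF) _; exact: cvg_snd.
have x0lim : x0 z @[z --> F] --> xbar by exact: (cvg_comp _ _ zlim cvg_fst).
have wlim : w z @[z --> F] --> wbar by exact: (cvg_comp _ _ zlim cvg_snd).
have t_gt0 : \forall z \near F, 0 < t z.
  apply: filterS FA => z [e0 _ tz]; have [tau0 _ _ _] := tau_bounds z.2.2 l0.
  by rewrite -(pmulr_rgt0 _ e0) (le_lt_trans tau0).
have tlim : t z @[z --> F] --> (0 : R).
  have : t z @[z --> F] --> `|xbar - xbar|.
    by apply: cvg_norm; apply: cvgB => //; exact: cvg_cst.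
  by rewrite subrr normr0.
have [[df _] _ dq _] := smooth.
have good : \forall z \near F,
    [/\ \forall x \near x0 z, differentiable (q ^~ (w z)) x,
        {for x0 z, continuous (grad (f ^~ (w z)))}, 0 < t z & A z].
  have dq2 : \forall z \near (xbar, wbar), \forall x \near z.1,
      differentiable (q ^~ z.2) x.
    have [[U W] /= [nU nW] UWd] := dq.
    exists (U°, W); first by split => //; exact: nbhs_interior.
    move=> [x w'] /= [Ux Ww]; apply: filterS Ux => x' Ux'.
    exact: (UWd (x', w') (conj Ux' Ww)).
  have ev1 : \forall z \near F, \forall x \near x0 z, differentiable (q ^~ (w z)) x.
    exact: (zlim _ dq2).
  have ev2 : \forall z \near F, differentiable (f ^~ (w z)) (x0 z) /\
      differentiable (grad (f ^~ (w z))) (x0 z) by exact: (zlim _ df).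
  have ev3 : \forall z \near F, 0 < t z /\ A z by exact: filterI.
  apply: filterS3 ev1 ev2 ev3 => z z1 [_ z2] [z3 z4].
  by split=> //; exact: differentiable_continuous.
have /choice[p pP] (z : I) : exists p : 'rV[R]_n * ('rV[R]_m * 'rV[R]_m),
    [/\ \forall x \near x0 z, differentiable (q ^~ (w z)) x,
        {for x0 z, continuous (grad (f ^~ (w z)))}, 0 < t z & A z] ->
    [/\ `|p.1 - x0 z| <= t z ^+ 3, `|q p.1 (w z) - p.2.1| <= t z ^+ 3,
        regular_normal P p.2.1 p.2.2
      & `|grad (f ^~ (w z)) p.1 + p.2.2 *m ('J (q ^~ (w z)) p.1)^T| <= t z ^+ 3].
  have [[dqz fz tz [_ Sz _]]|nz] := pselect (
      [/\ \forall x \near x0 z, differentiable (q ^~ (w z)) x,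
        {for x0 z, continuous (grad (f ^~ (w z)))}, 0 < t z & A z]); last first.
    by exists (0, (0, 0)) => /nz.
  have : asymptotically_stationary (f ^~ (w z)) (q ^~ (w z)) P (x0 z).
    case: Sz => [/M_stationary_asymptotically//|].
    by apply: stationary_asymptotically => //; exact: continuous_at_parameter.
  move=> /(_ _ (exprn_gt0 3 tz))[x [y [lam pz]]].
  by exists (x, (y, lam)).
pose x z := (p z).1; pose y z := (p z).2.1; pose mu z := (p z).2.2.
have small (V : normedModType R) (E : I -> V) k : (k <= 2)%N ->
    (\forall z \near F, `|E z| <= t z ^+ 3) ->
    (t z ^+ k)^-1 *: E z @[z --> F] --> (0 : V).
  move=> k2 Et.
  have t1 : \forall z \near F, t z < 1 by apply: (cvgr_lt _ tlim).
  apply: (@cvg_quotient0 _ _ _ _ _ _ _ t) (tlim).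
  apply: filterS3 t_gt0 t1 Et => z tz tz1 Ez; split=> //; rewrite (le_trans Ez)//.
  by rewrite -exprS ler_wiXn2l// ltW.
have xx0 : \forall z \near F, `|x z - x0 z| <= t z ^+ 3.
  by apply: filterS good => z /pP[].
have xlim : x z @[z --> F] --> xbar.
  have lim : (t z ^+ 0)^-1 *: (x z - x0 z) + x0 z @[z --> F] --> 0 + xbar.
    by apply: cvgD => //; exact: small.
  rewrite add0r in lim; apply: cvg_near_eq lim; apply: nearW => z.
  by rewrite expr0 invr1 scale1r subrK.
have dir1 : \forall z \near F, `|(t z)^-1 *: (x0 z - xbar)| = 1.
  by apply: filterS t_gt0 => z tz; rewrite normrZ normfV normr_id mulVf ?gt_eqF.
have [|u ulim0] := @ultra_cvg_bounded R I F n (fun z => (t z)^-1 *: (x0 z - xbar)) 1 FU.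
  by apply: filterS dir1 => z ->.
have ulim : (t z)^-1 *: (x z - xbar) @[z --> F] --> u.
  have lim : (t z ^+ 1)^-1 *: (x z - x0 z) + (t z)^-1 *: (x0 z - xbar) @[z --> F] --> 0 + u.
    by apply: cvgD => //; exact: small.
  rewrite add0r in lim; apply: cvg_near_eq lim; apply: nearW => z.
  by rewrite expr1 -scalerDr subrKA.
have tauF : \forall z \near F, 0 < t z /\ tau (w z) <= z.1 * t z.
  by apply: filterS2 t_gt0 FA => z tz [_ _ /ltW].
have pert (V : normedModType R) (E : I -> V) :
    (forall z, `|E z| <= tau (w z)) -> (t z)^-1 *: E z @[z --> F] --> (0 : V).
  move=> Etau; apply: (@cvg_quotient0 _ _ _ _ _ _ t _ 1) elim.
  apply: filterS tauF => z [tz tauz]; split=> //.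
  by rewrite expr1 (le_trans (Etau z)).
exists I, F, x, w, t, u, y, mu; split=> //; split=> //.
- rewrite -normr_eq0 gt_eqF// (lt_le_trans ltr01)//.
  by apply: (cvgr_to_ge (cvg_norm ulim0)); apply: filterS dir1 => z ->.
- have el : z.1 ^+ l @[z --> F] --> (0 : R).
    by case/orP: l12 => /eqP-> //; rewrite -[0](mulr0 0); exact: cvgM.
  apply: cvg_quotient0 el; apply: filterS tauF => z [tz tauz]; split=> //.
  have [tau0 _ _ qtau] := tau_bounds (w z) l0.
  by rewrite (le_trans qtau)// -exprMn lerXn2r ?nnegrE ?(le_trans tau0).
- by apply: pert => z; have [] := tau_bounds (w z) l0.
- by apply: pert => z; have [] := tau_bounds (w z) l0.
- by apply: small => //; apply: filterS good => z /pP[].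
- by apply: filterS good => z /pP[].
- by apply: (@small _ _ 1) => //; apply: filterS good => z /pP[].
Qed.

End KKTNets.

(** * The stability estimates *)

Section Estimates.
Context {R : realType} {n m : nat} {Omega : topologicalType}.
Context (f : 'rV[R]_n -> Omega -> R) (q : 'rV[R]_n -> Omega -> 'rV[R]_m).
Context (P : set 'rV[R]_m) (xbar : 'rV[R]_n) (wbar : Omega).
Hypotheses (q_cont : continuous (fun z : 'rV[R]_n * Omega => q z.1 z.2)).
Hypotheses (P_poly : polyhedral_union P) (smooth : smooth_data f q xbar wbar).
Hypothesis Pybar : P (q xbar wbar).
Let J := 'J (q ^~ wbar) xbar.
Let ybar := q xbar wbar.

Lemma near_reference (Q : 'rV[R]_n * Omega -> Prop) :
  (\forall z \near (xbar, wbar), Q z) -> \forall x \near xbar, Q (x, wbar).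
Proof.
move=> [[U W] /= [nU nW] UWQ]; apply: filterS nU => x Ux; apply: UWQ.
by split=> //=; exact: nbhs_singleton.
Qed.

Lemma smooth_reference :
  [/\ \forall x \near xbar, differentiable (f ^~ wbar) x /\
        differentiable (q ^~ wbar) x,
      differentiable (grad (f ^~ wbar)) xbar
    & forall j, differentiable (grad (Defs.coord (q ^~ wbar) j)) xbar].
Proof.
have [[df _] sq dq _] := smooth.
have dfx := near_reference df; have dqx := near_reference dq.
split.
- by apply: filterS2 dfx dqx => x [].
- by have [] := nbhs_singleton dfx.
- by move=> j; have [dqj _] := sq j; have [] := nbhs_singleton (near_reference dqj).
Qed.

Lemma grad_lagrangian_reference (lam : 'rV[R]_m) :
  grad (lagrangian (f ^~ wbar) (q ^~ wbar) lam) xbar =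
  grad (f ^~ wbar) xbar + lam *m J^T.
Proof.
have [dfq _ _] := smooth_reference; have [dfx dqx] := nbhs_singleton dfq.
exact: grad_lagrangian.
Qed.

Lemma hess_lagrangian_reference (lam : 'rV[R]_m) u :
  qform (hess (lagrangian (f ^~ wbar) (q ^~ wbar) lam) xbar) u =
  qform (hess (f ^~ wbar) xbar) u + dotr lam (curvature (q ^~ wbar) xbar u).
Proof. by have [dfq dgf dgq] := smooth_reference; exact: hess_lagrangian. Qed.

Lemma hess_constraint_reference (lam : 'rV[R]_m) u :
  qform (hess (fun y => dotr lam (q y wbar)) xbar) u =
  dotr lam (curvature (q ^~ wbar) xbar u).
Proof.
have [dfq _ dgq] := smooth_reference.
have g0 : grad (fun=> 0 : R) = fun=> 0 :> 'rV[R]_n.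
  by apply/funext => x; apply/rowP => j; rewrite !mxE; exact: derive_cst.
have -> : (fun y => dotr lam (q y wbar)) = lagrangian (fun=> 0) (q ^~ wbar) lam.
  by apply/funext => y; rewrite /lagrangian add0r.
rewrite hess_lagrangian//; last 2 first.
- by apply: filterS dfq => x [_ dqx]; split => //; exact: differentiable_cst.
- by rewrite g0; exact: differentiable_cst.
rewrite (_ : qform _ u = 0) ?add0r// /qform /hess g0.
rewrite -deriveEjacobian; last exact: differentiable_cst.
by rewrite derive_cst dotr0l.
Qed.

Lemma net_y1 l I (F : set_system I) {FF : Filter F} x w t u y mu :
  @KKT_net _ _ _ _ f q P xbar wbar l I F x w t u y mu ->
  (t k)^-1 *: (q (x k) (w k) - y k) @[k --> F] --> (0 : 'rV[R]_m).
Proof.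
move=> net; exact: (cvg_lower_quotient (net_t_gt0 net) (net_t net) (net_y net)).
Qed.

(** Convergent multipliers are excluded by RSSOSC, since the second-order form
of the Lagrangian vanishes at the critical direction [u]; unbounded ones by
FOSCMS. *)
Lemma stability_estimate1 : FOSCMS (q ^~ wbar) P xbar ->
  RSSOSC (f ^~ wbar) (q ^~ wbar) P xbar -> stability_estimate f q P xbar wbar 1.
Proof.
move=> foscms rssosc; apply: contrapT => fail.
have [I [F [x [w [t [u [y [mu [FU net]]]]]]]]] :=
  failure_net (l := 1) q_cont (polyhedral_union_closed P_poly) smooth isT fail.
have y1 : (t k)^-1 *: (q (x k) (w k) - y k) @[k --> F] --> (0 : 'rV[R]_m).
  exact: (net_y1 net).
have [xl wl tg tl ul u0 q1 J1 f1 y2 nl rl] := net.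
have uT := limit_direction_Tlin (FU := FU) smooth Pybar xl wl tg tl ul q1 y1 nl.
have [[lam mul]|[lam [nu [lam0 lamJ nul nun]]]] :=
  multiplier_dichotomy (FU := FU) smooth xl wl tg tl nl rl.
- have [KKT gu so] :=
    bounded_multipliers (FU := FU) P_poly smooth xl wl tg tl ul q1 y1 nl J1 f1 rl mul.
  have lamN := limit_normal_directional (FU := FU) smooth Pybar xl wl tg tl ul q1 y1 nl mul.
  have uC : critical_cone (f ^~ wbar) (q ^~ wbar) P xbar u.
    by split=> //; rewrite gu.
  have lamM : multipliers (f ^~ wbar) (q ^~ wbar) P xbar u lam.
    by split=> //; rewrite grad_lagrangian_reference.
  by have := rssosc u u0 uC lam lamM; rewrite hess_lagrangian_reference so ltxx.
- have lamN := limit_normal_directional (FU := FU) smooth Pybar xl wl tg tl ul q1 y1 nun nul.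
  by move/eqP : lam0; apply; exact: (foscms u).
Qed.

(** For unbounded multipliers, [y k] is so close to [q (x k) (w k)] that the
curvature term of [curvature_residual] vanishes, which SOSCMS excludes. For
convergent ones, quadratic growth at [wbar] is tested at the points [x k],
although these are almost feasible for [w k] only: [q (x k) (w k)] and
[q (x k) wbar] differ by [o(t^2)]. *)
Lemma stability_estimate2 : SOSCMS (q ^~ wbar) P xbar ->
  ess_local_min2 (f ^~ wbar) (q ^~ wbar) P xbar ->
  stability_estimate f q P xbar wbar 2.
Proof.
move=> soscms [_ [eta [U [eta0 nU essU]]]]; apply: contrapT => fail.
have [I [F [x [w [t [u [y [mu [FU net]]]]]]]]] :=
  failure_net (l := 2) q_cont (polyhedral_union_closed P_poly) smooth isT fail.
have y1 : (t k)^-1 *: (q (x k) (w k) - y k) @[k --> F] --> (0 : 'rV[R]_m).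
  exact: (net_y1 net).
have [xl wl tg tl ul u0 q2 J1 f1 y2 nl rl] := net.
have q1 : (t k)^-1 *: (q xbar (w k) - ybar) @[k --> F] --> (0 : 'rV[R]_m).
  exact: (cvg_lower_quotient tg tl q2).
have uT := limit_direction_Tlin (FU := FU) smooth Pybar xl wl tg tl ul q1 y1 nl.
have [[lam mul]|[lam [nu [lam0 lamJ nul nun]]]] :=
  multiplier_dichotomy (FU := FU) smooth xl wl tg tl nl rl; last first.
  have lamN := limit_normal_directional (FU := FU) smooth Pybar xl wl tg tl ul q1 y1 nun nul.
  have cur : (t k ^+ 2)^-1 * dotr lam (q (x k) (w k) - y k) @[k --> F] -->
      dotr lam (curvature (q ^~ wbar) xbar u) / 2.
    exact: (curvature_residual (FU := FU) P_poly smooth xl wl tg tl ul q1 y1 nun nul lamJ q2 J1).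
  have lim : (t k ^+ 2)^-1 * dotr lam (q (x k) (w k) - y k) @[k --> F] -->
      dotr lam (0 : 'rV[R]_m).
    under eq_fun do rewrite -dotrZr.
    by apply: cvg_dotr => //; exact: cvg_cst.
  have cur0 : dotr lam (curvature (q ^~ wbar) xbar u) / 2 = 0.
    by rewrite -(dotr0r lam); exact: (cvg_unique _ cur lim).
  move/eqP : lam0; apply; apply: (soscms u) => //.
  by rewrite hess_constraint_reference; move: cur0; lra.
have [KKT gu so] :=
  bounded_multipliers (FU := FU) P_poly smooth xl wl tg tl ul q1 y1 nl J1 f1 rl mul.
pose cst_q k := q (x k) wbar.
have qlim : (t k ^+ 2)^-1 *: (cst_q k - ybar - (x k - xbar) *m J) @[k --> F] -->
    2^-1 *: curvature (q ^~ wbar) xbar u.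
  apply: (cvg_curvature smooth xl (cvg_cst wbar) tg ul).
    by under eq_fun do rewrite subrr scaler0; exact: cvg_cst.
  by under eq_fun do rewrite subrr scaler0; exact: cvg_cst.
have qwlim : (t k ^+ 2)^-1 *: (q (x k) (w k) - ybar - (x k - xbar) *m J)
    @[k --> F] --> 2^-1 *: curvature (q ^~ wbar) xbar u.
  exact: (cvg_curvature smooth xl wl tg ul q2 J1).
have qy : (t k ^+ 2)^-1 *: (cst_q k - y k) @[k --> F] --> (0 : 'rV[R]_m).
  have lim : (t k ^+ 2)^-1 *: (cst_q k - ybar - (x k - xbar) *m J) -
      (t k ^+ 2)^-1 *: (q (x k) (w k) - ybar - (x k - xbar) *m J) +
      (t k ^+ 2)^-1 *: (q (x k) (w k) - y k) @[k --> F] -->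
      2^-1 *: curvature (q ^~ wbar) xbar u - 2^-1 *: curvature (q ^~ wbar) xbar u
      + 0.
    exact: (cvgD (cvgB qlim qwlim) y2).
  rewrite subrr add0r in lim.
  apply: cvg_near_eq lim; apply: nearW => k; rewrite -scalerBr -scalerDr.
  by congr (_ *: _); apply/rowP => j; rewrite !mxE; ring.
have [sf _ _ _] := smooth.
have flim : (t k ^+ 2)^-1 * (f (x k) wbar - f xbar wbar -
    dotr (grad (f ^~ wbar) xbar) (x k - xbar)) @[k --> F] -->
    qform (hess (f ^~ wbar) xbar) u / 2.
  exact: (cvg_second_order xl (cvg_cst wbar) tg ul sf).
have uu0 : 0 < eta * enorm u ^+ 2 by rewrite mulr_gt0// exprn_gt0// enorm_gt0.
pose b k := eta * enorm ((t k)^-1 *: (x k - xbar)) ^+ 2.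
have blim : b k @[k --> F] --> eta * enorm u ^+ 2.
  by apply: cvgM; [exact: cvg_cst|apply: cvgM; exact: cvg_enorm].
(* The distance of [q (x k) wbar] to [P] being [o(t^2)], the maximum in the
growth condition is attained by the objective. *)
have growth : \forall k \near F,
    b k <= (t k ^+ 2)^-1 * (f (x k) wbar - f xbar wbar).
  have xU : \forall k \near F, U (x k) by exact: xl.
  have close : \forall k \near F, enorm ((t k ^+ 2)^-1 *: (cst_q k - y k)) < b k.
    have lim : b k - enorm ((t k ^+ 2)^-1 *: (cst_q k - y k)) @[k --> F] -->
        eta * enorm u ^+ 2 - enorm (0 : 'rV[R]_m).
      by apply: cvgB => //; exact: cvg_enorm.
    rewrite /enorm dotr0l sqrtr0 subr0 in lim.
    have : \forall k \near F, 0 < b k - enorm ((t k ^+ 2)^-1 *: (cst_q k - y k)).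
      by apply: (cvgr_gt _ lim).
    by apply: filterS => k; rewrite subr_gt0.
  have tgn : \forall k \near F, 0 < t k /\ regular_normal P (y k) (mu k).
    exact: filterI.
  apply: filterS3 tgn xU close => k [tk Pyk] Ux qyk.
  have t2 : 0 < (t k ^+ 2)^-1 by rewrite invr_gt0 exprn_gt0.
  have bE : b k = (t k ^+ 2)^-1 * (eta * enorm (x k - xbar) ^+ 2).
    rewrite /b enormZ exprMn ger0_norm ?invr_ge0 ?(ltW tk)// exprVn.
    by ring.
  rewrite bE ler_pM2l//.
  have := essU _ Ux; rewrite le_max lee_fin => /orP[//|far].
  have : (Defs.edist (cst_q k) P <= (enorm (cst_q k - y k))%:E)%E.
    by apply: ereal_inf_lbound; exists (y k) => //; exact: regular_normal_mem Pyk.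
  move=> /(le_trans far); rewrite lee_fin => far2.
  move: qyk; rewrite enormZ ger0_norm ?(ltW t2)// bE ltr_pM2l//.
  by rewrite ltNge far2.
have lamy := limit_normal_orthogonal (FU := FU) P_poly smooth xl wl tg tl ul q1 y1 nl mul.
have lim : (t k ^+ 2)^-1 * (f (x k) wbar - f xbar wbar -
    dotr (grad (f ^~ wbar) xbar) (x k - xbar)) +
    dotr lam ((t k ^+ 2)^-1 *: (cst_q k - ybar - (x k - xbar) *m J)) -
    dotr lam ((t k ^+ 2)^-1 *: (cst_q k - y k)) - b k @[k --> F] -->
    qform (hess (f ^~ wbar) xbar) u / 2 +
    dotr lam (2^-1 *: curvature (q ^~ wbar) xbar u) - dotr lam 0 -
    eta * enorm u ^+ 2.
  apply: cvgB => //; apply: cvgB; first apply: cvgD => //.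
    by apply: cvg_dotr => //; exact: cvg_cst.
  by apply: cvg_dotr => //; exact: cvg_cst.
have : 0 <= qform (hess (f ^~ wbar) xbar) u / 2 +
    dotr lam (2^-1 *: curvature (q ^~ wbar) xbar u) - dotr lam 0 -
    eta * enorm u ^+ 2.
  apply: (cvgr_to_ge lim); apply: filterS2 growth lamy => k bk lamyk.
  have KKTx : dotr (grad (f ^~ wbar) xbar) (x k - xbar) +
      dotr lam ((x k - xbar) *m J) = 0.
    have := congr1 (dotr (x k - xbar)) KKT.
    by rewrite dotrDr dotr0r -dotr_mulmx (dotrC _ lam) dotrC.
  rewrite subr_ge0 (le_trans bk)// -subr_ge0.
  rewrite !dotrZr -!mulrDr -!mulrBr.
  rewrite (_ : _ * _ = 0)//.
  move: KKTx lamyk; rewrite /ybar !dotrBr => KKTx lamyk.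
  rewrite (_ : _ - _ = 0) ?mulr0//.
  by move: KKTx lamyk; lra.
by rewrite dotr0r dotrZr subr0; move: so uu0; lra.
Qed.

End Estimates.

(** * Feasible points and local minimisers near the reference point *)

Section Existence.
Context {R : realType} {n m : nat} {Omega : topologicalType}.
Context (f : 'rV[R]_n -> Omega -> R) (q : 'rV[R]_n -> Omega -> 'rV[R]_m).
Context (P : set 'rV[R]_m) (xbar : 'rV[R]_n) (wbar : Omega).
Hypotheses (f_cont : continuous (fun z : 'rV[R]_n * Omega => f z.1 z.2)).
Hypotheses (q_cont : continuous (fun z : 'rV[R]_n * Omega => q z.1 z.2)).
Hypotheses (P_poly : polyhedral_union P) (smooth : smooth_data f q xbar wbar).
Hypothesis Pybar : P (q xbar wbar).
Let J := 'J (q ^~ wbar) xbar.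
Let ybar := q xbar wbar.

(** Quantitative necessary condition for metric regularity: shifting the target
by a small multiple [s *: xi] of a normal [xi] at [y] must be compensated by a
displacement of [x] of order [s], whose image under [J] has to pay for it. *)
Lemma metric_regularity_normals :
  metrically_regular (constraint_map (q ^~ wbar) P) xbar 0 ->
  exists C : R, \forall y \near ybar, forall xi,
    regular_normal P y xi -> enorm xi <= C * `|xi *m J^T|.
Proof.
move=> [kap [U [V [kap0 nU nV regUV]]]].
(* [kap + 1] makes the regularity inequality strict, so that it is realised by
some point although the distance is an infimum. *)
exists (n%:R * (kap + 1)).
have nV2 : \forall y \near ybar, V° (ybar - y).
  have sub_cont : continuous (fun y : 'rV[R]_m => ybar - y).
    by move=> y; exact: (cvgB (cvg_cst _) cvg_id).
  have lim := sub_cont ybar; rewrite /continuous_at subrr in lim.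
  by apply: lim; exact: nbhs_interior.
apply: filterS nV2 => y Vy xi xi_nrm.
have [->|xi0] := eqVneq xi 0.
  by rewrite /enorm dotr0l sqrtr0 mul0mx normr0 mulr0.
have c0 := enorm_gt0 xi0; set c := enorm xi in c0 *.
have nVs : \forall s \near (0 : R)^'+, 0 < s /\ V (ybar - y + s *: (- xi)).
  apply: filterI; first exact: nbhs_right_gt.
  exact: (@cvg_ray _ _ (ybar - y) (- xi) _ Vy).
have [F [FU F0]] := ultraFilterLemma (at_right_proper_filter (0 : R)).
have /choice[z zP] (s : R) : exists z : 'rV[R]_n,
    0 < s /\ V (ybar - y + s *: (- xi)) ->
    enorm (xbar - z) <= (kap + 1) * (s * c) /\
    P (q z wbar - ybar + y + s *: xi).
  have [[s0 Vs]|ns] := pselect (0 < s /\ V (ybar - y + s *: (- xi))); last first.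
    by exists 0.
  have sc0 : 0 < s * c by rewrite mulr_gt0.
  have := regUV xbar _ (nbhs_singleton nU) Vs.
  set Y := ybar - y + s *: (- xi).
  have dY : (Defs.edist Y (constraint_map (q ^~ wbar) P xbar) <= (s * c)%:E)%E.
    apply: ereal_inf_lbound; exists (ybar - y).
      by exists y => //; exact: regular_normal_mem xi_nrm.
    by rewrite /Y addrC addKr enormZ gtr0_norm// enormN.
  move=> /le_lt_trans - /(_ ((kap + 1) * (s * c))%:E).
  have lt1 : (kap%:E * Defs.edist Y (constraint_map (q ^~ wbar) P xbar) <
      ((kap + 1) * (s * c))%:E)%E.
    apply: (@le_lt_trans _ _ (kap%:E * (s * c)%:E)%E).
      by rewrite lee_pmul2l.
    by rewrite -EFinM lte_fin ltr_pM2r// ltrDl.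
  move=> /(_ lt1) /ereal_inf_lt[_ [z Mz <-]]; rewrite lte_fin => zlt.
  exists z => _; split; first exact: ltW.
  case: Mz => p Pp; rewrite /Y => pE.
  rewrite (_ : _ + s *: xi = p)//.
  have -> : q z wbar = ybar - y + s *: - xi + p by rewrite -pE subrK.
  by apply/rowP => j; rewrite !mxE; ring.
have sF : \forall s \near F, 0 < s /\ V (ybar - y + s *: (- xi)) by exact: F0.
pose h s : 'rV[R]_n := s^-1 *: (z s - xbar).
have h_le : \forall s \near F, `|h s| <= (kap + 1) * c.
  apply: filterS sF => s sP; have [zs _] := zP s sP; have [s0 _] := sP.
  rewrite normrZ ger0_norm ?invr_ge0 ?(ltW s0)// ler_pdivrMl// mulrCA.
  by rewrite (le_trans _ zs)// distrC norm_le_enorm.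
have [h0 hlim] := ultra_cvg_bounded FU h_le.
have slim : s @[s --> F] --> (0 : R).
  by apply: cvg_trans (cvg_at_right_filter (f := id) cvg_id); exact: cvg_app.
have s_gt0 : \forall s \near F, 0 < s by apply: filterS sF => s [].
have zlim : z s @[s --> F] --> xbar.
  exact: (cvg_of_quotient s_gt0 slim hlim).
have qlim : s^-1 *: (q (z s) wbar - ybar) @[s --> F] --> h0 *m J.
  apply: (cvg_map_quotient smooth zlim (cvg_cst wbar) s_gt0 hlim slim).
  by under eq_fun do rewrite subrr scaler0; exact: cvg_cst.
have plim : s^-1 *: (q (z s) wbar - ybar) + xi @[s --> F] --> h0 *m J + xi.
  by apply: cvgD => //; exact: cvg_cst.
have main : dotr xi (h0 *m J + xi) <= 0.
  have /regular_normalP[_ xi_le] := xi_nrm.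
  have v1 : 0 < `|h0 *m J + xi| + 1 by rewrite ltr_wpDl.
  apply/ler_addgt0Pr => e e0; rewrite add0r.
  have e10 : 0 < e / (`|h0 *m J + xi| + 1) by rewrite divr_gt0.
  have ptlim : q (z s) wbar - ybar + y + s *: xi @[s --> F] --> y.
    have lim : s *: (s^-1 *: (q (z s) wbar - ybar) + xi) + y @[s --> F] -->
        0 *: (h0 *m J + xi) + y.
      by apply: cvgD; [exact: cvgZ|exact: cvg_cst].
    rewrite scale0r add0r in lim; apply: cvg_near_eq lim.
    apply: filterS s_gt0 => s s0; rewrite scalerDr scalerA mulfV ?gt_eqF// scale1r.
    by rewrite addrAC.
  have ev : \forall s \near F, P (q (z s) wbar - ybar + y + s *: xi) ->
      dotr xi (q (z s) wbar - ybar + y + s *: xi - y) <=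
      e / (`|h0 *m J + xi| + 1) * `|q (z s) wbar - ybar + y + s *: xi - y|.
    exact: (ptlim _ (xi_le _ e10)).
  have ev2 : \forall s \near F, dotr xi (s^-1 *: (q (z s) wbar - ybar) + xi) <=
      e / (`|h0 *m J + xi| + 1) * `|s^-1 *: (q (z s) wbar - ybar) + xi|.
    apply: filterS2 sF ev => s sP; have [_ Pz] := zP s sP => /(_ Pz).
    have [s0 _] := sP.
    have -> : q (z s) wbar - ybar + y + s *: xi - y =
        s *: (s^-1 *: (q (z s) wbar - ybar) + xi).
      rewrite scalerDr scalerA mulfV ?gt_eqF// scale1r.
      by apply/rowP => j; rewrite !mxE; ring.
    by rewrite dotrZr normrZ gtr0_norm// mulrCA ler_pM2l.
  have lim2 : e / (`|h0 *m J + xi| + 1) * `|s^-1 *: (q (z s) wbar - ybar) + xi|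
      - dotr xi (s^-1 *: (q (z s) wbar - ybar) + xi) @[s --> F] -->
      e / (`|h0 *m J + xi| + 1) * `|h0 *m J + xi| - dotr xi (h0 *m J + xi).
    apply: cvgB; first by apply: cvgM; [exact: cvg_cst|exact: cvg_norm].
    by apply: cvg_dotr => //; exact: cvg_cst.
  have : 0 <= e / (`|h0 *m J + xi| + 1) * `|h0 *m J + xi| - dotr xi (h0 *m J + xi).
    by apply: (cvgr_to_ge lim2); apply: filterS ev2 => s; rewrite subr_ge0.
  rewrite subr_ge0 => /le_trans; apply.
  by rewrite -mulrA ler_piMr ?(ltW e0)// ler_pdivrMl// mulr1 lerDl.
have h0_le : `|h0| <= (kap + 1) * c.
  by apply: (cvgr_to_le (cvg_norm hlim)).
move: main; rewrite dotrDr -sqr_enorm -/c (dotrC xi) dotr_mulmx => main.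
have := le_trans (ler_norm _) (norm_dotr (- h0) (xi *m J^T)).
rewrite dotrNl normrN => hJ.
have hJ2 : n%:R * (`|h0| * `|xi *m J^T|) <=
    n%:R * ((kap + 1) * c * `|xi *m J^T|) by rewrite ler_wpM2l// ler_wpM2r.
rewrite -(ler_pM2r c0) -expr2.
rewrite (_ : _ * c = n%:R * ((kap + 1) * c * `|xi *m J^T|)); last by ring.
by move: main hJ hJ2; lra.
Qed.

(** For [v] in the linearised tangent cone, the points [xbar + t *: v] are
feasible up to an error of order [t^2], even at parameters [w] whose
perturbations are small compared with [t^2]. If there were no feasible point
near them, exact penalisation with slope [s], [s^2 = t], would produce unit
normals at points whose distance to [xbar + t *: v] is of order [t^2 / s], that
is [s * t = o(t)]: such points have the same limit direction [v]. The limit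
normal [lam] lies in the kernel of the adjoint Jacobian, which is impossible
under metric regularity. The residual is a positive multiple of the unit normal,
so that its product with [lam] is eventually positive; by [curvature_residual],
the curvature has the sign that SOSCMS forbids. *)
Lemma feasible_along (v : 'rV[R]_n) (rho : R) :
  Tlin (q ^~ wbar) P xbar v ->
  (v != 0 -> SOSCMS (q ^~ wbar) P xbar) ->
  (v = 0 -> metrically_regular (constraint_map (q ^~ wbar) P) xbar 0) ->
  0 < rho -> \forall w \near wbar, exists2 x, `|x - xbar| < rho & P (q x w).
Proof.
move=> vT soscms mr rho0; apply: contrapT => nfeas.
(* The first component is [s], the square root of the step [t]; parameters are
admitted only if their perturbations are [o(t^2)] and [o(t)]. *)
pose I := (R * Omega)%type.
pose A : set I := [set z | [/\ 0 < z.1,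
  forall x, `|x - xbar| < rho -> ~ P (q x z.2),
  `|q xbar z.2 - ybar| <= z.1 * (z.1 ^+ 2) ^+ 2
  & `|'J (q ^~ z.2) xbar - J| <= z.1 * z.1 ^+ 2]].
have [_ _ dq [_ Jcont]] := smooth.
have [F [FU BF FA]] : exists F : set_system I, [/\ UltraFilter F,
    filter_prod (0 : R)^'+ (nbhs wbar) `<=` F & F A].
  apply: frequently_ultra => B [[E W] /= [E0 nW] EWB].
  have [s [s0 Es]] : exists s : R, 0 < s /\ E s.
    have : (0 : R)^'+ (E `&` [set e | 0 < e]).
      by apply: filterI => //; exact: nbhs_right_gt.
    by move=> /filter_ex[s [? ?]]; exists s.
  have pair_lim : (xbar, w) @[w --> wbar] --> (xbar, wbar).
    move=> C [[U V] /= [nU nV] UVC]; apply: filterS nV => w Vw.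
    by apply: UVC; split=> //=; exact: nbhs_singleton.
  have q_near : \forall w \near wbar, `|q xbar w - ybar| <= s * (s ^+ 2) ^+ 2.
    have lim : q xbar w @[w --> wbar] --> ybar.
      exact: (cvg_comp _ _ pair_lim (@q_cont (xbar, wbar))).
    move/cvgr_distC_le : lim; apply; by rewrite mulr_gt0// !exprn_gt0.
  have J_near : \forall w \near wbar, `|'J (q ^~ w) xbar - J| <= s * s ^+ 2.
    have lim : 'J (q ^~ w) xbar @[w --> wbar] --> J.
      exact: (cvg_comp _ _ pair_lim Jcont).
    move/cvgr_distC_le : lim; apply; by rewrite mulr_gt0// exprn_gt0.
  apply: contrapT => nAB; apply: nfeas.
  apply: filterS3 nW q_near J_near => w Ww qw Jw.
  apply: contrapT => nx; apply: nAB; exists (s, w); split; last exact: EWB.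
  by split=> //= x xr Px; apply: nx; exists x.
pose w (z : I) := z.2; pose t (z : I) := z.1 ^+ 2.
have slim : z.1 @[z --> F] --> (0 : R).
  apply: cvg_trans (cvg_app _ BF) _.
  by apply: cvg_trans (cvg_fst) _; exact: cvg_within.
have wlim : w z @[z --> F] --> wbar.
  by apply: cvg_trans (cvg_app _ BF) _; exact: cvg_snd.
have s_gt0 : \forall z \near F, 0 < z.1 by apply: filterS FA => z [].
have t_gt0 : \forall z \near F, 0 < t z.
  by apply: filterS s_gt0 => z z0; rewrite exprn_gt0.
have tlim : t z @[z --> F] --> (0 : R).
  by rewrite -[0](mulr0 0); exact: cvgM.
have q2 : (t z ^+ 2)^-1 *: (q xbar (w z) - ybar) @[z --> F] --> (0 : 'rV[R]_m).
  apply: cvg_quotient0 slim; apply: filterS2 t_gt0 FA => z tz [_ _ qz _].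
  by split.
have q1 : (t z)^-1 *: (q xbar (w z) - ybar) @[z --> F] --> (0 : 'rV[R]_m).
  exact: (cvg_lower_quotient t_gt0 tlim q2).
have J1 : (t z)^-1 *: ('J (q ^~ (w z)) xbar - J) @[z --> F] --> (0 : 'M[R]_(n, m)).
  apply: (@cvg_quotient0 _ _ _ _ _ _ t _ 1) slim.
  by apply: filterS2 t_gt0 FA => z tz [_ _ _ Jz]; split.
pose xh z := xbar + t z *: v.
have xhlim : xh z @[z --> F] --> xbar.
  have lim : xbar + t z *: v @[z --> F] --> xbar + 0 *: v.
    by apply: cvgD; [exact: cvg_cst|apply: cvgZ => //; exact: cvg_cst].
  by rewrite scale0r addr0 in lim.
have vlim : (t z)^-1 *: (xh z - xbar) @[z --> F] --> v.
  have lim : (fun=> v) z @[z --> F] --> v by exact: cvg_cst.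
  apply: cvg_near_eq lim; apply: filterS t_gt0 => z tz.
  by rewrite /xh addrC addKr scalerA mulVf ?gt_eqF// scale1r.
pose yh z := ybar + t z *: (v *m J).
have Pyh : \forall z \near F, P (yh z).
  have ray := tangent_polyhedral P_poly vT.
  have tlim2 : t z @[z --> F] --> (0 : R)^'+.
    move=> B; rewrite /at_right/= => B0.
    have ev : \forall z \near F, 0 < t z -> B (t z) by exact: (tlim _ B0).
    by apply: filterS2 t_gt0 ev => z tz; apply.
  exact: (tlim2 _ ray).
have errlim : (t z ^+ 2)^-1 *: (q (xh z) (w z) - yh z) @[z --> F] -->
    2^-1 *: curvature (q ^~ wbar) xbar v.
  have lim : (t z ^+ 2)^-1 *: (q (xh z) (w z) - ybar - (xh z - xbar) *m J)
      @[z --> F] --> 2^-1 *: curvature (q ^~ wbar) xbar v.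
    exact: (cvg_curvature smooth xhlim wlim t_gt0 vlim q2 J1).
  apply: cvg_near_eq lim; apply: nearW => z; congr (_ *: _).
  by rewrite /xh /yh [xbar + _ - xbar]addrC addKr opprD addrA scalemxAl.
pose M := enorm (2^-1 *: curvature (q ^~ wbar) xbar v) + 1.
have M0 : 0 < M by rewrite ltr_wpDl// enorm_ge0.
have err : \forall z \near F, enorm (q (xh z) (w z) - yh z) <= M * t z ^+ 2.
  have eM : \forall z \near F, enorm ((t z ^+ 2)^-1 *: (q (xh z) (w z) - yh z)) <= M.
    by apply: (cvgr_le _ (cvg_enorm errlim)); rewrite ltrDl.
  apply: filterS2 t_gt0 eM => z tz; rewrite enormZ ger0_norm; last first.
    by rewrite invr_ge0 exprn_ge0// ltW.
  have t20 : 0 < t z ^+ 2 by rewrite exprn_gt0.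
  by rewrite ler_pdivrMl// [M * _]mulrC.
have [[U W] /= [/nbhs_normP[r0 /= r00 rU] nW] UWd] := dq.
pose r := Num.min rho r0 / 2.
have r_gt0 : 0 < r by rewrite divr_gt0// lt_min rho0 r00.
have [r2rho r2r0] : r + r <= rho /\ r + r <= r0.
  by rewrite /r -splitr; split; rewrite ge_min lexx ?orbT.
have xhr : \forall z \near F, `|xh z - xbar| < r.
  by move/cvgr_distC_lt : xhlim; exact.
have Ms : \forall z \near F, M * z.1 ^+ 3 < r.
  have lim : M * (z.1 * (z.1 * z.1)) @[z --> F] --> M * (0 * (0 * 0)).
    by apply: cvgM; [exact: cvg_cst|apply: cvgM => //; exact: cvgM].
  rewrite !mulr0 in lim; have ev : \forall z \near F, M * (z.1 * (z.1 * z.1)) < r.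
    by apply: (cvgr_lt _ lim).
  by apply: filterS ev => z; rewrite exprS expr2.
have /choice[p pP] (z : I) : exists p : 'rV[R]_n * 'rV[R]_m,
    [/\ 0 < z.1, P (yh z), enorm (q (xh z) (w z) - yh z) <= M * t z ^+ 2,
      M * z.1 ^+ 3 < r & forall x, `|x - xh z| < r ->
        differentiable (q ^~ (w z)) x /\ ~ P (q x (w z))] ->
    let lam := (enorm (q p.1 (w z) - p.2))^-1 *: (q p.1 (w z) - p.2) in
    [/\ `|p.1 - xh z| <= M * z.1 * t z,
        0 < enorm (q p.1 (w z) - p.2) <= M * t z ^+ 2,
        regular_normal P p.2 lam & `|lam *m ('J (q ^~ (w z)) p.1)^T| <= z.1].
  have [[s0 Pyz errz Msz inf]|nz] := pselect ([/\ 0 < z.1, P (yh z),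
      enorm (q (xh z) (w z) - yh z) <= M * t z ^+ 2, M * z.1 ^+ 3 < r
    & forall x, `|x - xh z| < r ->
        differentiable (q ^~ (w z)) x /\ ~ P (q x (w z))]); last first.
    by exists (0, 0).
  have Mr : M * t z ^+ 2 < z.1 * r.
    by rewrite (_ : _ * _ = z.1 * (M * z.1 ^+ 3)) ?ltr_pM2l// /t; ring.
  have qc : continuous (q ^~ (w z)) by exact: continuous_at_parameter.
  have [x [y [xz yz nz Jz]]] := infeasible_normal qc (polyhedral_union_closed P_poly)
    Pyz s0 errz Mr inf.
  exists (x, y) => _; split=> //=; rewrite (le_trans xz)// ler_pdivrMr//.
  by rewrite le_eqVlt; apply/orP; left; apply/eqP; rewrite /t; ring.
have pF : \forall z \near F,
    let lam := (enorm (q (p z).1 (w z) - (p z).2))^-1 *: (q (p z).1 (w z) - (p z).2) in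
    [/\ `|(p z).1 - xh z| <= M * z.1 * t z,
        0 < enorm (q (p z).1 (w z) - (p z).2) <= M * t z ^+ 2,
        regular_normal P (p z).2 lam &
        `|lam *m ('J (q ^~ (w z)) (p z).1)^T| <= z.1].
  have WF : \forall z \near F, W (w z) by exact: wlim.
  have ev1 : \forall z \near F, [/\ P (yh z),
      enorm (q (xh z) (w z) - yh z) <= M * t z ^+ 2 & M * z.1 ^+ 3 < r].
    by apply: filterS3 Pyh err Ms => z.
  have ev2 : \forall z \near F, W (w z) /\ A z by exact: filterI.
  apply: filterS3 ev1 xhr ev2 => z [Pyz errz Msz] xhz [Wz [s0 infz _ _]].
  apply: pP; split=> // x xz.
  have xr : `|x - xbar| < r + r.
    by rewrite -(subrKA (xh z)) (le_lt_trans (ler_normD _ _))// ltrD.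
  split; last by apply: infz; exact: lt_le_trans r2rho.
  apply: (UWd (x, w z)); split=> //=; apply: rU => /=.
  by rewrite distrC; exact: lt_le_trans r2r0.
pose x z := (p z).1; pose y z := (p z).2.
pose mu z := (enorm (q (x z) (w z) - y z))^-1 *: (q (x z) (w z) - y z).
have mu_nrm : \forall z \near F, regular_normal P (y z) (mu z).
  by apply: filterS pF => z [].
have xsmall : (t z)^-1 *: (x z - xh z) @[z --> F] --> (0 : 'rV[R]_n).
  apply: (@cvg_quotient0 _ _ _ _ _ _ t (fun z => M * z.1) 1).
    by apply: filterS2 t_gt0 pF => z tz [xz _ _ _]; split.
  by rewrite -(mulr0 M); apply: cvgM => //; exact: cvg_cst.
have ulim : (t z)^-1 *: (x z - xbar) @[z --> F] --> v.
  have lim : (t z)^-1 *: (x z - xh z) + (t z)^-1 *: (xh z - xbar) @[z --> F] --> 0 + v.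
    exact: cvgD.
  rewrite add0r in lim; apply: cvg_near_eq lim; apply: nearW => z.
  by rewrite -scalerDr subrKA.
have xlim : x z @[z --> F] --> xbar.
  exact: (cvg_of_quotient t_gt0 tlim ulim).
have y1 : (t z)^-1 *: (q (x z) (w z) - y z) @[z --> F] --> (0 : 'rV[R]_m).
  apply: (@cvg_quotient0 _ _ _ _ _ _ t (fun z => M * t z) 1).
    apply: filterS2 t_gt0 pF => z tz [_ /andP[_ yz] _ _]; split=> //.
    by rewrite (le_trans (norm_le_enorm _))// (le_trans yz)// expr2 mulrA.
  by rewrite -(mulr0 M); apply: cvgM => //; exact: cvg_cst.
have mu1 : \forall z \near F, enorm (mu z) = 1.
  apply: filterS pF => z [_ /andP[d0 _] _ _].
  by rewrite enormZ ger0_norm ?invr_ge0 ?(ltW d0)// mulVf// gt_eqF.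
have [lam mulim] : exists lam : 'rV[R]_m, mu z @[z --> F] --> lam.
  apply: (@ultra_cvg_bounded R I F m mu 1).
  by apply: filterS mu1 => z <-; exact: norm_le_enorm.
have lam1 : enorm lam = 1.
  have lim : enorm (mu z) - 1 @[z --> F] --> enorm lam - 1.
    by apply: cvgB; [exact: cvg_enorm|exact: cvg_cst].
  apply/eqP; rewrite -subr_eq0; apply/eqP/(cvg_near0 _ lim).
  by apply: filterS mu1 => z ->; rewrite subrr.
have lamJ : lam *m J^T = 0.
  have lim : mu z *m ('J (q ^~ (w z)) (x z))^T @[z --> F] --> lam *m J^T.
    by apply: cvg_mulmx => //; apply: cvg_trmx; exact: (cvg_jacobian smooth xlim wlim).
  have lim0 : mu z *m ('J (q ^~ (w z)) (x z))^T @[z --> F] --> (0 : 'rV[R]_n).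
    have lim1 : ((1 : R) ^+ 0)^-1 *: (mu z *m ('J (q ^~ (w z)) (x z))^T)
        @[z --> F] --> (0 : 'rV[R]_n).
      apply: (@cvg_quotient0 _ _ _ _ _ _ (fun=> 1) (fun z => z.1) 0) slim.
      by apply: filterS pF => z [_ _ _ Jz]; rewrite expr0 mulr1; split.
    by apply: cvg_near_eq lim1; apply: nearW => z; rewrite expr0 invr1 scale1r.
  exact: (cvg_unique _ lim lim0).
have [v0|v0] := eqVneq v 0.
  have [C CP] := metric_regularity_normals (mr v0).
  have ylim := cvg_normal_point (FU := FU) smooth xlim wlim t_gt0 tlim ulim q1 y1.
  have Cev : \forall z \near F, forall xi, regular_normal P (y z) xi ->
      enorm xi <= C * `|xi *m J^T| by exact: (ylim _ CP).
  have lim : C * `|mu z *m J^T| @[z --> F] --> C * `|lam *m J^T|.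
    apply: cvgM; first exact: cvg_cst.
    by apply: cvg_norm; apply: cvg_mulmx => //; exact: cvg_cst.
  rewrite lamJ normr0 mulr0 in lim.
  have : 1 <= 0 :> R.
    apply: (cvgr_to_ge lim); apply: filterS3 mu1 mu_nrm Cev => z muz nz Cz.
    by rewrite -muz; exact: Cz.
  by rewrite ler10.
have cur : (t z ^+ 2)^-1 * dotr lam (q (x z) (w z) - y z) @[z --> F] -->
    dotr lam (curvature (q ^~ wbar) xbar v) / 2.
  exact: (curvature_residual (FU := FU) P_poly smooth xlim wlim t_gt0 tlim ulim
    q1 y1 mu_nrm mulim lamJ q2 J1).
have cur0 : 0 <= dotr lam (curvature (q ^~ wbar) xbar v) / 2.
  apply: (cvgr_to_ge cur).
  have dotlim : dotr lam (mu z) @[z --> F] --> dotr lam lam.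
    by apply: cvg_dotr => //; exact: cvg_cst.
  have dot_gt0 : \forall z \near F, 0 < dotr lam (mu z).
    by apply: (cvgr_gt _ dotlim); rewrite -sqr_enorm lam1 expr1n.
  apply: filterS3 t_gt0 pF dot_gt0 => z tz [_ /andP[d0 _] _ _].
  rewrite dotrZr pmulr_rgt0 ?invr_gt0// => lamq.
  by apply: ltW; rewrite mulr_gt0// invr_gt0 exprn_gt0.
have lamN := limit_normal_directional (FU := FU) smooth Pybar xlim wlim t_gt0
  tlim ulim q1 y1 mu_nrm mulim.
have : lam = 0.
  apply: (soscms v0 v v0 vT lam lamJ lamN).
  by rewrite (hess_constraint_reference smooth); move: cur0; lra.
move=> lam0; move: lam1; rewrite lam0 /enorm dotr0l sqrtr0 => /esym/eqP.
by rewrite oner_eq0.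
Qed.

Lemma feasible_nearby (rho : R) : SOSCMS (q ^~ wbar) P xbar ->
  Tlin (q ^~ wbar) P xbar <> [set 0] \/
    metrically_regular (constraint_map (q ^~ wbar) P) xbar 0 ->
  0 < rho -> \forall w \near wbar, exists2 x, `|x - xbar| < rho & P (q x w).
Proof.
move=> soscms nondeg rho0.
have T0 : Tlin (q ^~ wbar) P xbar 0.
  rewrite /Tlin/= mul0mx; split=> //.
  exists (fun k => k.+1%:R^-1), (fun=> 0); split.
  - by move=> k; rewrite invr_gt0.
  - exact: cvg_harmonic.
  - exact: cvg_cst.
  - by move=> k; rewrite scaler0 addr0.
have [mr|nmr] :=
    pselect (metrically_regular (constraint_map (q ^~ wbar) P) xbar 0).
  by apply: (feasible_along T0) => //; rewrite eqxx.
have [v [vT v0]] : exists v, Tlin (q ^~ wbar) P xbar v /\ v != 0.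
  case: nondeg => // nT; apply: contrapT => nv; apply: nT.
  rewrite eqEsubset; split=> [v vT|_ ->//] /=.
  by apply: contrapT => /eqP v0; apply: nv; exists v.
by apply: (feasible_along vT) => // v_eq0; move: v0; rewrite v_eq0 eqxx.
Qed.

(** A limit of minimisers over the feasible part of a small ball is feasible
and, as there are feasible points arbitrarily close to [xbar], not worse than
[xbar]. By quadratic growth it is [xbar]. Hence the minimisers end up in the
interior of the ball, where they are local minimisers of the problem. *)
Lemma local_minimizer_nearby (U : set 'rV[R]_n) :
  ess_local_min2 (f ^~ wbar) (q ^~ wbar) P xbar -> nbhs xbar U ->
  (forall rho : R, 0 < rho ->
    \forall w \near wbar, exists2 x, `|x - xbar| < rho & P (q x w)) ->
  \forall w \near wbar, local_minimizers (f ^~ w) (q ^~ w) P `&` U !=set0.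
Proof.
move=> [_ [eta [V [eta0 nV essV]]]] nU feas; apply: contrapT => nmin.
have P_closed := polyhedral_union_closed P_poly.
have [r r0 rUV] : exists2 r : R, 0 < r & forall x : 'rV[R]_n, `|x - xbar| <= r -> U x /\ V x.
  have /nbhs_normP[r /= r0 rUV] : \forall x \near xbar, U x /\ V x by exact: filterI.
  exists (r / 2); first by rewrite divr_gt0.
  move=> x xr; apply: rUV; rewrite /= distrC (le_lt_trans xr)//.
  by rewrite ltr_pdivrMr// ltr_pMr// ltr1n.
pose B := [set x : 'rV[R]_n | `|x - xbar| <= r].
have cB : compact B by exact: compact_normed_ball.
have [F [FU BF FA]] : exists F : set_system Omega, [/\ UltraFilter F,
    nbhs wbar `<=` F & F [set w |
      ~ (local_minimizers (f ^~ w) (q ^~ w) P `&` U !=set0)]].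
  apply: frequently_ultra => W nW; apply: contrapT => nAW; apply: nmin.
  apply: filterS nW => w Ww; apply: contrapT => nw; apply: nAW.
  by exists w.
have wlim : w @[w --> F] --> wbar by exact: BF.
have /choice[x xP] (w : Omega) : exists x : 'rV[R]_n,
    (exists2 z, `|z - xbar| < r & P (q z w)) ->
    [/\ B x, P (q x w) & forall z, B z -> P (q z w) -> f x w <= f z w].
  have [[z zr Pz]|nz] := pselect (exists2 z, `|z - xbar| < r & P (q z w)); last first.
    by exists 0.
  have qc : continuous (q ^~ w) by exact: continuous_at_parameter.
  have fc : continuous (f ^~ w) by exact: continuous_at_parameter.
  have cK : compact (B `&` [set x | P (q x w)]).
    apply: compact_closedI => //.
    exact: (preimage_closed (fun x _ => qc x) P_closed).
  have [] := @compact_EVT_min _ R (f ^~ w) (B `&` [set x | P (q x w)]) _ cK _.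
  - by exists z; split => //; exact: ltW.
  - exact: continuous_subspaceT.
  - move=> x /set_mem[Bx Px] xmin; exists x => _; split=> // z' Bz' Pz'.
    by apply: xmin; apply/mem_set.
have xF : \forall w \near F,
    [/\ B (x w), P (q (x w) w) & forall z, B z -> P (q z w) -> f (x w) w <= f z w].
  by apply: filterS (BF _ (feas r r0)) => w /xP.
have [xs Bxs xlim] : exists2 xs, B xs & x w @[w --> F] --> xs.
  by apply: ultra_cvg_compact cB _; apply: filterS xF => w [].
have pair_lim : (x w, w) @[w --> F] --> (xs, wbar).
  exact: (cvg_pair xlim wlim).
have Pxs : P (q xs wbar).
  apply: (closed_cvg P P_closed _ _ (cvg_comp _ _ pair_lim (@q_cont (xs, wbar)))).
  by apply: filterS xF => w [].
have fxs : f xs wbar <= f xbar wbar.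
  have flim : f (x w) w @[w --> F] --> f xs wbar.
    exact: (cvg_comp _ _ pair_lim (@f_cont (xs, wbar))).
  apply/ler_addgt0Pr => e e0; apply: (cvgr_to_le flim).
  have fe : \forall z \near (xbar, wbar), f z.1 z.2 <= f xbar wbar + e.
    by apply: (cvgr_le _ (@f_cont (xbar, wbar))); rewrite ltrDl.
  have [[U1 W1] /= [/nbhs_normP[r1 /= r10 rU1] nW1] UW1] := fe.
  have rr0 : 0 < Num.min r r1 by rewrite lt_min r0.
  have W1F : \forall w \near F, W1 w by exact: BF.
  have feasF : \forall w \near F, exists2 z, `|z - xbar| < Num.min r r1 & P (q z w).
    by apply: BF; exact: feas.
  apply: filterS3 xF W1F feasF => w [_ _ xmin] W1w [z zr Pz].
  have [zr1 zr2] : `|z - xbar| < r /\ `|z - xbar| < r1.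
    by split; apply: (lt_le_trans zr); rewrite ge_min lexx ?orbT.
  rewrite (le_trans (xmin z (ltW zr1) Pz))//.
  by apply: (UW1 (z, w)); split=> //=; apply: rU1; rewrite /= distrC.
have xsE : xs = xbar.
  have [_ Vxs] := rUV _ Bxs.
  have : ((eta * enorm (xs - xbar) ^+ 2)%:E <= 0)%E.
    apply: (le_trans (essV _ Vxs)); rewrite ge_max lee_fin subr_le0 fxs/=.
    apply: ereal_inf_lbound; exists (q xs wbar) => //.
    by rewrite subrr /enorm dotr0l sqrtr0.
  rewrite lee_fin pmulr_rle0// sqr_enorm => xs0.
  apply/eqP; rewrite -subr_eq0; apply/eqP/dotr_eq0/eqP.
  by rewrite eq_le xs0 dotr_ge0.
rewrite xsE in xlim.
have xr : \forall w \near F, `|x w - xbar| < r.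
  by move/cvgr_distC_lt : xlim; exact.
have /filter_ex[w [[nw xwr] [Bx Px xmin]]] : F (([set w |
      ~ (local_minimizers (f ^~ w) (q ^~ w) P `&` U !=set0)] `&`
    [set w | `|x w - xbar| < r]) `&` [set w | [/\ B (x w), P (q (x w) w) &
      forall z, B z -> P (q z w) -> f (x w) w <= f z w]]).
  by apply: filterI => //; exact: filterI.
apply: nw; exists (x w); split; last by have [] := rUV _ Bx.
split=> //.
have nB : \forall z \near x w, B z.
  have lim : continuous (fun z : 'rV[R]_n => `|z - xbar|).
    by move=> z; exact: (cvg_norm (cvgB cvg_id (cvg_cst _))).
  by apply: (cvgr_le _ (lim (x w))).
by apply: filterS nB => z Bz Pz; exact: xmin.
Qed.

End Existence.

Lemma FOSCMS_SOSCMS (R : realType) n m (G : 'rV[R]_n -> 'rV[R]_m)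
    (P : set 'rV[R]_m) (x : 'rV[R]_n) : FOSCMS G P x -> SOSCMS G P x.
Proof. by move=> fo u u0 uT lam lamJ lamN _; exact: (fo u). Qed.

Unset Implicit Arguments.

Theorem theorem4 (R : realType) (n m : nat) (Omega : topologicalType)
    (f : 'rV[R]_n -> Omega -> R) (q : 'rV[R]_n -> Omega -> 'rV[R]_m)
    (P : set 'rV[R]_m) (xbar : 'rV[R]_n) (wbar : Omega)
    (f_cont : continuous (fun z : 'rV[R]_n * Omega => f z.1 z.2))
    (q_cont : continuous (fun z : 'rV[R]_n * Omega => q z.1 z.2))
    (P_poly : polyhedral_union P)
    (fq_smooth : standing_assumption f q xbar wbar)
    (xbar_feas : feasible (q ^~ wbar) P xbar) :
  (FOSCMS (q ^~ wbar) P xbar ->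
   RSSOSC (f ^~ wbar) (q ^~ wbar) P xbar ->
   exists (U : set 'rV[R]_n) (W : set Omega) (L : R),
     [/\ nbhs xbar U, nbhs wbar W, 0 < L,
         (forall w, W w ->
            (M_stationary (f ^~ w) (q ^~ w) P
               `|` stationary (f ^~ w) (q ^~ w) P) `&` U
            `<=` ball_at xbar (L * tau_ f q xbar wbar 1 w))
       & ess_local_min2 (f ^~ wbar) (q ^~ wbar) P xbar ->
         Tlin (q ^~ wbar) P xbar <> [set 0] \/
         metrically_regular (constraint_map (q ^~ wbar) P) xbar 0 ->
         forall w, W w ->
           local_minimizers (f ^~ w) (q ^~ w) P `&` U !=set0])
  /\
  (SOSCMS (q ^~ wbar) P xbar ->
   ess_local_min2 (f ^~ wbar) (q ^~ wbar) P xbar ->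
   exists (U : set 'rV[R]_n) (W : set Omega) (L : R),
     [/\ nbhs xbar U, nbhs wbar W, 0 < L,
         (forall w, W w ->
            (M_stationary (f ^~ w) (q ^~ w) P
               `|` stationary (f ^~ w) (q ^~ w) P) `&` U
            `<=` ball_at xbar (L * tau_ f q xbar wbar 2 w))
       & Tlin (q ^~ wbar) P xbar <> [set 0] \/
         metrically_regular (constraint_map (q ^~ wbar) P) xbar 0 ->
         forall w, W w ->
           local_minimizers (f ^~ w) (q ^~ w) P `&` U !=set0]).
Proof.
have smooth := standing_smooth_data fq_smooth.
have exist : SOSCMS (q ^~ wbar) P xbar ->
    ess_local_min2 (f ^~ wbar) (q ^~ wbar) P xbar ->
    Tlin (q ^~ wbar) P xbar <> [set 0] \/
      metrically_regular (constraint_map (q ^~ wbar) P) xbar 0 ->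
    forall U, nbhs xbar U ->
    \forall w \near wbar, local_minimizers (f ^~ w) (q ^~ w) P `&` U !=set0.
  move=> so ess nondeg U nU.
  apply: (local_minimizer_nearby f_cont q_cont P_poly ess nU) => rho rho0.
  exact: (feasible_nearby q_cont P_poly smooth).
split=> [fo rss|so ess].
- have [U [W [L [nU nW L0 est]]]] :=
    stability_estimate1 q_cont P_poly smooth xbar_feas fo rss.
  have [[ess nondeg]|none] := pselect (ess_local_min2 (f ^~ wbar) (q ^~ wbar) P xbar /\
      (Tlin (q ^~ wbar) P xbar <> [set 0] \/
        metrically_regular (constraint_map (q ^~ wbar) P) xbar 0)).
    have nW' := exist (FOSCMS_SOSCMS fo) ess nondeg U nU.
    exists U, (W `&` [set w | local_minimizers (f ^~ w) (q ^~ w) P `&` U !=set0]), L.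
    split=> //; first exact: filterI.
      by move=> w [Ww _]; exact: est.
    by move=> _ _ w [].
  by exists U, W, L; split=> // ess nondeg; case: none.
- have [U [W [L [nU nW L0 est]]]] :=
    stability_estimate2 q_cont P_poly smooth xbar_feas so ess.
  have [nondeg|none] := pselect (Tlin (q ^~ wbar) P xbar <> [set 0] \/
        metrically_regular (constraint_map (q ^~ wbar) P) xbar 0).
    have nW' := exist so ess nondeg U nU.
    exists U, (W `&` [set w | local_minimizers (f ^~ w) (q ^~ w) P `&` U !=set0]), L.
    split=> //; first exact: filterI.
      by move=> w [Ww _]; exact: est.
    by move=> _ w [].
  by exists U, W, L; split=> // nondeg; case: none.
Qed.
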